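(* Let $(R,I)$ be a standard graded pair over a perfect field of characteristic $p>0$, where $R$ is a two dimensional domain with graded maximal ideal $\mathbf m$. Then $$c^I(\mathbf m)=\alpha(R,I).$$ In particular $c^I(\mathbf m)=c^{IS}(\mathbf mS)$, where $S$ denotes the normalization of $R$ in its quotient field $Q(R)$.
   Context: A standard graded pair $(R,I)$ consists of a Noetherian standard graded ring $R$ over a field and a graded ideal $I$ of finite colength (contained in the graded maximal ideal). For ideals $I,J$ (in a ring of characteristic $p>0$), the $F$-threshold of $J$ with respect to $I$ is $c^I(J)=\lim_{q\to\infty}\frac{\min\{r\mid J^{r+1}\subseteq I^{[q]}\}}{q}$, where $q=p^n$ and $I^{[q]}$ is the ideal generated by the $q$-th powers of elements of $I$. $\alpha(R,I)=\sup\{x\mid f_{R,I}(x)\neq0\}$, where $f_{R,I}:[0,\infty)\to[0,\infty)$, the HK density function, is $f_{R,I}(x)=\lim_{n\to\infty}\frac1q\,\ell\big((R/I^{[q]})_{\lfloor xq\rfloor}\big)$, $q=p^n$ (the limit exists and is a continuous compactly supported function). *)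

(* Defs.v *)
From HB Require Import structures.
From mathcomp Require Import all_boot all_order all_algebra.
From mathcomp Require Import all_classical all_reals all_analysis.
Set Implicit Arguments.
Unset Strict Implicit.
Unset Printing Implicit Defensive.
Import Order.TTheory GRing.Theory Num.Theory.
Local Open Scope classical_set_scope.
Local Open Scope ring_scope.

(* Subsets of rings (ideals, graded pieces, ...) are classical sets; [mem X]  *)
(* views a set as a predicate, as required by [zmod_closed], [idealr_closed]. *)

Definition submodule (K A : nzRingType) (phi : K -> A) (M : set A) : Prop :=
  M 0 /\ forall a x y, M x -> M y -> M (phi a * x + y).

(* Unlike [idealr_closed], this does not exclude the unit ideal. *)
Definition is_ideal (A : comNzRingType) (J : set A) : Prop :=
  submodule idfun J.

Definition ideal_gen (A : comNzRingType) (X : set A) : set A :=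
  smallest (@is_ideal A) X.

Fixpoint ideal_pow (A : comNzRingType) (J : set A) (n : nat) : set A :=
  if n is n'.+1 then
    ideal_gen [set z | exists x y, [/\ J x, ideal_pow J n' y & z = x * y]]
  else [set: A].

Definition frobenius_power (A : comNzRingType) (J : set A) (q : nat) : set A :=
  ideal_gen [set x ^+ q | x in J].

Definition noetherian (A : comNzRingType) : Prop :=
  forall J : set A, is_ideal J -> exists s : seq A, J = ideal_gen [set` s].

Definition prime_ideal (A : comNzRingType) (P : set A) : Prop :=
  idealr_closed (mem P) /\ prime_idealr_closed (mem P).

Definition has_prime_chain (A : comNzRingType) (n : nat) : Prop :=
  exists P : nat -> set A, (forall i, (i <= n)%N -> prime_ideal (P i)) /\
    (forall i, (i < n)%N -> P i `<` P i.+1).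

Definition krull_dim (A : comNzRingType) (n : nat) : Prop :=
  has_prime_chain A n /\ ~ has_prime_chain A n.+1.

(* The length of the K-module M / N, for K-submodules N, M of A with N `<=` M *)
(* (K acting through phi): the supremum of the lengths of chains of           *)
(* submodules between N and M.                                                *)
Definition quo_length (T : realType) (K A : nzRingType) (phi : K -> A)
    (M N : set A) : \bar T :=
  ereal_sup [set (n%:R)%:E | n in [set n : nat | exists C : nat -> set A,
    [/\ forall i, (i <= n)%N -> [/\ submodule phi (C i), N `<=` C i & C i `<=` M]
      & forall i, (i < n)%N -> C i `<` C i.+1]]].

Definition perfect (k : fieldType) (p : nat) (kp : p \in [pchar k]) : Prop :=
  forall a : k, exists b : k, pFrobenius_aut kp b = a.

(* A is a k-algebra through iota; Gr i is the piece of degree i. *)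
Record standard_graded (k : fieldType) (A : comNzRingType)
    (iota : {rmorphism k -> A}) (Gr : nat -> set A) : Prop := StandardGraded {
  graded_zmod : forall i, zmod_closed (mem (Gr i));
  graded_span : forall a : A, exists (n : nat) (c : nat -> A),
    (forall i, Gr i (c i)) /\ a = \sum_(i < n) c i;
  graded_direct : forall (n : nat) (c : nat -> A),
    (forall i, Gr i (c i)) -> \sum_(i < n) c i = 0 ->
    forall i, (i < n)%N -> c i = 0;
  graded_mul : forall i j x y, Gr i x -> Gr j y -> Gr (i + j)%N (x * y);
  graded_0 : Gr 0 = range iota;
  graded_gen :
    smallest (fun B : set A => subring_closed (mem B)) (Gr 0 `|` Gr 1) = setT
}.

Definition homogeneous_ideal (A : comNzRingType) (Gr : nat -> set A)
    (J : set A) : Prop :=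
  is_ideal J /\ forall (n : nat) (c : nat -> A),
    (forall i, Gr i (c i)) -> J (\sum_(i < n) c i) ->
    forall i, (i < n)%N -> J (c i).

Definition graded_maximal (A : comNzRingType) (Gr : nat -> set A) : set A :=
  ideal_gen (\bigcup_(i in [set i : nat | (0 < i)%N]) Gr i).

Record standard_graded_pair (T : realType) (k : fieldType) (A : comNzRingType)
    (iota : {rmorphism k -> A}) (Gr : nat -> set A) (I : set A) : Prop :=
    StandardGradedPair {
  pair_noetherian : noetherian A;
  pair_graded : standard_graded iota Gr;
  pair_homogeneous : homogeneous_ideal Gr I;
  pair_sub : I `<=` graded_maximal Gr;
  pair_colength : (quo_length T (@idfun A) setT I < +oo)%E
}.

(* c^I(J).  Values are taken in \bar T, where the infimum of a set of natural *)
(* numbers is its minimum, and +oo if it is empty.                            *)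
Definition F_threshold (T : realType) (A : comNzRingType) (p : nat)
    (I J : set A) : \bar T :=
  limn (fun n : nat => (((p ^ n)%:R^-1)%:E *
    ereal_inf [set (r%:R)%:E | r in
      [set r : nat | ideal_pow J r.+1 `<=` frobenius_power I (p ^ n)]])%E).

Definition HK_density (T : realType) (k : fieldType) (A : comNzRingType)
    (iota : {rmorphism k -> A}) (Gr : nat -> set A) (p : nat) (I : set A)
    (x : T) : \bar T :=
  limn (fun n : nat => let d := Num.truncn (x * (p ^ n)%:R) in
    (((p ^ n)%:R^-1)%:E *
     quo_length T iota (Gr d) (Gr d `&` frobenius_power I (p ^ n)))%E).

Definition HK_alpha (T : realType) (k : fieldType) (A : comNzRingType)
    (iota : {rmorphism k -> A}) (Gr : nat -> set A) (p : nat) (I : set A) :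
    \bar T :=
  ereal_sup [set x%:E | x in
    [set x : T | 0 <= x /\ HK_density iota Gr p I x <> 0%E]].

Section Normalization.
Variable A : idomainType.

Definition integral_pred : {pred {fraction A}} :=
  fun z => `[< integralOver (@FracField.tofrac A) z >].

Lemma integral_predP (z : {fraction A}) :
  reflect (integralOver (@FracField.tofrac A) z) (z \in integral_pred).
Proof. exact: asboolP. Qed.

Lemma integral_subring_closed : subring_closed integral_pred.
Proof.
split=> [|u v /integral_predP iu /integral_predP iv
         |u v /integral_predP iu /integral_predP iv]; apply/integral_predP.
- exact: integral1.
- exact: integral_sub.
- exact: integral_mul.
Qed.

HB.instance Definition _ :=
  GRing.isSubringClosed.Build {fraction A} integral_pred integral_subring_closed.

Record normalization : predArgType := Normalization {
  norm_val :> {fraction A};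
  norm_valP : norm_val \in integral_pred
}.

HB.instance Definition _ := [isSub for norm_val].
HB.instance Definition _ := [Choice of normalization by <:].
HB.instance Definition _ :=
  [SubChoice_isSubComNzRing of normalization by <:].

Lemma tofrac_integral (a : A) : FracField.tofrac a \in integral_pred.
Proof. by apply/integral_predP; exact: integral_id. Qed.

Definition to_normalization (a : A) : normalization :=
  Normalization (tofrac_integral a).

Definition extend_ideal (J : set A) : set normalization :=
  ideal_gen (to_normalization @` J).

End Normalization.

(* Main.v *)
(** Write [J = I^[q]], [q = p^n], [l_q d] for the dimension of the degree [d]
    part of [A / J], and [E_q] for the least [r] with [A_r] in [J], so that the
    F-threshold is the limit [c] of [(E_q - 1) / q].

    Upper bound for alpha, for [A] and for its normalization [S] at once: if
    [A_r] lies in [J S], clearing denominators puts it in the tight closure of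
    [J], that is, some [c0 <> 0] multiplies all [u^q'], [u] in [A_r], into
    [I^[q q']].  As the [u^q'] generate everything in degrees at least
    [(r + O(1)) q'] and [A / c0] has bounded Hilbert function, the HK density
    vanishes from [(r + O(1)) / q] on.

    Lower bound: let [x < c] be close to [c].  In degrees between [x q] and
    [c q] only the generators of [I] of degree below [c] matter.  If they
    generate an ideal primary to the maximal one, a Koszul complex on two
    parameters shows that [l_q] is convex from there on; being eventually zero
    but nonzero just below [c q], it is at least a multiple of [q] at [x q].
    Otherwise they lie in a graded prime [P] of height one, and monomials in
    some [w] in [P] and a linear form outside [P] stay independent modulo
    [P^[q]].  Finally [l_(p q) (p d) <= p (l_q d) + O(1)], because [A] has rank
    at most [p] over its [p]-th powers in degrees divisible by [p], so for [x]
    with denominator a power of [p] the density is a limit of an almost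
    decreasing sequence, hence exists. *)

(* [limn] of a divergent sequence is an arbitrary default value, so a nonzero [HK_density] can be
   claimed only where convergence has been proved. As [HK_alpha] is a supremum, a dense set of
   points suffices, which is why the lower bound works at [p]-rational [x], where [x q] is
   eventually an integer. Vanishing above the threshold is likewise proved as convergence to zero.
   The limit [c] exists by the same mechanism as the density: [E_(p q) <= p (E_q + nu)] makes
   [E_q / q] almost decreasing. All error terms are constants over [q], uniform in the exponent, and
   disappear in the limit.

   No length is ever taken over [S]. If [D] is the least exponent for [S] at level [q], the density
   of [A] vanishes from [(D + 1 + nu) / q] on; since it is nonzero at points arbitrarily close to
   [c], this quotient is at least [c], and [D / q] is squeezed between two sequences tending to [c].

   Upper bounds on dimensions are expressed by [spanned], which is monotone and additive along exact
   sequences; an exact [dim_mod] is needed only for lower bounds. *)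
Require Import Defs.
From HB Require Import structures.
From mathcomp Require Import all_boot all_order all_algebra.
From mathcomp Require Import all_classical all_reals all_analysis.
From mathcomp Require Import zify ring lra.
Set Implicit Arguments.
Unset Strict Implicit.
Unset Printing Implicit Defensive.
Import Order.TTheory GRing.Theory Num.Theory.
Import numFieldNormedType.Exports.
Local Open Scope classical_set_scope.
Local Open Scope ring_scope.

(** * Dimension modulo a subspace *)

Section LinearAlgebra.
Variables (k : fieldType) (V : lmodType k).
Implicit Types (M N L : set V).

Definition linsub M := M 0 /\ forall a x y, M x -> M y -> M (a *: x + y).

Definition free_mod (I : finType) N (b : I -> V) :=
  forall l : I -> k, N (\sum_i l i *: b i) -> forall i, l i = 0.

Definition spans_mod (I : finType) M N (b : I -> V) :=
  forall u, M u -> exists l : I -> k, N (u - \sum_i l i *: b i).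

(** The spanning vectors need not lie in [M], so the bound passes at once to a smaller [M] and a
    larger [N]. *)
Definition spanned M N n := exists b : 'I_n -> V, spans_mod M N b.

Definition dim_mod M N n :=
  exists b : 'I_n -> V, [/\ forall i, M (b i), free_mod N b & spans_mod M N b].

Lemma linsub0 M : linsub M -> M 0. Proof. by case. Qed.

Lemma linsubD M x y : linsub M -> M x -> M y -> M (x + y).
Proof. by move=> [_ h] Mx My; rewrite -[x]scale1r; apply: h. Qed.

Lemma linsubZ M a x : linsub M -> M x -> M (a *: x).
Proof. by move=> [M0 h] Mx; rewrite -[_ *: _]addr0; apply: h. Qed.

Lemma linsubN M x : linsub M -> M x -> M (- x).
Proof. by move=> hM Mx; rewrite -scaleN1r; apply: linsubZ. Qed.

Lemma linsubB M x y : linsub M -> M x -> M y -> M (x - y).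
Proof. by move=> hM Mx My; apply: linsubD => //; apply: linsubN. Qed.

Lemma linsub_sum M (I : Type) (r : seq I) (P : pred I) (F : I -> V) :
  linsub M -> (forall i, P i -> M (F i)) -> M (\sum_(i <- r | P i) F i).
Proof.
move=> hM hF; elim/big_ind: _ => //; first exact: linsub0.
by move=> x y; apply: linsubD.
Qed.

Lemma linsubI M N : linsub M -> linsub N -> linsub (M `&` N).
Proof.
move=> [M0 hM] [N0 hN]; split=> // a x y [Mx Nx] [My Ny].
by split; [apply: hM|apply: hN].
Qed.

Lemma free_mod_reindex (I J : finType) N (b : I -> V) (f : J -> I) :
  bijective f -> free_mod N b -> free_mod N (b \o f).
Proof.
move=> [g fg gf] hb l hN j.
have := hb (fun i => l (g i)).
rewrite (reindex f) /=; last by exists g => x _.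
under eq_bigr do rewrite fg.
by move=> /(_ hN (f j)); rewrite fg.
Qed.

Lemma spans_mod_reindex (I J : finType) M N (b : I -> V) (f : J -> I) :
  bijective f -> spans_mod M N b -> spans_mod M N (b \o f).
Proof.
move=> bf hb u /hb[l hl]; exists (l \o f).
by rewrite (reindex f) in hl; last exact: onW_bij.
Qed.

Lemma spans_spanned (I : finType) M N (b : I -> V) :
  spans_mod M N b -> spanned M N #|I|.
Proof.
by move=> hb; exists (b \o enum_val); apply: spans_mod_reindex; first exact: enum_val_bij.
Qed.

Lemma free_le_spanned (I : finType) M N (b : I -> V) n : linsub N ->
  (forall i, M (b i)) -> free_mod N b -> spanned M N n -> (#|I| <= n)%N.
Proof.
move=> hN Mb fb [c hc].
have /choice[L hL] i := hc _ (Mb i).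
rewrite leqNgt; apply/negP => ltn.
pose B := \matrix_(i < #|I|, j < n) L (enum_val i) j.
(* More vectors [b] than [c]: the coefficient matrix has a nonzero left kernel, which yields a
   relation among the [b] modulo [N]. *)
have : kermx B != 0.
  rewrite -mxrank_eq0 mxrank_ker subn_eq0 -ltnNge.
  exact: leq_ltn_trans (rank_leq_col _) ltn.
case/rowV0Pn => v /sub_kermxP vB /eqP; apply; apply/rowP => i.
rewrite mxE -[i]enum_valK.
apply: (fb (fun x => v 0 (enum_rank x))).
have -> : \sum_x v 0 (enum_rank x) *: b x =
    \sum_x v 0 (enum_rank x) *: (b x - \sum_j L x j *: c j).
  under [RHS]eq_bigr do rewrite scalerBr.
  rewrite sumrB [X in _ - X](_ : _ = 0) ?subr0 //.
  under eq_bigr do rewrite scaler_sumr.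
  rewrite exchange_big big1 // => j _.
  under eq_bigr do rewrite scalerA.
  rewrite -scaler_suml.
  rewrite (reindex (@enum_val _ (mem I))) /=; last first.
    by apply: onW_bij; exact: enum_val_bij.
  have /rowP/(_ j) := vB; rewrite !mxE => vB0.
  rewrite (_ : \sum_(_ | _) _ = 0) ?scale0r // -[RHS]vB0.
  by apply: eq_bigr => x _; rewrite enum_valK mxE.
by apply: linsub_sum => // x _; apply: linsubZ.
Qed.

Lemma spanned_sub M M' N N' n :
  M `<=` M' -> N' `<=` N -> spanned M' N' n -> spanned M N n.
Proof.
move=> MM NN [b hb]; exists b => u Mu.
by have [l hl] := hb u (MM _ Mu); exists l; apply: NN.
Qed.

Lemma spanned_trans M N L m n :
  spanned M L m -> spanned L N n -> spanned M N (m + n).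
Proof.
move=> [b hb] [c hc].
rewrite -[m]card_ord -[n]card_ord -card_sum.
apply: (@spans_spanned _ M N
  (fun x : 'I_m + 'I_n => match x with inl i => b i | inr j => c j end)).
move=> u /hb[l /hc[l' h]].
exists (fun x : 'I_m + 'I_n => match x with inl i => l i | inr j => l' j end).
by rewrite big_sumType /= opprD addrA.
Qed.

Lemma spanned_leq M N m n : N 0 -> (m <= n)%N -> spanned M N m -> spanned M N n.
Proof.
move=> N0 mn hm; rewrite -(subnKC mn); apply: spanned_trans hm _.
exists (fun=> 0) => u Nu; exists (fun=> 0).
by rewrite big1 ?subr0 // => i _; rewrite scaler0.
Qed.

Lemma free_mod_option m M N (b : 'I_m -> V) u : linsub N ->
  (forall i, M (b i)) -> free_mod N b -> M u ->
  (forall l : 'I_m -> k, ~ N (u - \sum_i l i *: b i)) ->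
  exists b' : 'I_m.+1 -> V, (forall i, M (b' i)) /\ free_mod N b'.
Proof.
move=> hN Mb fb Mu hu.
pose b' (i : option 'I_m) := if i is Some j then b j else u.
have fb' : free_mod N b'.
  move=> l hl.
  have eqs : \sum_i l i *: b' i = l None *: u + \sum_i l (Some i) *: b i.
    rewrite (bigD1 None) //=; congr (_ + _).
    by rewrite (reindex_omap Some id) //=; [apply: eq_bigl => i; rewrite eqxx|case].
  have l0 : l None = 0.
    apply/eqP; case: eqVneq => // ln0; exfalso.
    apply: (hu (fun i => - (l None)^-1 * l (Some i))).
    have -> : u - \sum_i (- (l None)^-1 * l (Some i)) *: b i =
        (l None)^-1 *: (\sum_i l i *: b' i).
      rewrite eqs scalerDr scalerA mulVf // scale1r; congr (_ + _).
      rewrite scaler_sumr -sumrN; apply: eq_bigr => i _.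
      by rewrite -scalerA scaleNr opprK.
    exact: linsubZ.
  case=> [i|//]; apply: (fb (fun i => l (Some i))).
  by rewrite eqs l0 scale0r add0r in hl.
have ce : #|{: option 'I_m}| = m.+1 by rewrite card_option card_ord.
exists (b' \o (fun i => enum_val (cast_ord (esym ce) i))); split.
  by move=> i /=; case: (enum_val _) => //=.
apply: free_mod_reindex fb'; apply: bij_comp; first exact: enum_val_bij.
exact: (Bijective (cast_ordK _) (cast_ordKV _)).
Qed.

(** A free family of maximal size spans, since any vector outside its span could be adjoined; [n]
    bounds these sizes. *)
Lemma dim_mod_exists M N n : linsub N -> spanned M N n ->
  exists2 m, (m <= n)%N & dim_mod M N m.
Proof.
move=> hN hs.
pose P m := `[< exists b : 'I_m -> V, (forall i, M (b i)) /\ free_mod N b >].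
have exP : exists m, P m by exists 0%N; apply/asboolP; exists (fun=> 0); split=> [[]|? _ []].
have ubP m : P m -> (m <= n)%N.
  by move=> /asboolP[b [Mb fb]]; rewrite -[m]card_ord; apply: (free_le_spanned hN Mb fb).
case: (ex_maxnP exP ubP) => m /[dup] /ubP mn /asboolP[b [Mb fb]] mx.
exists m => //; exists b; split=> // u Mu; apply: contrapT => hno.
have [|b' hb'] := free_mod_option hN Mb fb Mu.
  by move=> l hl; apply: hno; exists l.
by have /mx := asboolT (ex_intro _ b' hb' : exists b, _); rewrite ltnn.
Qed.

(** The given spanning vectors may lie outside [M]; trading them for a basis of [M] modulo [N] keeps
    the remainders in [M]. *)
Lemma spanned_cap M N n : linsub M -> linsub N -> spanned M N n -> spanned M (M `&` N) n.
Proof.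
move=> hM hN hs; have [m mn [b [Mb _ sb]]] := dim_mod_exists hN hs.
apply: (@spanned_leq _ _ m) => //; first by split; apply: linsub0.
exists b => u Mu; have [l hl] := sb u Mu; exists l; split=> //.
by apply: linsubB => //; apply: linsub_sum => // i _; apply: linsubZ.
Qed.

Lemma dim_mod_spanned M N n : dim_mod M N n -> spanned M N n.
Proof. by move=> [b [_ _ h]]; exists b. Qed.

Lemma dim_mod_le M N m n : linsub N -> dim_mod M N m -> spanned M N n -> (m <= n)%N.
Proof.
by move=> hN [b [Mb fb _]] hs; rewrite -[m]card_ord; apply: (free_le_spanned hN Mb fb).
Qed.

Lemma free_le_dim (I : finType) M N (b : I -> V) n : linsub N ->
  (forall i, M (b i)) -> free_mod N b -> dim_mod M N n -> (#|I| <= n)%N.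
Proof. by move=> hN Mb fb [c [_ _ hc]]; apply: (free_le_spanned hN Mb fb); exists c. Qed.

End LinearAlgebra.

(** [M] modulo the preimage of [N'] embeds into [M'] modulo [N']; a basis of the image is lifted. *)
Lemma spanned_preim (k : fieldType) (V W : lmodType k) (phi : V -> W)
    (M : set V) (M' N' : set W) n :
  linear phi -> linsub N' -> (forall u, M u -> M' (phi u)) -> spanned M' N' n ->
  spanned M (phi @^-1` N') n.
Proof.
move=> lphi hN hphi hs.
pose phiL : {linear V -> W} := HB.pack phi (GRing.isLinear.Build k V W *:%R phi lphi).
have phi0 : phi 0 = 0 := linear0 phiL.
have phiB u v : phi (u - v) = phi u - phi v := linearB phiL u v.
have phiZ a u : phi (a *: u) = a *: phi u := linearZ_LR phiL a u.
have phi_sum I (r : seq I) P F : phi (\sum_(i <- r | P i) F i) = \sum_(i <- r | P i) phi (F i).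
  exact: (linear_sum phiL).
have [m mn [c [Mc fc sc]]] : exists2 m, (m <= n)%N & dim_mod (phi @` M) N' m.
  apply: dim_mod_exists => //; apply: spanned_sub hs => // _ [u Mu <-].
  exact: hphi.
have /choice[c' hc'] i : exists u, M u /\ phi u = c i.
  by have [u] := Mc i; exists u.
apply: (@spanned_leq _ _ _ _ m) => //; first by rewrite /= phi0; apply: linsub0.
exists c' => u Mu; have [|l hl] := sc (phi u); first by exists u.
exists l; rewrite /= phiB phi_sum.
by under eq_bigr => i _ do rewrite phiZ (hc' i).2.
Qed.

Lemma dim_mod_pair (k : fieldType) (V : lmodType k) (M N : set V) n m :
  linsub M -> linsub N -> dim_mod M N n ->
  spanned [set u : V * V | M u.1 /\ M u.2] [set u | N u.1 /\ N u.2] m ->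
  (n + n <= m)%N.
Proof.
move=> hM hN [b [Mb fb _]] hs; rewrite -[n]card_ord -card_sum.
pose b' (x : 'I_n + 'I_n) : V * V :=
  match x with inl i => (b i, 0) | inr j => (0, b j) end.
have N2 : linsub [set u : V * V | N u.1 /\ N u.2].
  split=> [|a x y [] ? ? [] ? ?]; first by split; apply: linsub0.
  by split; apply: hN.2.
apply: (@free_le_spanned _ _ _ [set u : V * V | M u.1 /\ M u.2] _ b' _ N2) hs.
  by case=> i /=; split=> //; apply: linsub0.
move=> l; rewrite /= !raddf_sum /= !big_sumType /=.
rewrite [X in _ + X]big1 ?addr0; last by move=> i _; rewrite scaler0.
rewrite [X in X + _]big1 ?add0r; last by move=> i _; rewrite scaler0.
by move=> [h1 h2] [] i; [apply: (fb (l \o inl))|apply: (fb (l \o inr))].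
Qed.

(** * Ideals and lengths *)

Section Ideals.
Variable A : comNzRingType.
Implicit Types (J : set A) (X : set A).

Lemma ideal0 J : is_ideal J -> J 0. Proof. by case. Qed.

Lemma idealD J x y : is_ideal J -> J x -> J y -> J (x + y).
Proof. by move=> [_ h] Jx Jy; rewrite -[x]mul1r; apply: h. Qed.

Lemma idealMl J a x : is_ideal J -> J x -> J (a * x).
Proof. by move=> [J0 h] Jx; rewrite -[_ * _]addr0; apply: h. Qed.

Lemma idealMr J a x : is_ideal J -> J x -> J (x * a).
Proof. by rewrite mulrC; apply: idealMl. Qed.

Lemma idealN J x : is_ideal J -> J x -> J (- x).
Proof. by move=> hJ Jx; rewrite -mulN1r; apply: idealMl. Qed.

Lemma idealB J x y : is_ideal J -> J x -> J y -> J (x - y).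
Proof. by move=> hJ Jx Jy; apply: idealD => //; apply: idealN. Qed.

Lemma ideal_sum J (I : Type) (r : seq I) (P : pred I) (F : I -> A) :
  is_ideal J -> (forall i, P i -> J (F i)) -> J (\sum_(i <- r | P i) F i).
Proof.
move=> hJ hF; elim/big_ind: _ => //; first exact: ideal0.
by move=> x y; apply: idealD.
Qed.

Lemma ideal_genP X : is_ideal (ideal_gen X).
Proof.
split=> [J [hJ _]|a x y hx hy J hJ]; first exact: ideal0.
by case: (hJ) => -[_ h] _; apply: h; [apply: hx|apply: hy].
Qed.

Lemma ideal_gen_sub X J : is_ideal J -> X `<=` J -> ideal_gen X `<=` J.
Proof. by move=> hJ XJ x; apply. Qed.

Lemma sub_ideal_gen X : X `<=` ideal_gen X.
Proof. by move=> x Xx J [_]; apply. Qed.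

Lemma ideal_genE X u : ideal_gen X u -> exists (n : nat) (r x : 'I_n -> A),
  (forall i, X (x i)) /\ u = \sum_i r i * x i.
Proof.
apply: (@ideal_gen_sub X [set u | exists (n : nat) (r x : 'I_n -> A),
  (forall i, X (x i)) /\ u = \sum_i r i * x i]).
  split=> [|a _ _ [n [r [x [hx ->]]]] [m [s [y [hy ->]]]]].
    by exists 0%N, (fun=> 0), (fun=> 0); rewrite big_ord0; split=> [[]|].
  exists (n + m)%N, (fun i : 'I_(n + m) => match fintype.split i with inl i => a * r i | inr j => s j end),
    (fun i : 'I_(n + m) => match fintype.split i with inl i => x i | inr j => y j end); split.
    by move=> i; case: (fintype.split i).
  rewrite big_split_ord /= mulr_sumr; congr (_ + _); apply: eq_bigr => i _.
    by rewrite -[lshift m i]/(unsplit (inl i)) unsplitK mulrA.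
  by rewrite -[rshift n i]/(unsplit (inr i)) unsplitK.
move=> x Xx; exists 1%N, (fun=> 1), (fun=> x); split=> //.
by rewrite big_ord1 mul1r.
Qed.

Lemma ideal_gen_seq (s : seq A) u : ideal_gen [set` s] u ->
  exists r : 'I_(size s) -> A, u = \sum_i r i * s`_i.
Proof.
apply: (@ideal_gen_sub [set` s] [set u | exists r : 'I_(size s) -> A,
  u = \sum_i r i * s`_i]).
  split=> [|a _ _ [r ->] [r' ->]].
    by exists (fun=> 0); rewrite big1 // => i _; rewrite mul0r.
  exists (fun i => a * r i + r' i).
  rewrite mulr_sumr -big_split /=; apply: eq_bigr => i _.
  by rewrite mulrDl mulrA.
move=> x /= xs; have h : (index x s < size s)%N by rewrite index_mem.
exists (fun i => (i == Ordinal h)%:R).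
rewrite (bigD1 (Ordinal h)) //= eqxx mul1r nth_index // big1 ?addr0 // => i /negPf ->.
by rewrite mul0r.
Qed.

(** A counterexample starts a strictly ascending chain of counterexamples, whose union is finitely
    generated. The predicate [Q] restricts the induction to graded ideals. *)
Lemma noetherian_ind (Q : set A -> Prop) (Phi : set A -> Prop) : noetherian A ->
  (forall J, Q J -> is_ideal J) ->
  (forall J, Q J -> (forall J', Q J' -> J `<` J' -> Phi J') -> Phi J) ->
  forall J, Q J -> Phi J.
Proof.
move=> hA hQ step J0 QJ0; apply: contrapT => nJ0.
pose B := {J : set A | Q J /\ ~ Phi J}.
have nxt (J : B) : exists J' : B, sval J `<` sval J'.
  case: J => J [QJ nJ] /=; apply: contrapT => hno; apply: nJ.
  apply: step => // J' QJ' JJ'; apply: contrapT => nJ'.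
  by apply: hno; exists (exist _ J' (conj QJ' nJ')).
have [f hf] := choice nxt.
pose F n := sval (iter n f (exist _ J0 (conj QJ0 nJ0))).
have FS n : F n `<` F n.+1 by apply: hf.
have Fle m n : (m <= n)%N -> F m `<=` F n.
  elim: n => [|n IH]; first by rewrite leqn0 => /eqP ->.
  rewrite leq_eqVlt => /orP[/eqP -> //|/IH h]; apply: subset_trans h _.
  by have [] := FS n.
have Fi n : is_ideal (F n) by rewrite /F; case: (iter _ _ _) => J [] /= /hQ.
pose U := [set x | exists n, F n x].
have hU : is_ideal U.
  split=> [|a x y [n hx] [m hy]]; first by exists 0%N; apply: ideal0.
  exists (maxn n m); apply: (Fi _).2; first exact: Fle (leq_maxl _ _) _ hx.
  exact: Fle (leq_maxr _ _) _ hy.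
have [s hs] := hA U hU.
have [N hN] : exists N, [set` s] `<=` F N.
  have : [set` s] `<=` U by rewrite hs; apply: sub_ideal_gen.
  elim: s {hs} => [|x s IH] h; first by exists 0%N.
  have [N hN] : exists N, [set` s] `<=` F N.
    by apply: IH => y ys; apply: h; rewrite /= inE ys orbT.
  have [M hM] : U x by apply: h; rewrite /= inE eqxx.
  exists (maxn N M) => y /=; rewrite inE => /orP[/eqP ->|ys].
    exact: Fle (leq_maxr _ _) _ hM.
  exact: Fle (leq_maxl _ _) _ (hN _ ys).
have [_] := FS N; apply => x hx.
apply: (ideal_gen_sub (Fi N) hN); rewrite -hs; by exists N.+1.
Qed.

End Ideals.

Section RestrictScalars.
Variables (k : fieldType) (A : comNzRingType) (iota : {rmorphism k -> A}).

(* The [let] keeps [iota] in the type, whence the scalar multiplication is inferred. *)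
Definition restrict_scalars : Type := let _ := iota in A.
Local Notation V := restrict_scalars.

HB.instance Definition _ := GRing.Zmodule.copy V A.

Lemma rs_scaleA a b (v : V) : iota a * (iota b * (v : A)) = iota (a * b) * (v : A).
Proof. by rewrite rmorphM mulrA. Qed.
Lemma rs_scale1 : left_id 1 (fun a (v : V) => iota a * (v : A) : V).
Proof. by move=> v; rewrite rmorph1 mul1r. Qed.
Lemma rs_scaleDr : right_distributive (fun a (v : V) => iota a * (v : A) : V) +%R.
Proof. by move=> a u v; apply: mulrDr. Qed.
Lemma rs_scaleDl (v : V) : {morph (fun a => iota a * (v : A) : V) : a b / a + b}.
Proof. by move=> a b; rewrite rmorphD mulrDl. Qed.

HB.instance Definition _ := GRing.Zmodule_isLmodule.Build k V
  rs_scaleA rs_scale1 rs_scaleDr rs_scaleDl.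

Lemma rs_scaleE (a : k) (v : V) : a *: v = iota a * (v : A). Proof. by []. Qed.

Lemma ideal_linsub (J : set A) : is_ideal J -> linsub (J : set V).
Proof. by move=> [J0 h]; split=> // a x y; apply: h. Qed.

(** Vectors picked from the successive steps of a chain are free modulo [N]; conversely a basis
    gives a flag of full length. *)
Lemma quo_length_dim (T : realType) (M N : set A) n :
  linsub (M : set V) -> linsub (N : set V) -> N `<=` M ->
  dim_mod (M : set V) N n -> quo_length T iota M N = (n%:R)%:E.
Proof.
move=> hM hN NM hd; apply/eqP; rewrite eq_le; apply/andP; split.
  apply: ge_ereal_sup => _ [m [C [hC sC]] <-]; rewrite lee_fin ler_nat.
  have /choice[c hc] (i : 'I_m) : exists c, C i.+1 c /\ ~ C i c.
    have [_] := sC i (ltn_ord i); move/existsNP => [c /not_implyP[? ?]].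
    by exists c.
  have Cle i j : (i <= j)%N -> (j <= m)%N -> C i `<=` C j.
    elim: j => [|j IH]; first by rewrite leqn0 => /eqP -> _.
    rewrite leq_eqVlt => /orP[/eqP -> _|h jm]; first by [].
    apply: subset_trans (IH h (ltnW jm)) _.
    by have [] := sC j jm.
  rewrite -[m]card_ord; apply: (@free_le_dim _ V _ M N c) => //.
    move=> i; have [h1 _] := hc i; have [_ _] := hC i.+1 (ltn_ord i); exact.
  move=> l hl i; apply/eqP; apply: contraT => li.
  (* At the last index [j] with nonzero coefficient, the relation would express [c j] by elements of
     [C j]. *)
  case: (@arg_maxnP _ i (fun i => l i != 0) (fun i : 'I_m => i : nat) li) => j lj mx.
  have [_] := hc j; case.
  have [hCj NCj _] := hC j (ltnW (ltn_ord j)).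
  have {}hCj : linsub (C j : set V) by [].
  have -> : c j = (l j)^-1 *: ((\sum_i l i *: (c i : V)) - \sum_(i | i != j) l i *: (c i : V)).
    by rewrite (bigD1 j) //= addrK scalerA mulVf // scale1r.
  apply: linsubZ => //; apply: linsubB => //; first exact: NCj.
  apply: linsub_sum => // i' ne; have [-> |li'] := eqVneq (l i') 0.
    by rewrite scale0r; apply: (linsub0 hCj).
  apply: linsubZ => //; have : (i' <= j)%N := mx _ li'.
  rewrite leq_eqVlt => /orP[/eqP e|lt]; first by rewrite (ord_inj e) eqxx in ne.
  by apply: (Cle i'.+1 j lt (ltnW (ltn_ord j))); have [] := hc i'.
case: hd => b [Mb fb sb]; apply: ereal_sup_ubound.
exists n => //.
(* The flag: the [i]-th term is [N] plus the span of the first [i] basis vectors. *)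
exists (fun i => [set u : A | exists l : 'I_n -> k,
   N ((u : V) - \sum_j l j *: (b j : V)) /\ forall j : 'I_n, (i <= j)%N -> l j = 0]).
split=> i hi.
  split.
  - split=> [|a x y [l [hl l0]] [l' [hl' l0']]].
      exists (fun=> 0); split=> //.
      by rewrite big1 ?subr0; [exact: (linsub0 hN)|move=> j _; rewrite scale0r].
    exists (fun j => a * l j + l' j); split; last first.
      by move=> j ij; rewrite l0 // l0' // mulr0 addr0.
    rewrite (_ : _ - _ = a *: ((x : V) - \sum_j l j *: (b j : V)) + ((y : V) - \sum_j l' j *: (b j : V))).
      by apply: hN.2.
    rewrite scalerBr addrACA -opprD; congr (_ - _).
    rewrite scaler_sumr -big_split /=; apply: eq_bigr => j _.
    by rewrite scalerDl scalerA.
  - move=> u Nu; exists (fun=> 0); split=> //.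
    by rewrite big1 ?subr0 // => j _; rewrite scale0r.
  - move=> u [l [hl _]]; rewrite -[u](subrK (\sum_j l j *: (b j : V))).
    apply: (@linsubD _ V) => //; first exact: NM.
    by apply: linsub_sum => // j _; apply: linsubZ.
split.
  move=> u [l [hl l0]]; exists l; split=> // j ij; apply: l0; exact: ltnW.
move=> /(_ (b (Ordinal hi))) []; last first.
  move=> l [hl l0].
  have := fb (fun j => (j == Ordinal hi)%:R - l j).
  rewrite (eq_bigr (fun j => (j == Ordinal hi)%:R *: (b j : V) - l j *: (b j : V))); last first.
    by move=> j _; rewrite scalerBl.
  rewrite sumrB (bigD1 (Ordinal hi)) //= eqxx scale1r big1 ?addr0; last first.
    by move=> j /negPf ->; rewrite scale0r.
  move=> /(_ hl (Ordinal hi)); rewrite eqxx l0 // subr0 => /eqP.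
  by rewrite oner_eq0.
exists (fun j => (j == Ordinal hi)%:R); split.
  rewrite (bigD1 (Ordinal hi)) //= eqxx scale1r big1 ?addr0 ?subrr; first exact: (linsub0 hN).
  by move=> j /negPf ->; rewrite scale0r.
move=> j; case: eqP => // ->; by rewrite /= ltnn.
Qed.

End RestrictScalars.

(** * Homogeneous components *)

Section Graded.
Variables (k : fieldType) (A : idomainType) (iota : {rmorphism k -> A}).
Variables (Gr : nat -> set A) (hG : standard_graded iota Gr).
Implicit Types (J P : set A) (a b u v : A) (d e : nat).

Lemma gr0 d : Gr d 0.
Proof. by have [+ _] := graded_zmod hG d; rewrite !inE. Qed.

Lemma grB d u v : Gr d u -> Gr d v -> Gr d (u - v).
Proof.
have [_ h] := graded_zmod hG d => hu hv; have := h u v.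
by rewrite !inE; apply; rewrite ?inE.
Qed.

Lemma grN d u : Gr d u -> Gr d (- u).
Proof. by rewrite -sub0r; apply: grB; apply: gr0. Qed.

Lemma grD d u v : Gr d u -> Gr d v -> Gr d (u + v).
Proof. by move=> hu hv; rewrite -[v]opprK; apply: grB => //; apply: grN. Qed.

Lemma gr_sum d (I : Type) (r : seq I) (Q : pred I) (F : I -> A) :
  (forall i, Q i -> Gr d (F i)) -> Gr d (\sum_(i <- r | Q i) F i).
Proof. by move=> h; elim/big_ind: _ => //; [apply: gr0|apply: grD]. Qed.

Lemma grM i j u v : Gr i u -> Gr j v -> Gr (i + j) (u * v).
Proof. exact: (graded_mul hG). Qed.

Lemma gr_iota c : Gr 0 (iota c).
Proof. by rewrite (graded_0 hG); exists c. Qed.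

Lemma gr1 : Gr 0 1.
Proof. by rewrite -(rmorph1 iota); apply: gr_iota. Qed.

Lemma grX d u n : Gr d u -> Gr (d * n) (u ^+ n).
Proof.
move=> hu; elim: n => [|n IH]; first by rewrite muln0; apply: gr1.
by rewrite mulnS exprS; apply: grM.
Qed.

Lemma grZ d c u : Gr d u -> Gr d (iota c * u).
Proof. by move=> hu; rewrite -[d]add0n; apply: grM => //; apply: gr_iota. Qed.

Lemma gr_linsub d : linsub (Gr d : set (restrict_scalars iota)).
Proof. by split=> [|a x y hx hy]; [apply: gr0|apply: grD => //; apply: grZ]. Qed.

Definition graded_poly (p : {poly A}) := forall i, Gr i p`_i.

Lemma graded_poly_ex a : exists p : {poly A}, graded_poly p /\ p.[1] = a.
Proof.
have [n [c [hc ->]]] := graded_span hG a.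
exists (\poly_(i < n) c i); split=> [i|]; first by rewrite coef_poly; case: ifP => _ //;
  apply: gr0.
by rewrite horner_poly; apply: eq_bigr => i _; rewrite expr1n mulr1.
Qed.

(* The decomposition of [a] into homogeneous components, recorded as the *)
(* polynomial whose coefficient of degree [i] is the component of degree [i]. *)
Definition gpoly a : {poly A} := xget 0 [set p | graded_poly p /\ p.[1] = a].

Definition comp d a := (gpoly a)`_d.

Lemma gpolyP a : graded_poly (gpoly a) /\ (gpoly a).[1] = a.
Proof. by have := xgetPex (0 : {poly A}) (graded_poly_ex a). Qed.

Lemma graded_poly0 p : graded_poly p -> p.[1] = 0 -> p = 0.
Proof.
move=> hp; rewrite horner_coef => h0; apply/polyP => i; rewrite coef0.
have [lt|ge] := ltnP i (size p); last exact: nth_default.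
apply: (graded_direct hG (n := size p) (c := fun i => p`_i)) => //.
by rewrite -[RHS]h0; apply: eq_bigr => j _; rewrite expr1n mulr1.
Qed.

Lemma gpoly_eq a p : graded_poly p -> p.[1] = a -> gpoly a = p.
Proof.
move=> hp pa; have [h1 h2] := gpolyP a; apply/eqP; rewrite -subr_eq0; apply/eqP.
apply: graded_poly0; last by rewrite hornerD hornerN h2 pa subrr.
by move=> i; rewrite coefB; apply: grB.
Qed.

Lemma comp_gr d a : Gr d (comp d a). Proof. by have [h _] := gpolyP a. Qed.

Lemma gpoly_gr d u : Gr d u -> gpoly u = u *: 'X^d.
Proof.
move=> hu; apply: gpoly_eq; last by rewrite hornerZ hornerXn expr1n mulr1.
move=> i; rewrite coefZ coefXn; case: eqP => [->|_]; first by rewrite mulr1.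
by rewrite mulr0; apply: gr0.
Qed.

Lemma gpolyD a b : gpoly (a + b) = gpoly a + gpoly b.
Proof.
have [h1 h2] := gpolyP a; have [h3 h4] := gpolyP b.
by apply: gpoly_eq => [i|]; [rewrite coefD; apply: grD|rewrite hornerD h2 h4].
Qed.

(** This is the point of storing components in a polynomial: their convolution is polynomial
    multiplication. *)
Lemma gpolyM a b : gpoly (a * b) = gpoly a * gpoly b.
Proof.
have [h1 h2] := gpolyP a; have [h3 h4] := gpolyP b.
apply: gpoly_eq => [i|]; last by rewrite hornerM h2 h4.
rewrite coefM; apply: gr_sum => j _.
have /subnKC {1}<- : (j <= i)%N by rewrite -ltnS.
exact: grM.
Qed.

Lemma compD d a b : comp d (a + b) = comp d a + comp d b.
Proof. by rewrite /comp gpolyD coefD. Qed.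

Lemma comp0 d : comp d 0 = 0.
Proof. by have := compD d 0 0; rewrite addr0 -{1}[comp d 0]addr0 => /addrI <-. Qed.

Lemma compN d a : comp d (- a) = - comp d a.
Proof. by apply/eqP; rewrite -addr_eq0 -compD addNr comp0. Qed.

Lemma comp_sum d (I : Type) (r : seq I) (Q : pred I) (F : I -> A) :
  comp d (\sum_(i <- r | Q i) F i) = \sum_(i <- r | Q i) comp d (F i).
Proof. by apply: (big_morph (comp d)); [apply: compD|apply: comp0]. Qed.

Lemma comp_id d e u : Gr e u -> comp d u = if d == e then u else 0.
Proof.
move=> hu; rewrite /comp (gpoly_gr hu) coefZ coefXn.
by case: eqP => _; rewrite ?mulr1 ?mulr0.
Qed.

Lemma comp_sumE a : a = \sum_(d < size (gpoly a)) comp d a.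
Proof.
rewrite -{1}(gpolyP a).2 horner_coef.
by apply: eq_bigr => i _; rewrite expr1n mulr1.
Qed.

Lemma comp_sum_leq a n : (size (gpoly a) <= n)%N -> a = \sum_(d < n) comp d a.
Proof.
move=> h; rewrite {1}(comp_sumE a) (big_ord_widen n (fun d => comp d a) h) big_mkcond /=.
by apply: eq_bigr => i _; case: ltnP => // ge; rewrite /comp nth_default.
Qed.

Lemma comp_nz a : a != 0 -> exists d, comp d a != 0.
Proof.
move=> a0; apply: contrapT => h; move/negP: a0; apply; apply/eqP.
rewrite (comp_sumE a) big1 // => i _; apply/eqP/negPn/negP => hi.
by apply: h; exists i.
Qed.

(** Truncated subtraction would give degree 0 when [d < e]; here negative degrees carry only
    zero. *)
Definition compm d e a := if (e <= d)%N then comp (d - e) a else 0.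

Definition grm d e : set A := if (e <= d)%N then Gr (d - e) else [set 0].

Lemma compm_gr d e a : grm d e (compm d e a).
Proof. by rewrite /grm /compm; case: ifP => // _; apply: comp_gr. Qed.

Lemma grm0 d e : grm d e 0.
Proof. by rewrite /grm; case: ifP => // _; apply: gr0. Qed.

Lemma grmD d e u v : grm d e u -> grm d e v -> grm d e (u + v).
Proof.
by rewrite /grm; case: ifP => _ /=; [apply: grD|move=> -> ->; rewrite addr0].
Qed.

Lemma comp_mulr d e a f : Gr e f -> comp d (a * f) = compm d e a * f.
Proof.
move=> hf; rewrite /comp gpolyM (gpoly_gr hf) -scalerAr coefZ coefMXn /compm.
by rewrite ltnNge; case: leqP => _ /=; rewrite ?mulr0 ?mul0r // mulrC.
Qed.

Lemma comp_iota d c a : comp d (iota c * a) = iota c * comp d a.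
Proof. by rewrite mulrC (comp_mulr _ _ (gr_iota c)) /compm subn0 mulrC. Qed.

Definition hideal J := is_ideal J /\ forall d a, J a -> J (comp d a).

Lemma hidealE J : homogeneous_ideal Gr J <-> hideal J.
Proof.
split=> -[hJ h]; split=> //.
  move=> d a; rewrite {1}(comp_sumE a) => /h h'.
  have [lt|ge] := ltnP d (size (gpoly a)); first by apply: (h' _ d lt) => i; apply: comp_gr.
  by rewrite /comp nth_default //; apply: ideal0.
move=> n c hc hs i ni; have := h i _ hs.
rewrite comp_sum (bigD1 (Ordinal ni)) //= big1 ?addr0; last first.
  move=> j ji; rewrite (comp_id _ (hc j)) ifN //; apply: contraNneq ji => e.
  by apply/eqP/ord_inj.
by rewrite (comp_id _ (hc i)) eqxx.
Qed.

Lemma hideal_comp J a : is_ideal J -> (forall d, J (comp d a)) -> J a.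
Proof. by move=> hJ h; rewrite (comp_sumE a); apply: ideal_sum. Qed.

Definition hpiece (I : finType) (f : I -> A) (e : I -> nat) d : set A :=
  [set u | exists2 r : I -> A, forall i, grm d (e i) (r i) & u = \sum_i r i * f i].

Lemma hpieceP (I : finType) (f : I -> A) (e : I -> nat) d (r : I -> A) :
  (forall i, Gr (e i) (f i)) -> Gr d (\sum_i r i * f i) ->
  hpiece f e d (\sum_i r i * f i).
Proof.
move=> hf hu; exists (fun i => compm d (e i) (r i)); first by move=> i; apply: compm_gr.
rewrite -[LHS](_ : comp d (\sum_i r i * f i) = _); last by rewrite (comp_id _ hu) eqxx.
by rewrite comp_sum; apply: eq_bigr => i _; apply: comp_mulr.
Qed.

Hypothesis nA : noetherian A.

Lemma hideal_gens J : hideal J -> exists (I : finType) (f : I -> A) (e : I -> nat),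
  [/\ forall i, Gr (e i) (f i), forall i, J (f i) &
      forall d u, Gr d u -> J u -> hpiece f e d u].
Proof.
move=> [hJ hc]; have [s hs] := nA hJ.
(* Every generator is replaced by all its components, which vanish from degree [m] on. *)
pose m := \max_(a <- s) size (gpoly a).
have Js (i : 'I_(size s)) : J s`_i by rewrite hs; apply: sub_ideal_gen; apply: mem_nth.
exists ('I_(size s) * 'I_m)%type, (fun x : 'I_(size s) * 'I_m => comp x.2 s`_x.1),
  (fun x : 'I_(size s) * 'I_m => x.2 : nat).
split=> [x|x|d u hu]; first exact: comp_gr.
  by apply: hc.
rewrite hs => /ideal_gen_seq[r ur].
have {}ur : u = \sum_(x : 'I_(size s) * 'I_m) r x.1 * comp x.2 s`_x.1.
    rewrite ur -(pair_bigA _ (fun (i : 'I_(size s)) (j : 'I_m) => r i * comp j s`_i)) /=.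
  apply: eq_bigr => i _; rewrite -mulr_sumr -comp_sum_leq //.
  by apply: (@leq_bigmax_seq _ s predT (fun a => size (gpoly a))) => //; apply: mem_nth.
by rewrite ur; apply: hpieceP => [x|]; [apply: comp_gr|rewrite -ur].
Qed.

(** * Homogeneous primes *)

Lemma comp_mul d a b : comp d (a * b) = \sum_(i < d.+1) comp i a * comp (d - i) b.
Proof. by rewrite /comp gpolyM coefM. Qed.

(** Sums of scalar multiples of [d]-fold products of linear forms. Comparing it with [Gr d] turns
    generation of the ring in degree one into a statement degree by degree. *)
Fixpoint prodgr d : set A :=
  if d is d'.+1 then [set u | exists (n : nat) (x v : 'I_n -> A),
    (forall i, Gr 1 (x i) /\ prodgr d' (v i)) /\ u = \sum_i x i * v i]
  else Gr 0.

Lemma prodgr0 d : prodgr d 0.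
Proof.
case: d => [|d]; first exact: gr0.
by exists 0%N, (fun=> 0), (fun=> 0); split=> [[]|]; rewrite ?big_ord0.
Qed.

Lemma prodgrD d u v : prodgr d u -> prodgr d v -> prodgr d (u + v).
Proof.
case: d => [|d]; first exact: grD.
move=> [n [x [w [h ->]]]] [m [y [w' [h' ->]]]].
exists (n + m)%N,
  (fun i : 'I_(n + m) => match fintype.split i with inl i => x i | inr j => y j end),
  (fun i : 'I_(n + m) => match fintype.split i with inl i => w i | inr j => w' j end).
split; first by move=> i; case: (fintype.split i).
rewrite big_split_ord /=; congr (_ + _); apply: eq_bigr => i _.
  by rewrite -[lshift m i]/(unsplit (inl i)) unsplitK.
by rewrite -[rshift n i]/(unsplit (inr i)) unsplitK.
Qed.

Lemma prodgrZ d c u : prodgr d u -> prodgr d (iota c * u).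
Proof.
case: d => [|d]; first exact: grZ.
move=> [n [x [w [h ->]]]]; exists n, (fun i => iota c * x i), w; split.
  by move=> i; have [h1 h2] := h i; split=> //; apply: grZ.
by rewrite mulr_sumr; apply: eq_bigr => i _; rewrite mulrA.
Qed.

Lemma prodgr_sum d (I : Type) (r : seq I) (Q : pred I) (F : I -> A) :
  (forall i, Q i -> prodgr d (F i)) -> prodgr d (\sum_(i <- r | Q i) F i).
Proof. by move=> h; elim/big_ind: _ => //; [apply: prodgr0|apply: prodgrD]. Qed.

Lemma prodgrM d e u v : prodgr d u -> prodgr e v -> prodgr (d + e) (u * v).
Proof.
elim: d u => [|d IH] u; first by rewrite /= (graded_0 hG) => -[c _ <-]; apply: prodgrZ.
move=> [n [x [w [h ->]]]] hv; rewrite mulr_suml.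
exists n, x, (fun i => w i * v); split; last by apply: eq_bigr => i _; rewrite mulrA.
by move=> i; have [h1 h2] := h i; split=> //; apply: IH.
Qed.

Lemma prodgr_gr d u : prodgr d u -> Gr d u.
Proof.
elim: d u => [//|d IH] u [n [x [w [h ->]]]].
apply: gr_sum => i _; have [h1 /IH h2] := h i; exact: (grM h1 h2).
Qed.

Lemma gr_prodgr d u : Gr d u -> prodgr d u.
Proof.
(* [B] is a subring containing degrees 0 and 1, hence everything. *)
pose B := [set a | forall d, prodgr d (comp d a)].
have hB : subring_closed (mem B).
  split; rewrite ?inE.
  - by move=> e; rewrite (comp_id _ gr1); case: eqP => [->|_]; [apply: gr1|apply: prodgr0].
  - move=> x y; rewrite !inE => hx hy e; rewrite compD compN.
    by apply: prodgrD => //; rewrite -mulN1r -(rmorphN1 iota); apply: prodgrZ.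
  - move=> x y; rewrite !inE => hx hy e; rewrite comp_mul; apply: prodgr_sum => i _.
    have /subnKC {1}<- : (i <= e)%N by rewrite -ltnS.
    exact: prodgrM.
have : B u.
  have : [set: A] u by [].
  rewrite -(graded_gen hG) => /(_ B); apply; split=> // x [hx|hx] e.
    by rewrite (comp_id _ hx); case: eqP => [->|_] //; apply: prodgr0.
  rewrite (comp_id _ hx); case: eqP => [->|_]; last exact: prodgr0.
  exists 1%N, (fun=> x), (fun=> 1); rewrite big_ord1 mulr1; split=> // i.
  by split=> //; apply: gr1.
by move=> /(_ d) + hu; rewrite (comp_id _ hu) eqxx.
Qed.

Notation mm := (graded_maximal Gr).

Lemma mmE a : mm a <-> comp 0 a = 0.
Proof.
split.
  apply: (@ideal_gen_sub _ _ [set a | comp 0 a = 0]).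
    split=> [|x u v /= hu hv]; first exact: comp0.
    by rewrite compD comp_mul big_ord1 hu hv mulr0 addr0.
  move=> u [i i0 hu] /=; rewrite (comp_id _ hu); case: eqP => // e.
  by rewrite /= -e in i0.
move=> h; apply: hideal_comp => [|d]; first exact: ideal_genP.
case: d => [|d]; first by rewrite h; apply: ideal0; apply: ideal_genP.
by apply: sub_ideal_gen; exists d.+1 => //; apply: comp_gr.
Qed.

Lemma mm_hideal : hideal mm.
Proof.
split; first exact: ideal_genP.
by move=> d a /mmE h; apply/mmE; rewrite (comp_id _ (comp_gr d a)); case: eqP => // <-.
Qed.

Lemma gr_mm d u : Gr d.+1 u -> mm u.
Proof. by move=> hu; apply: sub_ideal_gen; exists d.+1. Qed.

Lemma lin_gens : exists (I : finType) (x : I -> A), (forall i, Gr 1 (x i)) /\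
  forall d u, Gr d.+1 u -> exists v : I -> A, (forall i, Gr d (v i)) /\ u = \sum_i x i * v i.
Proof.
have [I [f [e [hf fm hp]]]] := hideal_gens mm_hideal.
(* Only generators of degree one matter: those of degree 0 in the maximal ideal are zero, and those
   of higher degree contribute nothing to degree one. *)
exists I, (fun i => if e i == 1%N then f i else 0); split.
  by move=> i; case: eqP => [<-//|_]; apply: gr0.
have h1 y : Gr 1 y -> exists c : I -> A, (forall i, Gr 0 (c i)) /\
    y = \sum_i (if e i == 1%N then f i else 0) * c i.
  move=> hy; have [r hr ->] := hp 1%N y hy (gr_mm hy).
  exists (fun i => if e i == 1%N then r i else 0); split.
    move=> i; case: eqP => [ei|_]; last exact: gr0.
    by have := hr i; rewrite ei /grm.
  apply: eq_bigr => i _; have := hr i; have := hf i; have := fm i; rewrite /grm.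
  case: (e i) => [|[|j]] /=; last by move=> _ _ ->; rewrite mul0r mulr0.
    by move=> /mmE h h'; rewrite (comp_id _ h') eqxx in h; rewrite h mulr0 mul0r.
  by rewrite mulrC.
move=> d u /gr_prodgr[n [y [w [h ->]]]].
have /choice[c hc] i := h1 _ (h i).1.
exists (fun i => \sum_j c j i * w j); split.
  move=> i; apply: gr_sum => j _; rewrite -[d]add0n; apply: grM; first exact: (hc j).1.
  exact: prodgr_gr (h j).2.
under eq_bigr do rewrite (hc _).2 mulr_suml.
rewrite exchange_big; apply: eq_bigr => i _ /=.
by rewrite mulr_sumr; apply: eq_bigr => j _; rewrite mulrA.
Qed.

(** Products of forms of degrees [m] and [n] span degree [m + n], stated as a membership test. *)
Lemma gr_addP m n (J : set A) : is_ideal J ->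
  (forall u v, Gr m u -> Gr n v -> J (u * v)) -> Gr (m + n) `<=` J.
Proof.
have [I [x [hx hg]]] := lin_gens.
move=> hJ; elim: m n => [|m IH] n h u hu.
  by rewrite -[u]mul1r; apply: h => //; apply: gr1.
have [v [hv ->]] := hg _ _ hu; apply: ideal_sum => // i _.
rewrite mulrC; apply: (IH n.+1) => [y w hy hw|].
  have [w' [hw' ->]] := hg _ _ hw; rewrite mulr_sumr; apply: ideal_sum => // j _.
  by rewrite mulrA; apply: h => //; rewrite -addn1; apply: grM.
by rewrite addnS -[(m + n).+1]addn1; apply: grM.
Qed.

Lemma gr_fd d : exists n, spanned (Gr d : set (restrict_scalars iota)) [set 0] n.
Proof.
have [I [x [hx hg]]] := lin_gens.
elim: d => [|d [n [b hb]]].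
  exists 1%N, (fun=> 1) => u; rewrite (graded_0 hG) => -[c _ <-]; exists (fun=> c).
  by rewrite big_ord1 rs_scaleE mulr1 subrr.
exists #|{: I * 'I_n}|.
apply: (@spans_spanned _ (restrict_scalars iota) _ _ _ (fun z => x z.1 * (b z.2 : A))).
move=> u /hg[v [hv ->]].
have /choice[l hl] i := hb _ (hv i).
exists (fun z => l z.1 z.2); apply/eqP; rewrite subr_eq0; apply/eqP.
rewrite -(pair_bigA _ (fun i j => l i j *: (x i * (b j : A) : restrict_scalars iota))) /=.
apply: eq_bigr => i _; have /= /eqP := hl i; rewrite subr_eq0 => /eqP ->.
by rewrite mulr_sumr; apply: eq_bigr => j _; rewrite !rs_scaleE mulrCA.
Qed.

Definition hprime P := [/\ hideal P, ~ P 1 & forall a b, P (a * b) -> P a \/ P b].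

Lemma prime_idealE P : is_ideal P -> ~ P 1 ->
  (forall a b, P (a * b) -> P a \/ P b) -> prime_ideal P.
Proof.
move=> hP P1 hp; split; first split.
- by rewrite !inE; apply: ideal0.
- by apply/negP; rewrite !inE.
- by move=> a x y; rewrite !inE => hx hy; apply: idealD => //; apply: idealMl.
- move=> a b; rewrite !inE => /hp[h|h]; apply/orP; [left|right]; rewrite inE //.
Qed.

Lemma hprime_mm P : hprime P -> P `<=` mm.
Proof.
move=> [[hP hc] P1 _] a /(hc 0%N) h; apply/mmE; have := comp_gr 0 a.
rewrite (graded_0 hG) => -[c _ e]; rewrite -e in h *.
have [->|c0] := eqVneq c 0; first exact: rmorph0.
case: P1; rewrite -(rmorph1 iota) -(mulVf c0) rmorphM; exact: idealMl.
Qed.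

Lemma mm_hprime : hprime mm.
Proof.
split; first exact: mm_hideal.
  by move=> /mmE; rewrite (comp_id _ gr1) eqxx => /eqP; rewrite oner_eq0.
move=> a b /mmE; rewrite comp_mul big_ord1 => /eqP; rewrite mulf_eq0.
by case/orP => /eqP h; [left|right]; apply/mmE.
Qed.

Hypothesis dimA : krull_dim A 2.

(** Otherwise zero, [P], [Q] and the maximal ideal form a chain of length three. *)
Lemma no_hchain P Q : hprime P -> hprime Q -> (exists2 a, P a & a != 0) ->
  P `<=` Q -> ~ Q `<=` P -> mm `<=` Q.
Proof.
move=> hP hQ [a Pa a0] PQ nQP; apply: contrapT => nmQ.
case: dimA => _; apply.
exists (fun i => match i with 0 => [set 0] | 1 => P | 2 => Q | _ => mm end).
split.
  move=> [|[|[|i]]] _; apply: prime_idealE; try by case: hP => -[].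
  - by split=> // b x y -> ->; rewrite mulr0 addr0.
  - by move/eqP; rewrite oner_eq0.
  - by move=> x y /eqP; rewrite mulf_eq0 => /orP[]/eqP; [left|right].
  - by case: hQ => -[].
  - by case: hQ.
  - by case: hQ.
  - exact: ideal_genP.
  - by case: mm_hprime.
  - by case: mm_hprime.
move=> [|[|[|i]]] //= _; split=> //.
- by move=> _ ->; apply: ideal0; case: hP => -[].
- by move=> /(_ a Pa)/eqP; rewrite (negPf a0).
- exact: hprime_mm.
Qed.

Definition addi J a : set A := [set x | exists j r, J j /\ x = j + r * a].

Lemma sub_addi J a : J `<=` addi J a.
Proof. by move=> x hx; exists x, 0; rewrite mul0r addr0. Qed.

Lemma mem_addi J a : is_ideal J -> addi J a a.
Proof. by move=> hJ; exists 0, 1; rewrite mul1r add0r; split=> //; apply: ideal0. Qed.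

Lemma addi_hideal J d a : hideal J -> Gr d a -> hideal (addi J a).
Proof.
move=> [hJ hc] ha; split.
  split; first exact: sub_addi (ideal0 hJ).
  move=> c _ _ [j [r [hj ->]]] [j' [r' [hj' ->]]].
  exists (c * j + j'), (c * r + r'); split; first by apply: hJ.2.
  by rewrite mulrDr mulrDl addrACA mulrA.
move=> e _ [j [r [hj ->]]]; rewrite compD (comp_mulr _ _ ha).
by exists (comp e j), (compm e d r); split=> //; apply: hc.
Qed.

(** Take [a b] in [J] with neither factor in [J], and the lowest components of each not in [J]:
    modulo [J] their product is a component of [a b]. *)
Lemma not_hprime J : hideal J -> ~ J 1 -> ~ hprime J -> exists d e a b,
  [/\ Gr d a, Gr e b, ~ J a, ~ J b & J (a * b)].
Proof.
move=> [hJ hc] J1 nJ.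
have : ~ (forall a b, J (a * b) -> J a \/ J b) by move=> h; apply: nJ; split.
move=> /existsNP[a /existsNP[b /not_implyP[Jab /not_orP[na nb]]]].
have fst_comp x : ~ J x -> exists i, ~ J (comp i x) /\ forall j, (j < i)%N -> J (comp j x).
  move=> nx; have ex : exists i, `[< ~ J (comp i x) >].
    apply: contrapT => h; apply: nx; apply: hideal_comp => // d.
    by apply: contrapT => hd; apply: h; exists d; apply/asboolP.
  case: (ex_minnP ex) => i /asboolP hi mn; exists i; split=> // j ji.
  by apply: contrapT => /asboolP /mn; rewrite leqNgt ji.
have [i [ni mi]] := fst_comp a na; have [j [nj mj]] := fst_comp b nb.
exists i, j, (comp i a), (comp j b); split=> //; try exact: comp_gr.
have := hc (i + j)%N _ Jab; rewrite comp_mul.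
have ilt : (i < (i + j).+1)%N by rewrite ltnS leq_addr.
rewrite (bigD1 (Ordinal ilt)) //= addKn => h.
rewrite -[_ * _](addrK (\sum_(t < (i + j).+1 | t != Ordinal ilt) comp t a * comp (i + j - t) b)).
apply: idealB => //; apply: ideal_sum => // t ne.
have [lt|ge] := ltnP t i; first by apply: idealMr => //; apply: mi.
apply: idealMl => //; apply: mj.
have : (t : nat) != i by apply: contraNneq ne => e; apply/eqP/ord_inj.
by move: ge (ltn_ord t); lia.
Qed.

(* In place of a primary decomposition: a property which holds for the graded *)
(* primes over [J0] and is inherited by [J] from [J + (a)] and [J + (b)] with *)
(* [a b] in [J] holds for [J0].                                               *)
Lemma hideal_prime_ind (Phi : set A -> Prop) J0 : hideal J0 ->
  (forall P, hprime P -> J0 `<=` P -> Phi P) ->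
  (forall J, hideal J -> J 1 -> Phi J) ->
  (forall J d e a b, hideal J -> J0 `<=` J -> Gr d a -> Gr e b -> J (a * b) ->
     Phi (addi J a) -> Phi (addi J b) -> Phi J) ->
  Phi J0.
Proof.
move=> hJ0 hP h1 hab.
apply: (noetherian_ind (Q := fun J => hideal J /\ J0 `<=` J) nA) => //; last by split.
  by move=> J [[]].
move=> J [hJ J0J] IH.
have [J1|J1] := pselect (J 1); first exact: h1.
have [pJ|pJ] := pselect (hprime J); first exact: hP.
have [d [e [a [b [ha hb na nb Jab]]]]] := not_hprime hJ J1 pJ.
have step f x : Gr f x -> ~ J x -> Phi (addi J x).
  move=> hx nx; apply: IH; first split; first exact: addi_hideal hx.
    by apply: subset_trans J0J _; apply: sub_addi.
  split; first exact: sub_addi.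
  by move=> h; apply: nx; apply: h; apply: mem_addi; case: hJ.
by apply: (hab J d e a b) => //; [apply: step ha na|apply: step hb nb].
Qed.

Lemma gr_sub_leq J m n : is_ideal J -> (m <= n)%N -> Gr m `<=` J -> Gr n `<=` J.
Proof.
move=> hJ mn h; rewrite -(subnKC mn); apply: gr_addP => // u v hu hv.
by apply: idealMr => //; apply: h.
Qed.

Lemma gr_sub_addi J a b m n : hideal J -> J (a * b) ->
  Gr m `<=` addi J a -> Gr n `<=` addi J b -> Gr (m + n) `<=` J.
Proof.
move=> [hJ _] Jab hm hn; apply: gr_addP => // u v /hm[j [r [hj ->]]] /hn[j' [r' [hj' ->]]].
rewrite mulrDl; apply: idealD => //; first exact: idealMr.
rewrite mulrDr; apply: idealD => //; first exact: idealMl.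
by rewrite mulrACA; apply: idealMl.
Qed.

Lemma addiAC J a b : addi (addi J a) b = addi (addi J b) a.
Proof.
apply/seteqP; split=> x [_ [r [[j [s [hj ->]]] ->]]].
  by exists (j + r * b), s; split; [exists j, r|rewrite addrAC].
by exists (j + r * a), s; split; [exists j, r|rewrite addrAC].
Qed.

(** [A / P] has dimension one, so the only graded prime over [P + (z)] is the maximal ideal. *)
Lemma prime_param P d z : hprime P -> (exists2 a, P a & a != 0) -> Gr d.+1 z -> ~ P z ->
  exists N, Gr N `<=` addi P z.
Proof.
move=> hP P0 hz nz; have [iP cP] : hideal P by case: hP.
apply: (@hideal_prime_ind (fun J => exists N, Gr N `<=` J)).
- exact: addi_hideal hz.
- move=> Q hQ PQ; exists 1%N.
  have PQ' : P `<=` Q by apply: subset_trans PQ; apply: sub_addi.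
  have := no_hchain hP hQ P0 PQ'.
  have nQP : ~ Q `<=` P by move=> h; apply: nz; apply: h; apply: PQ; apply: mem_addi.
  by move=> /(_ nQP) h; apply: subset_trans h => u; apply: gr_mm.
- by move=> J [hJ _] J1; exists 0%N => u _; rewrite -[u]mulr1; apply: idealMl.
- move=> J e f a b hJ _ _ _ Jab [m hm] [n hn]; exists (m + n)%N; exact: gr_sub_addi hm hn.
Qed.

(** * Hilbert functions *)

Notation V := (restrict_scalars iota).

Definition bounded J := exists C, forall d, spanned (Gr d : set V) J C.

Lemma spanned_zero d J : is_ideal J -> Gr d `<=` J -> spanned (Gr d : set V) J 0.
Proof.
move=> hJ h; exists (fun=> 0) => u hu; exists (fun=> 0).
by rewrite big_ord0 subr0; apply: h.
Qed.

Lemma spanned_Gr0 J : is_ideal J -> spanned (Gr 0 : set V) J 1.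
Proof.
move=> hJ; exists (fun=> 1) => u; rewrite (graded_0 hG) => -[c _ <-]; exists (fun=> c).
by rewrite big_ord1 rs_scaleE mulr1 subrr; apply: ideal0.
Qed.

Lemma gr1_notin J : is_ideal J -> ~ mm `<=` J -> exists2 y, Gr 1 y & ~ J y.
Proof.
move=> hJ h; apply: contrapT => hno; apply: h => a ha.
apply: hideal_comp => // -[|d]; first by rewrite (mmE a).1 //; apply: ideal0.
apply: (@gr_sub_leq J 1 d.+1) (comp_gr _ _) => // y hy.
by apply: contrapT => ny; apply: hno; exists y.
Qed.

(** Multiplication by [y] maps degree [d] of [A / P] onto degree [d + 1]. *)
Lemma spanned_addi d P y n : hideal P -> Gr 1 y -> Gr d.+1 `<=` addi P y ->
  spanned (Gr d : set V) P n -> spanned (Gr d.+1 : set V) P n.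
Proof.
move=> [hP cP] hy hd [b hb]; exists (fun i => y * (b i : A)) => u hu.
have [j [r [hj e]]] := hd u hu.
have {}e : u = comp d.+1 j + comp d r * y.
  have := comp_id d.+1 hu; rewrite eqxx => <-.
  by rewrite e compD (comp_mulr _ _ hy) /compm subn1.
have [l hl] := hb (comp d r) (comp_gr _ _).
exists l; rewrite [u]e.
rewrite (_ : _ - _ = comp d.+1 j + y * (comp d r - \sum_i l i *: (b i : V)) :> A); last first.
  rewrite mulrBr mulr_sumr addrA [y * _]mulrC; congr (_ - _); apply: eq_bigr => i _.
  by rewrite !rs_scaleE mulrCA.
by apply: idealD => //; [apply: cP|apply: idealMl].
Qed.

Lemma bounded_upto J n : is_ideal J ->
  exists C, forall d, (d <= n)%N -> spanned (Gr d : set V) J C.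
Proof.
move=> hJ; elim: n => [|n [C hC]].
  by exists 1%N => d; rewrite leqn0 => /eqP ->; apply: spanned_Gr0.
have [m hm] := gr_fd n.+1; exists (maxn C m) => d.
have J0 : J 0 := ideal0 hJ.
rewrite leq_eqVlt => /orP[/eqP ->|h].
  apply: (@spanned_leq _ V _ _ m) => //; first exact: leq_maxr.
  by apply: spanned_sub hm => // _ ->.
by apply: (@spanned_leq _ V _ _ C) => //; [apply: leq_maxl|apply: hC].
Qed.

(** For a linear form [y] outside [P], multiplication by [y] on [A / P] is onto in large degrees, so
    the Hilbert function is eventually nonincreasing. *)
Lemma bounded_hprime P : hprime P -> (exists2 a, P a & a != 0) -> bounded P.
Proof.
move=> hP P0; have [[iP cP] _ _] := hP.
have [mP|nmP] := pselect (mm `<=` P).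
  exists 1%N => -[|d]; first exact: spanned_Gr0.
  apply: (@spanned_leq _ V _ _ 0) => //; first exact: ideal0.
  by apply: spanned_zero => // u hu; apply: mP; apply: gr_mm hu.
have [y hy ny] := gr1_notin iP nmP.
have [N hN] := prime_param hP P0 hy ny.
have [C hC] := bounded_upto N iP.
exists C => d; have [dN|Nd] := leqP d N; first exact: hC.
rewrite -(subnKC (ltnW Nd)); elim: (d - N)%N => [|n IH]; first by rewrite addn0; apply: hC.
have [iPy _] : hideal (addi P y) by apply: addi_hideal hy.
rewrite addnS; apply: spanned_addi hy _ IH => //.
by apply: gr_sub_leq hN => //; rewrite -addnS leq_addr.
Qed.

(** If [a b] is in [J], then [(J + (a)) / J] is a shifted quotient of [A / (J + (b))], so bounds for
    [J + (a)] and [J + (b)] add up to one for [J]. *)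
Lemma bounded_nonzero J0 : hideal J0 -> (exists2 a, J0 a & a != 0) -> bounded J0.
Proof.
move=> hJ0 [a0 Ja0 a0n]; apply: (hideal_prime_ind hJ0).
- by move=> P hP h; apply: bounded_hprime => //; exists a0 => //; apply: h.
- move=> J [hJ _] J1; exists 0%N => d; apply: spanned_zero => // u _.
  by rewrite -[u]mulr1; apply: idealMl.
move=> J d e a b [hJ cJ] _ ha hb Jab [C1 h1] [C2 h2].
have [iJa _] : hideal (addi J a) by apply: addi_hideal ha.
exists (C1 + C2)%N => t.
apply: (@spanned_trans _ V _ _ (Gr t `&` addi J a)).
  apply: spanned_cap (h1 t); first exact: gr_linsub.
  exact: ideal_linsub.
have [td|dt] := ltnP t d.
  apply: (@spanned_leq _ V _ _ 0) => //; first exact: ideal0.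
  exists (fun=> 0) => u [hu [j [r [hj e']]]]; exists (fun=> 0).
  rewrite big_ord0 subr0; have := comp_id t hu; rewrite eqxx => <-.
  by rewrite e' compD (comp_mulr _ _ ha) /compm leqNgt td mul0r addr0; apply: cJ.
have [c hc] := h2 (t - d)%N; exists (fun i => a * (c i : A)) => u [hu [j [r [hj e']]]].
have {}e' : u = comp t j + comp (t - d) r * a.
  have := comp_id t hu; rewrite eqxx => <-.
  by rewrite e' compD (comp_mulr _ _ ha) /compm dt.
have [l [j' [r' [hj' hl]]]] := hc (comp (t - d) r) (comp_gr _ _).
exists l; rewrite [u]e'.
rewrite (_ : _ - _ = comp t j + a * (comp (t - d) r - \sum_i l i *: (c i : V)) :> A);
  last first.
  rewrite mulrBr mulr_sumr addrA [a * _]mulrC; congr (_ - _); apply: eq_bigr => i _.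
  by rewrite !rs_scaleE mulrCA.
apply: idealD => //; first exact: cJ.
rewrite hl mulrDr; apply: idealD => //; first exact: idealMl.
by rewrite mulrCA; apply: idealMl.
Qed.

Lemma hideal_zero : hideal [set 0].
Proof.
split; first by split=> // a x y -> ->; rewrite mulr0 addr0.
by move=> d _ ->; apply: comp0.
Qed.

Definition mulgr d e c : set A := [set x | exists2 r, grm d e r & x = r * c].

Lemma bounded_mulgr e c : Gr e c -> c != 0 ->
  exists C, forall d, spanned (Gr d : set V) (mulgr d e c) C.
Proof.
move=> hc c0; have h0 := addi_hideal hideal_zero hc.
have [|C hC] := bounded_nonzero h0.
  by exists c => //; apply: mem_addi; case: hideal_zero.
exists C => d; have [ih _] := h0.
apply: spanned_sub (spanned_cap (gr_linsub d) (ideal_linsub iota ih) (hC d)) => //.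
move=> u [hu [j [r [-> ur]]]]; exists (compm d e r); first exact: compm_gr.
have := comp_id d hu; rewrite eqxx => <-.
by rewrite {1}ur add0r (comp_mulr _ _ hc).
Qed.

(** Without linear forms [A] is the field [k], where no prime strictly contains another. *)
Lemma gr1_nonzero : exists2 y, Gr 1 y & y != 0.
Proof.
have [[P [hP sP]] _] := dimA.
have [h01 n01] := sP 0%N isT; have [[_ n1 hl] _] := hP 1%N isT.
apply: contrapT => hno; apply: n01 => a Pa.
have h1 : Gr 1 `<=` [set 0].
  by move=> y hy; apply/eqP/negPn/negP => y0; apply: hno; exists y.
have hd d : Gr d.+1 `<=` [set 0] by apply: gr_sub_leq h1 => //; case: hideal_zero.
have ea : a = comp 0 a.
  rewrite {1}(comp_sum_leq (leqnSn (size (gpoly a)))) big_ord_recl big1 ?addr0 //.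
  move=> i _; exact: (hd i _ (comp_gr _ _)).
have := comp_gr 0 a; rewrite (graded_0 hG) => -[c _ ec].
have [c0|c0] := eqVneq c 0.
  by rewrite ea -ec c0 rmorph0; have [[+ _ _] _] := hP 0%N isT; rewrite inE.
exfalso.
move/negP: n1; apply; rewrite inE.
rewrite -(rmorph1 iota) -(mulVf c0) rmorphM ec -ea.
have := hl (iota c^-1) a 0; rewrite !inE addr0; apply=> //; rewrite ?inE //.
by apply: h01; have [[+ _ _] _] := hP 0%N isT; rewrite inE.
Qed.

(** [A / y] has bounded Hilbert function for a linear form [y], so each degree exceeds the previous
    one by at most a constant. *)
Lemma hilbert_linear : exists K, forall d, spanned (Gr d : set V) [set 0] (K * d.+1).
Proof.
have [y hy y0] := gr1_nonzero; have [C hC] := bounded_mulgr hy y0.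
exists C.+1; elim=> [|d IH].
  rewrite muln1; apply: (@spanned_leq _ V _ _ 1) => //.
  by apply: spanned_Gr0; case: hideal_zero.
rewrite mulnS; apply: (@spanned_leq _ V _ _ (C + C.+1 * d.+1)); rewrite ?leq_add2r //.
apply: spanned_trans (hC d.+1) _.
have [b hb] := IH; exists (fun i => y * (b i : A)) => _ [r hr ->].
have [l /= /eqP] := hb r (eq_ind _ (fun t => Gr t r) hr _ (subn1 d.+1)).
rewrite subr_eq0 => /eqP ->; exists l; apply/eqP; rewrite subr_eq0; apply/eqP.
by rewrite mulr_suml; apply: eq_bigr => i _; rewrite !rs_scaleE -mulrA [y * _]mulrC.
Qed.

Lemma hprimeX P a n : hprime P -> P (a ^+ n.+1) -> P a.
Proof. by move=> [_ _ hp]; elim: n => [//|n IH]; rewrite exprS => /hp[]. Qed.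

Lemma gr_notin P Q : hideal P -> hideal Q -> ~ P `<=` Q ->
  exists d a, [/\ Gr d a, P a & ~ Q a].
Proof.
move=> [_ cP] [hQ _] h; apply: contrapT => hno; apply: h => a Pa.
apply: hideal_comp => // d; apply: contrapT => nQ; apply: hno.
by exists d, (comp d a); split=> //; [apply: comp_gr|apply: cP].
Qed.

Lemma avoid_one (Ps : nat -> set A) n Q : hprime Q -> ~ mm `<=` Q ->
  (forall i, (i < n)%N -> hideal (Ps i)) ->
  (forall i, (i < n)%N -> ~ mm `<=` Ps i -> ~ Ps i `<=` Q) ->
  exists d w, [/\ Gr d.+1 w, ~ Q w &
    forall i, (i < n)%N -> ~ mm `<=` Ps i -> Ps i w].
Proof.
move=> hQ nQ hPs; have [hiQ _ pQ] := hQ.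
elim: n hPs => [|n IH] hPs nPs.
  by have [y hy ny] := gr1_notin hiQ.1 nQ; exists 0%N, y.
have [|i lt|d [w [hw nw Pw]]] := IH; first by move=> i lt; apply: hPs; apply: ltnW.
  by apply: nPs; apply: ltnW.
have [h|h] := pselect (mm `<=` Ps n).
  exists d, w; split=> // i; rewrite ltnS leq_eqVlt => /orP[/eqP ->|lt] //.
  exact: Pw.
have [e [a [ha Pa na]]] := gr_notin (hPs n (ltnSn n)) hiQ (nPs n (ltnSn n) h).
exists (d + e)%N, (w * a); split.
- by rewrite -addSn; apply: grM.
- by move=> /pQ[].
- move=> i; rewrite ltnS leq_eqVlt => /orP[/eqP -> _|lt ni].
    by apply: idealMl => //; have [] := hPs n (ltnSn n).
  by apply: idealMr; [have [] := hPs i (ltnW lt)|apply: Pw].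
Qed.

(** Graded prime avoidance, with inclusions among the primes excluded by dimension two. *)
Lemma avoid (Ps : nat -> set A) n :
  (forall i, (i < n)%N -> hprime (Ps i)) ->
  (forall i, (i < n)%N -> exists2 a, Ps i a & a != 0) ->
  exists d z, [/\ Gr d.+1 z, z != 0 &
    forall i, (i < n)%N -> ~ mm `<=` Ps i -> ~ Ps i z].
Proof.
elim: n => [|n IH] hPs nzPs.
  by have [y hy y0] := gr1_nonzero; exists 0%N, y.
have [|i lt|d [z [hz z0 nz]]] := IH; first by move=> i lt; apply: hPs; apply: ltnW.
  by apply: nzPs; apply: ltnW.
have [hmn|hmn] := pselect (mm `<=` Ps n).
  exists d, z; split=> // i; rewrite ltnS leq_eqVlt => /orP[/eqP -> //|lt].
  exact: nz.
have [Pnz|nPnz] := pselect (Ps n z); last first.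
  exists d, z; split=> // i; rewrite ltnS leq_eqVlt => /orP[/eqP -> //|lt].
  exact: nz.
have hn := hPs n (ltnSn n); have [[hin _] _ _] := hn.
(* Here [z] lies in the last prime, so an earlier prime inside it would be strictly smaller; hence
   some [w] lies in all earlier relevant primes but not in the last. *)
have [|i lt nm sub|e [w [hw nw Pw]]] := @avoid_one Ps n (Ps n) hn hmn.
  by move=> i lt; have [] := hPs i (ltnW lt).
  apply: hmn; apply: no_hchain (hPs i (ltnW lt)) hn (nzPs i (ltnW lt)) sub _.
  by move=> h; apply: (nz i lt nm); apply: h.
(* The exponents give both terms the same degree; each relevant prime contains exactly one of [z]
   and [w]. *)
exists ((e.+1 * d.+1).-1)%N, (z ^+ e.+1 + w ^+ d.+1).
have nin : ~ Ps n (z ^+ e.+1 + w ^+ d.+1).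
  move=> h; apply: nw; apply: (@hprimeX _ _ d hn).
  rewrite -[_ ^+ _](addKr (z ^+ e.+1)); apply: idealD => //.
  by apply: idealN => //; rewrite exprS; apply: idealMr.
split.
- rewrite prednK ?muln_gt0 //; apply: grD; last exact: grX.
  by rewrite mulnC; apply: grX.
- by apply/eqP => h; apply: nin; rewrite h; apply: ideal0.
- move=> i; rewrite ltnS leq_eqVlt => /orP[/eqP -> //|lt] nm h.
  have hi := hPs i (ltnW lt); have [[hii _] _ _] := hi.
  apply: (nz i lt nm); apply: (@hprimeX _ _ e hi).
  rewrite -[_ ^+ _](addrK (w ^+ d.+1)); apply: idealB => //.
  by rewrite exprS; apply: idealMr => //; apply: Pw.
Qed.

(** * Parameters *)

Lemma addi_power y z m N : Gr N `<=` addi (addi [set 0] y) z -> Gr 1 y ->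
  (exists e, Gr e z) -> Gr (m * N) `<=` addi (addi [set 0] (y ^+ m)) z.
Proof.
move=> hN hy [e hz]; elim: m => [|m IH].
  by move=> u _; exists u, 0; rewrite mul0r addr0; split=> //; exists 0, u; rewrite mulr1 add0r.
have [hJ _] : hideal (addi (addi [set 0] (y ^+ m.+1)) z).
  apply: addi_hideal hz; apply: addi_hideal (grX _ hy); exact: hideal_zero.
rewrite mulSn; apply: gr_addP => // u v /hN[_ [s [[_ [r [-> ->]] ->]]]].
move=> /IH[_ [s' [[_ [r' [-> ->]] ->]]]].
exists (r * r' * y ^+ m.+1), (s * (r' * y ^+ m + s' * z) + s' * r * y); split.
  by exists 0, (r * r'); rewrite add0r.
by rewrite !add0r exprS; ring.
Qed.

Lemma parameters : exists d y z N, [/\ Gr d.+1 y, Gr d.+1 z, y != 0, z != 0 &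
  Gr N `<=` addi (addi [set 0] y) z].
Proof.
have [y hy y0] := gr1_nonzero.
have hJ0 := addi_hideal hideal_zero hy.
(* A substitute for the minimal primes over [y]: a finite list whose avoidance makes [z] a parameter
   modulo [y]. *)
have [n [Ps [hPs hz]]] : exists n (Ps : nat -> set A),
    (forall i, (i < n)%N -> hprime (Ps i) /\ addi [set 0] y `<=` Ps i) /\
    forall d z, Gr d.+1 z -> (forall i, (i < n)%N -> ~ mm `<=` Ps i -> ~ Ps i z) ->
      exists N, Gr N `<=` addi (addi [set 0] y) z.
  apply: (@hideal_prime_ind (fun J => exists n (Ps : nat -> set A),
    (forall i, (i < n)%N -> hprime (Ps i) /\ addi [set 0] y `<=` Ps i) /\
    forall d z, Gr d.+1 z -> (forall i, (i < n)%N -> ~ mm `<=` Ps i -> ~ Ps i z) ->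
      exists N, Gr N `<=` addi J z)) => //.
  - move=> P hP yP; exists 1%N, (fun=> P); split=> // d z hz nz.
    have [mP|nmP] := pselect (mm `<=` P).
      by exists 1%N => u hu; apply: sub_addi; apply: mP; apply: gr_mm hu.
    apply: prime_param hz (nz 0%N isT nmP) => //; exists y => //.
    by apply: yP; apply: mem_addi; case: hideal_zero.
  - move=> J [hJ _] J1; exists 0%N, (fun=> set0); split=> // d z _ _.
    by exists 0%N => u _; apply: sub_addi; rewrite -[u]mulr1; apply: idealMl.
  - move=> J d e a b hJ _ ha hb Jab [n [Ps [h1 h2]]] [n' [Ps' [h1' h2']]].
    exists (n + n')%N, (fun i => if (i < n)%N then Ps i else Ps' (i - n)%N); split.
      move=> i; case: (ltnP i n) => [lt _|ge lt]; first exact: h1.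
      by apply: h1'; rewrite ltn_subLR.
    move=> f z hz nz.
    have [|N hN] := h2 f z hz.
      by move=> i lt; have := nz i (ltn_addr _ lt); rewrite lt.
    have [|N' hN'] := h2' f z hz.
      move=> i lt; have := nz (n + i)%N; rewrite ltn_add2l lt => /(_ isT).
      by rewrite ltnNge leq_addr addKn.
    exists (N + N')%N; apply: (@gr_sub_addi _ a b); rewrite 1?addiAC //.
      exact: addi_hideal hz.
    exact: sub_addi.
have [||d [z [hz' z0 nz]]] := @avoid Ps n.
- by move=> i /hPs[].
- move=> i /hPs[_ h]; exists y => //; apply: h; apply: mem_addi.
  by case: hideal_zero.
have [N hN] := hz d z hz' nz.
(* The linear form is raised to the degree of [z], so that both parameters have equal degree. *)
exists d, (y ^+ d.+1), z, (d.+1 * N)%N; split=> //.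
- by have := grX d.+1 hy; rewrite mul1n.
- exact: expf_neq0.
- by apply: addi_power => //; exists d.+1.
Qed.

Definition span_ideal (I : finType) (f : I -> A) : set A :=
  [set u | exists r : I -> A, u = \sum_i r i * f i].

Lemma span_idealP (I : finType) (f : I -> A) : is_ideal (span_ideal f).
Proof.
split=> [|a _ _ [r ->] [s ->]].
  by exists (fun=> 0); rewrite big1 // => i _; rewrite mul0r.
exists (fun i => a * r i + s i); rewrite mulr_sumr -big_split; apply: eq_bigr => i _ /=.
by rewrite mulrDl mulrA.
Qed.

Lemma mem_span_ideal (I : finType) (f : I -> A) i : span_ideal f (f i).
Proof.
exists (fun j => (j == i)%:R); rewrite (bigD1 i) //= eqxx mul1r big1 ?addr0 //.
by move=> j /negPf ->; rewrite mul0r.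
Qed.

Lemma span_ideal_hpiece (I : finType) (f : I -> A) (e : I -> nat) d u :
  (forall i, Gr (e i) (f i)) -> Gr d u -> span_ideal f u -> hpiece f e d u.
Proof. by move=> hf hu [r ur]; rewrite ur; apply: hpieceP => //; rewrite -ur. Qed.

Lemma hpiece_span (I : finType) (f : I -> A) (e : I -> nat) d : hpiece f e d `<=` span_ideal f.
Proof. by move=> u [r _ ->]; exists r. Qed.

Lemma span_ideal_hideal (I : finType) (f : I -> A) (e : I -> nat) :
  (forall i, Gr (e i) (f i)) -> hideal (span_ideal f).
Proof.
move=> hf; split; first exact: span_idealP.
move=> d _ [r ->]; exists (fun i => compm d (e i) (r i)).
by rewrite comp_sum; apply: eq_bigr => i _; apply: comp_mulr.
Qed.

(* A system of parameters [y, z] of degree [N], with its first Koszul homology *)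
(* vanishing in large degrees.                                                *)
Lemma parameters_koszul : exists N y z N0, [/\ (0 < N)%N, (N <= N0)%N, Gr N y & Gr N z] /\
  (forall t u, (N0 <= t)%N -> Gr t u -> exists r s,
     [/\ Gr (t - N) r, Gr (t - N) s & u = y * r + z * s]) /\
  (forall d u v, (N0 <= d)%N -> Gr d u -> Gr d v -> y * u + z * v = 0 ->
     exists w, [/\ Gr (d - N) w, u = z * w & v = - (y * w)]).
Proof.
have [d0 [y [z [M [hy hz y0 z0 hM]]]]] := parameters.
pose N := d0.+1; rewrite -/N in hy hz.
pose N0 := maxn M N.
have spl t u : (N0 <= t)%N -> Gr t u -> exists r s,
     [/\ Gr (t - N) r, Gr (t - N) s & u = y * r + z * s].
  move=> ht hu; have hyz : hideal (addi (addi [set 0] y) z).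
    by apply: addi_hideal hz; apply: addi_hideal hy; apply: hideal_zero.
  have := gr_sub_leq hyz.1 (leq_trans (leq_maxl _ _) ht) hM hu.
  move=> [_ [s [[_ [r [-> ->]] e]]]].
  have Nt : (N <= t)%N := leq_trans (leq_maxr _ _) ht.
  exists (comp (t - N) r), (comp (t - N) s); split; try exact: comp_gr.
  have := comp_id t hu; rewrite eqxx => <-.
  by rewrite e add0r compD (comp_mulr _ _ hy) (comp_mulr _ _ hz) /compm Nt ![_ * comp _ _]mulrC.
(* The colon ideal [(z) : y]. Once the coefficients of its generators have degree at least [N0],
   they lie in [(y, z)]; as [y] times a generator is in [(z)], the colon ideal agrees with [(z)] in
   large degrees. *)
have hQ : hideal [set u | addi [set 0] z (y * u)].
  have [iz cz] := addi_hideal hideal_zero hz; split.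
    split; first by rewrite /= mulr0; apply: ideal0.
    move=> a u v /= hu hv; rewrite mulrDr; apply: idealD => //.
    by rewrite mulrCA; apply: idealMl.
  move=> d u /= /(cz (d + N)%N); rewrite mulrC (comp_mulr _ _ hy) /compm.
  by rewrite leq_addl addnK mulrC.
have [I [f [e [hf Qf hp]]]] := hideal_gens hQ.
pose E := \sum_i e i.
exists N, y, z, (N0 + E)%N; split.
  by split=> //; apply: leq_trans (leq_maxr M N) (leq_addr _ _).
split; first by move=> t u ht; apply: spl; apply: leq_trans ht; apply: leq_addr.
move=> d u v hd hu hv e0.
have hz' := addi_hideal hideal_zero hz.
have [_ [w0 [-> uw]]] : addi [set 0] z u.
  have Qu : [set u | addi [set 0] z (y * u)] u.
    exists 0, (- v) => /=; split=> //; rewrite add0r mulNr [v * z]mulrC.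
    by apply/eqP; rewrite -addr_eq0 e0.
  have [r hr ->] := hp d u hu Qu.
  apply: ideal_sum => [|i _]; first by case: hz'.
  have ei : (e i <= E)%N by rewrite /E (bigD1 i) //= leq_addr.
  have := hr i; rewrite /grm; case: leqP => [ed|lt]; last first.
    by move: (leq_trans lt (leq_trans ei (leq_trans (leq_addl _ _) hd))); rewrite ltnn.
  move=> /spl -[|a [b [_ _ ->]]]; first by move: hd ei; lia.
  rewrite mulrDl -mulrA [a * _]mulrC mulrA; case: hz' => iz _; apply: idealD => //.
    by apply: idealMr => //; apply: Qf.
  by rewrite -mulrA; apply: idealMr => //; apply: mem_addi; case: hideal_zero.
have Nd : (N <= d)%N by apply: leq_trans hd; apply: leq_trans (leq_maxr M N) (leq_addr _ _).
have uw' : u = z * comp (d - N) w0.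
  have := comp_id d hu; rewrite eqxx => <-.
  by rewrite uw add0r (comp_mulr _ _ hz) /compm Nd mulrC.
exists (comp (d - N) w0); split=> //; first exact: comp_gr.
apply: (mulfI z0); apply/eqP; rewrite mulrN -addr_eq0 addrC mulrCA -uw'.
by rewrite e0.
Qed.

(** * Forms of large degree as combinations of [q]-th powers *)

Lemma gr_monomials (I : finType) (x : I -> A) : (forall i, Gr 1 (x i)) ->
  (forall d u, Gr d.+1 u -> exists v : I -> A, (forall i, Gr d (v i)) /\ u = \sum_i x i * v i) ->
  forall n J, is_ideal J -> (forall s : seq I, size s = n -> J (\prod_(i <- s) x i)) ->
  Gr n `<=` J.
Proof.
move=> hx hg; elim=> [|n IH] J hJ hs u hu.
  by have := hs [::] erefl; rewrite big_nil => h; rewrite -[u]mulr1; apply: idealMl.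
have [v [hv ->]] := hg _ _ hu; apply: ideal_sum => // i _.
apply: (IH [set a | J (x i * a)]) (hv i).
  split=> [|a b c /= hb hc]; first by rewrite /= mulr0; apply: ideal0.
  by rewrite mulrDr mulrCA; apply: hJ.2.
by move=> s hsz; have := hs (i :: s); rewrite /= hsz big_cons; apply.
Qed.

Lemma pigeonhole_seq (I : finType) (s : seq I) q : (0 < q)%N -> (0 < #|I|)%N ->
  (#|I| * q <= size s)%N -> exists i, (q <= count_mem i s)%N.
Proof.
move=> q0 I0 hs; apply: contrapT => h.
have lt i : (count_mem i s <= q.-1)%N.
  by rewrite -ltnS prednK // ltnNge; apply/negP => hi; apply: h; exists i.
have : (size s <= #|I| * q.-1)%N.
  rewrite -sum1_size.
  rewrite (eq_bigr (fun j => \sum_(i : I) (j == i : nat))%N); last first.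
    move=> j _; rewrite (bigD1 j) //= eqxx big1 ?addn0 // => i ne.
    by rewrite eq_sym (negPf ne).
  rewrite exchange_big -sum_nat_const; apply: leq_sum => i _ /=.
  by rewrite -big_mkcond /= sum1_count; apply: lt.
by move=> h'; move: (leq_trans hs h'); rewrite leqNgt ltn_pmul2l // prednK ?leqnn.
Qed.

Lemma pigeonhole_gr : exists (I : finType) (x : I -> A),
  [/\ (0 < #|I|)%N, forall i, Gr 1 (x i) & forall q n u, (0 < q)%N ->
    (#|I| * q <= n)%N -> Gr n u ->
    exists v : I -> A, (forall i, Gr (n - q) (v i)) /\ u = \sum_i v i * x i ^+ q].
Proof.
have [I [x [hx hg]]] := lin_gens.
have I0 : (0 < #|I|)%N.
  rewrite lt0n; apply/negP => /eqP I0; have [y hy] := gr1_nonzero.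
  have [v [_ ->]] := hg _ _ hy; rewrite big1 ?eqxx // => i.
  by have := max_card (pred1 i); rewrite I0 card1.
exists I, x; split=> // q n u q0 hn hu.
have hu' : span_ideal (fun i => x i ^+ q) u.
  apply: (gr_monomials hx hg (n := n)) => // [|s hs]; first exact: span_idealP.
  have [i hi] := pigeonhole_seq q0 I0 (leq_trans hn (eq_leq (esym hs))).
  rewrite (bigID (pred1 i)) /=; apply: idealMr; first exact: span_idealP.
  rewrite (eq_bigr (fun=> x i)); last by move=> j /eqP ->.
  rewrite big_const_seq iter_mulr_1 -(subnK hi) exprD.
  apply: idealMl; first exact: span_idealP.
  exact: (@mem_span_ideal _ (fun i => x i ^+ q)).
have hxq i : Gr q (x i ^+ q) by have := grX q (hx i); rewrite mul1n.
have [r hr ->] := @span_ideal_hpiece _ _ (fun=> q) _ _ hxq hu hu'.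
exists r; split=> // i; have := hr i; rewrite /grm ifT //.
by apply: leq_trans hn; apply: leq_pmull.
Qed.

(** With [nu] the number of linear generators, a monomial of degree [(d + nu) q] contains [d]
    factors [x_i ^ q] by repeated pigeonhole, and their product is the [q]-th power of a form of
    degree [d]. *)
Lemma frobenius_gens : exists nu, forall q d J, (0 < q)%N -> is_ideal J ->
  (forall u, Gr d u -> J (u ^+ q)) -> Gr ((d + nu) * q) `<=` J.
Proof.
have [I [x [I0 hx pg]]] := pigeonhole_gr.
exists #|I| => q d J q0; elim: d J => [|d IH] J hJ h u hu.
  by have := h 1 gr1; rewrite expr1n => J1; rewrite -[u]mulr1; apply: idealMl.
have [|v [hv ->]] := pg q _ u q0 _ hu; first by rewrite leq_mul2r leq_addl orbT.
apply: ideal_sum => // i _; rewrite mulrC.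
(* One factor [x_i ^ q] is split off by passing to the colon ideal. *)
apply: (IH [set a | J (x i ^+ q * a)]).
- split=> [|a b c /= hb hc]; first by rewrite /= mulr0; apply: ideal0.
  by rewrite mulrDr mulrCA; apply: hJ.2.
- move=> w hw /=; rewrite -exprMn; apply: h.
  by rewrite -add1n; apply: grM.
- have := hv i; rewrite addSn mulSn.
  by rewrite [(q + _)%N]addnC addnK.
Qed.

(** * Shift and convexity of Hilbert functions *)

Lemma grm_spanned J C d e : is_ideal J -> (forall d, spanned (Gr d : set V) J C) ->
  spanned (grm d e : set V) J C.
Proof.
move=> hJ hC; rewrite /grm; case: ifP => _ //.
apply: (@spanned_leq _ V _ _ 0) => //; first exact: ideal0.
exists (fun=> 0) => u ->; exists (fun=> 0); rewrite big_ord0 subr0; exact: ideal0.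
Qed.

Lemma span_ideal_linsub (I : finType) (F : I -> A) : linsub (span_ideal F : set V).
Proof. exact/ideal_linsub/span_idealP. Qed.

(* The kernel of multiplication by [g] on [A / (F)] is a quotient of          *)
(* [Tor_1 (A / g, A / (F))], whence a bound independent of the degrees of [F]. *)
Lemma spanned_shift e g (I : finType) : Gr e g -> g != 0 ->
  exists C, forall (F : I -> A) (E : I -> nat), (forall i, Gr (E i) (F i)) ->
  forall d n, spanned (Gr (d + e) : set V) (span_ideal F) n ->
    spanned (Gr d : set V) (span_ideal F) (n + C).
Proof.
move=> hg g0; have ig := (addi_hideal hideal_zero hg).1.
have [C0 hC0] : bounded (addi [set 0] g).
  apply: bounded_nonzero (addi_hideal hideal_zero hg) _.
  by exists g => //; apply: mem_addi; case: hideal_zero.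
exists #|{: I * 'I_C0}| => F E hF d n hs.
pose phi (r : V) : V := g * (r : A).
have lphi : linear phi.
  by move=> a u v; rewrite /phi rs_scaleE mulrDr !rs_scaleE mulrCA.
pose J : set V := span_ideal F.
have lJ : linsub J by apply: span_ideal_linsub.
pose K : set V := [set r | Gr d r /\ J (phi r)].
have hK : spanned (Gr d : set V) K n.
  have hpre : spanned (Gr d : set V) (phi @^-1` J) n.
    apply: (@spanned_preim _ V V phi (Gr d) (Gr (d + e)) J n lphi lJ _ hs).
    by move=> u hu; rewrite /phi addnC; apply: grM.
  apply: spanned_cap hpre; first exact: gr_linsub.
  split=> [|a x y hx hy]; first by rewrite /= /phi mulr0; apply: lJ.1.
  by rewrite /= lphi; apply: lJ.2.
apply: spanned_trans hK _.
(* [J / g J] is generated over [A / g] by the family [F], so each degree has dimension at most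
   [#|I| * C0]; and [g x] in [g J] forces [x] in [J]. *)
pose gJ : set V := [set x | exists2 j, J j & x = g * (j : A)].
have lgJ : linsub gJ.
  split=> [|a _ _ [j hj ->] [j' hj' ->]]; first by exists 0; [apply: lJ.1|rewrite mulr0].
  exists (a *: j + j'); first exact: lJ.2.
  by rewrite !rs_scaleE mulrDr mulrCA.
have : spanned K (phi @^-1` gJ) #|{: I * 'I_C0}|.
  apply: (@spanned_preim _ V V phi K (hpiece F E (d + e)) gJ) => //.
    move=> r [hr Jr]; apply: span_ideal_hpiece => //.
    by rewrite /phi addnC; apply: grM.
  have /choice[w hw] i : exists w : 'I_C0 -> V,
      spans_mod (grm (d + e) (E i) : set V) (addi [set 0] g) w.
    by have := grm_spanned (d + e) (E i) ig hC0.
  apply: (@spans_spanned _ V _ _ _ (fun x => (w x.1 x.2 : A) * F x.1)).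
  move=> u [r hr ur].
  have /choice[l hl] i := hw i (r i) (hr i).
  have /choice[s hs'] : forall i, exists s, r i = \sum_j l i j *: (w i j : V) + g * s.
    move=> i; have [_ [s [-> e']]] := hl i; exists s.
    by rewrite addrC mulrC -[s * g]add0r -e' subrK.
  exists (fun x => l x.1 x.2); exists (\sum_i s i * F i : A); first by exists s.
  rewrite ur; apply/eqP; rewrite subr_eq addrC; apply/eqP.
  rewrite -(pair_bigA _ (fun i j => l i j *: ((w i j : A) * F i : V))) mulr_sumr /=.
  rewrite -big_split; apply: eq_bigr => i _ /=.
  rewrite hs' mulrDl mulrA; congr (_ + _); rewrite mulr_suml; apply: eq_bigr => j _.
  by rewrite !rs_scaleE mulrA.
apply: spanned_sub => // r [j hj e'].
by have -> : r = j by apply: (mulfI g0).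
Qed.

(* In degrees away from those of the generators of [J = (F)], the Koszul complex  *)
(* [(A/J)_(d - N) -> (A/J)_d ^ 2 -> (A/J)_(d + N)] on [y, z] is exact, so the     *)
(* Hilbert function of [A / J] is convex there.                                   *)
Lemma dim_mod_convex N y z N0 :
  [/\ (0 < N)%N, (N <= N0)%N, Gr N y & Gr N z] ->
  (forall t u, (N0 <= t)%N -> Gr t u -> exists r s,
     [/\ Gr (t - N) r, Gr (t - N) s & u = y * r + z * s]) ->
  (forall d u v, (N0 <= d)%N -> Gr d u -> Gr d v -> y * u + z * v = 0 ->
     exists w, [/\ Gr (d - N) w, u = z * w & v = - (y * w)]) ->
  forall (I : finType) (F : I -> A) (E : I -> nat) d (a b l : nat),
  (forall i, Gr (E i) (F i)) -> (N0 <= d)%N -> (forall i, F i = 0 \/ (E i + N0 <= d + N)%N) ->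
  spanned (Gr (d - N) : set V) (span_ideal F) a ->
  spanned (Gr (d + N) : set V) (span_ideal F) b ->
  dim_mod (Gr d : set V) (span_ideal F) l -> (l + l <= a + b)%N.
Proof.
move=> [Npos NN0 hy hz] hspl hkos I F E d a b l hF hd hE ha hb hl.
pose J : set V := span_ideal F.
have lJ : linsub J by apply: span_ideal_linsub.
have iJ : is_ideal (span_ideal F) := span_idealP F.
apply: (dim_mod_pair (gr_linsub d) lJ hl).
pose phi (u : V * V) : V := y * (u.1 : A) + z * (u.2 : A).
have lphi : linear phi.
  move=> c u v; rewrite /phi /= !rs_scaleE !mulrDr.
  by rewrite addrACA ![_ * (iota c * _)]mulrCA.
pose M2 : set (V * V) := [set u | Gr d u.1 /\ Gr d u.2].
have hM2 : linsub M2.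
  split=> [|c x w [hx1 hx2] [hw1 hw2]]; first by split; apply: gr0.
  by split; apply: (gr_linsub d).2.
have hpre : linsub (phi @^-1` J).
  split=> [|c x w hx hw]; first by rewrite /= /phi /= !mulr0 addr0; apply: lJ.1.
  by rewrite /= lphi; apply: lJ.2.
rewrite addnC; apply: (@spanned_trans _ _ _ _ (M2 `&` phi @^-1` J)).
  apply: spanned_cap => //; apply: spanned_preim hb => // -[u v] [hu hv].
  by rewrite addnC; apply: grD; apply: grM.
case: ha => c hc.
exists (fun i => (z * (c i : A) : V, - (y * (c i : A)) : V)) => -[u v] [[/= hu hv] hJ].
have [r hr er] : hpiece F E (d + N) (phi (u, v)).
  by apply: span_ideal_hpiece => //; rewrite addnC; apply: grD; apply: grM.
(* A nonzero [F i] has a coefficient of degree at least [N0], which therefore splits along [y] and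
   [z]. *)
have /choice[st hst] : forall i, exists st : A * A,
    [/\ Gr d (st.1 * F i), Gr d (st.2 * F i) & r i * F i = y * (st.1 * F i) + z * (st.2 * F i)].
  move=> i; have [F0|le] := hE i.
    by exists (0, 0); rewrite F0 !mulr0 addr0; split=> //; apply: gr0.
  have Ed : (E i <= d)%N by move: le NN0; lia.
  have := hr i; rewrite /grm ifT; last by apply: leq_trans Ed (leq_addr _ _).
  move=> /hspl -[|s [t [hs ht ->]]]; first by move: le; lia.
  have dE : d = (d + N - E i - N + E i)%N by lia.
  exists (s, t); split=> /=; [rewrite dE; exact: grM|rewrite dE; exact: grM|].
  by rewrite mulrDl !mulrA.
pose j := \sum_i (st i).1 * F i; pose j' := \sum_i (st i).2 * F i.
(* Correcting [u] and [v] by elements of the ideal turns the congruence into an exact relation, to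
   which the Koszul property applies. *)
have [w [hw eu ev]] : exists w, [/\ Gr (d - N) w, u - j = z * w & v - j' = - (y * w)].
  apply: hkos => //.
  - by apply: grB => //; apply: gr_sum => i _; have [] := hst i.
  - by apply: grB => //; apply: gr_sum => i _; have [] := hst i.
  rewrite !mulrBr addrACA -opprD; apply/eqP; rewrite subr_eq0; apply/eqP.
  rewrite -[LHS]/(phi (u, v)) er !mulr_sumr -big_split; apply: eq_bigr => i _ /=.
  by have [] := hst i.
have [m hm] := hc w hw; exists m.
have Jj : J j by exists (fun i => (st i).1).
have Jj' : J j' by exists (fun i => (st i).2).
set w0 := \sum_i m i *: (c i : V) in hm.
have -> : \sum_i m i *: ((z * (c i : A) : V), (- (y * (c i : A)) : V)) =
    ((z * (w0 : A) : V), (- (y * (w0 : A)) : V)).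
  rewrite [LHS]surjective_pairing; congr (_, _); rewrite raddf_sum /=.
    by rewrite mulr_sumr; apply: eq_bigr => i _; rewrite !rs_scaleE mulrCA.
  by rewrite mulr_sumr -sumrN; apply: eq_bigr => i _; rewrite !rs_scaleE mulrN mulrCA.
split=> /=.
  rewrite (_ : _ - _ = j + z * (w - w0) :> A).
    by apply: idealD => //; apply: idealMl.
  by rewrite mulrBr -eu addrA [j + _]addrC subrK.
rewrite (_ : _ - _ = j' - y * (w - w0) :> A).
  by apply: idealB => //; apply: idealMl.
have yw : y * w = j' - v by rewrite -[y * w]opprK -ev opprB.
by rewrite opprK mulrBr yw !opprB addrCA [j' + _]addrC subrK addrC.
Qed.

(** * Unboundedness of the Hilbert function of [A] *)

Lemma powers_free P1 P2 b : is_ideal P1 -> is_ideal P2 -> ~ P2 1 ->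
  (forall x y, P1 (x * y) -> P1 x \/ P1 y) -> P1 `<=` P2 -> P2 b -> ~ P1 b ->
  forall q : {poly k}, P1 (map_poly iota q).[b] -> q = 0.
Proof.
move=> h1 h2 n1 hp P12 b2 b1; elim/poly_ind => [//|q c IH].
rewrite rmorphD rmorphM /= map_polyX map_polyC /= hornerD hornerM hornerX hornerC => h.
(* The constant term lies in [P2], which contains no unit; then [b] can be cancelled because [P1] is
   prime. *)
have c0 : c = 0.
  apply/eqP; apply: contraT => c0; exfalso; apply: n1.
  rewrite -(rmorph1 iota) -(mulVf c0) rmorphM; apply: idealMl => //.
  rewrite -[iota c](addKr ((map_poly iota q).[b] * b)); apply: idealD => //; last exact: P12.
  by apply: idealN => //; apply: idealMl.
move: h; rewrite c0 rmorph0 addr0 => /hp[/IH ->|//].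
by rewrite mul0r add0r.
Qed.

(** The chain of primes supplied by the dimension need not be graded, so dimensions are counted in
    the filtration by degree. *)
Definition grle n : set A := [set a | forall d, (n < d)%N -> comp d a = 0].

Lemma grle_ex a : exists n, grle n a.
Proof.
exists (size (gpoly a)) => d lt; rewrite /comp nth_default //; exact: ltnW.
Qed.

Lemma grle_leq m n : (m <= n)%N -> grle m `<=` grle n.
Proof. by move=> mn a ha d nd; apply: ha; apply: leq_ltn_trans nd. Qed.

Lemma grleM m n a b : grle m a -> grle n b -> grle (m + n) (a * b).
Proof.
move=> ha hb d lt; rewrite comp_mul big1 // => i _.
have [h|h] := ltnP m i; first by rewrite ha // mul0r.
by rewrite hb ?mulr0 //; move: h lt (ltn_ord i); lia.
Qed.

Lemma grleS_spanned n C : spanned (Gr n.+1 : set V) [set 0] C ->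
  spanned (grle n.+1 : set V) (grle n) C.
Proof.
move=> [b hb]; exists b => u hu; have [l /= /eqP] := hb _ (comp_gr n.+1 u).
rewrite subr_eq0 => /eqP e; exists l => d lt.
rewrite -e; change (comp d ((u : A) - comp n.+1 u) = 0).
rewrite compD compN (comp_id _ (comp_gr n.+1 u)).
by case: eqP => [->|ne]; rewrite ?subrr // hu ?subr0 //; move: lt ne; lia.
Qed.

(* Otherwise [A / P 1], for a chain of primes [P 0 < P 1 < P 2], would be finite *)
(* dimensional over [k], hence a field.                                          *)
Lemma hilbert_unbounded : ~ exists C, forall d, spanned (Gr d : set V) [set 0] C.
Proof.
move=> [C hC]; have [[P [hP sP]] _] := dimA.
have prime_facts i : (i <= 2)%N ->
    [/\ is_ideal (P i), ~ P i 1 & forall x y, P i (x * y) -> P i x \/ P i y].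
  move=> /hP[[h0 h1 hl] hp]; split.
  - split=> [|a x y hx hy]; first by rewrite inE in h0.
    by have := hl a x y; rewrite !inE; apply.
  - by move=> h; move/negP: h1; rewrite inE.
  - by move=> x y h; have := hp x y; rewrite !inE => /(_ h)/orP[]; rewrite inE; [left|right].
have [i0 _ _] := prime_facts 0%N isT; have [i1 _ p1] := prime_facts 1%N isT.
have [i2 n2 _] := prime_facts 2%N isT.
have [P01 nP10] := sP 0%N isT; have [P12 nP21] := sP 1%N isT.
have [a [Pa a0]] : exists a, P 1%N a /\ a != 0.
  apply: contrapT => h; apply: nP10 => a Pa; have [->|a0] := eqVneq a 0.
    exact: ideal0.
  by exfalso; apply: h; exists a.
have [b [Pb nb]] : exists b, P 2%N b /\ ~ P 1%N b.
  by apply: contrapT => h; apply: nP21 => b Pb; apply: contrapT => nb; apply: h; exists b.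
have [delta ha] := grle_ex a; have [eb hb] := grle_ex b.
(* One more than the growth of the filtration over [delta] steps, where [delta] bounds the degree of
   [a]. *)
pose n := (C * delta).+1.
pose pw (i : 'I_n) : V := b ^+ i.
have fpw : free_mod (P 1%N : set V) pw.
  move=> l hl i.
  have := powers_free i1 i2 n2 p1 P12 Pb nb (q := \poly_(j < n) (if insub j is Some j' then l j' else 0)).
  have -> : (map_poly iota (\poly_(j < n) (if insub j is Some j' then l j' else 0))).[b] =
     \sum_j l j *: pw j.
    rewrite (@horner_coef_wide _ n); last first.
      by apply: leq_trans (size_poly _ _) (size_poly _ _).
    by apply: eq_bigr => j _; rewrite coef_map coef_poly ltn_ord valK rs_scaleE.
  by move=> /(_ hl)/polyP/(_ i); rewrite coef_poly ltn_ord valK coef0.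
have grleX i : grle (eb * i) (b ^+ i).
  elim: i => [|i IH]; last by rewrite exprS mulnS; apply: grleM.
  by move=> d; rewrite muln0 => d0; rewrite expr0 (comp_id _ gr1) gtn_eqF.
pose D := (eb * n)%N.
have spD m : spanned (grle (D + m) : set V) (grle D) (C * m).
  elim: m => [|m IH].
    rewrite muln0 addn0; exists (fun=> 0) => u hu; exists (fun=> 0).
    by rewrite big_ord0 subr0.
  by rewrite addnS mulnS; apply: spanned_trans (grleS_spanned (hC _)) IH.
have fin m : exists K, spanned (grle m : set V) [set 0] K.
  elim: m => [|m [K hK]].
    exists 1%N, (fun=> 1) => u hu.
    have := comp_gr 0 u; rewrite (graded_0 hG) => -[c _ ec]; exists (fun=> c).
    rewrite big_ord1 rs_scaleE mulr1 ec; apply/eqP; rewrite subr_eq0; apply/eqP.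
    rewrite {1}(comp_sum_leq (leqnSn (size (gpoly u)))) big_ord_recl big1 ?addr0 //.
    by move=> i _; apply: hu.
  by exists (C + K)%N; apply: spanned_trans (grleS_spanned (hC _)) hK.
have l0 : linsub ([set 0] : set V) := ideal_linsub iota hideal_zero.1.
have [K hK] := fin D; have [lD _ [w [Mw fw sw]]] := dim_mod_exists l0 hK.
(* Multiples of [a] lie in [P 1], while powers of [b] are free modulo it: [lD + n] independent
   vectors in a space of dimension at most [lD + C * delta]. *)
pose F (x : 'I_lD + 'I_n) : V := match x with inl i => a * (w i : A) | inr j => pw j end.
have : (#|{: 'I_lD + 'I_n}| <= C * delta + lD)%N.
  apply: (@free_le_spanned _ V _ (grle (D + delta)) [set 0] F) => //.
  - case=> [i|i] /=; first by rewrite addnC; apply: grleM.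
    apply: grle_leq (grleX i); apply: leq_trans (leq_addr _ _).
    by rewrite leq_mul2l (ltnW (ltn_ord i)) orbT.
  - move=> l; rewrite /= big_sumType /=.
    have -> : \sum_i l (inl i) *: (a * (w i : A) : V) = a * (\sum_i l (inl i) *: w i : V).
      by rewrite mulr_sumr; apply: eq_bigr => i _; rewrite !rs_scaleE mulrCA.
    move=> h; have lr j : l (inr j) = 0.
      apply: (fpw (l \o inr)) => /=.
      move/eqP: h; rewrite addrC addr_eq0 => /eqP ->.
      by apply: idealN => //; apply: idealMr.
    case=> // i; apply: (fw (l \o inl)).
    move: h; rewrite [X in _ + X]big1 ?addr0; last by move=> j _; rewrite lr scale0r.
    by move=> /eqP; rewrite mulf_eq0 (negPf a0) => /eqP.
  - by apply: spanned_trans (spD delta) _; exists w.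
by rewrite card_sum !card_ord /n; lia.
Qed.

(** * Graded primes of height one *)

Lemma exists_hprime_over J0 : hideal J0 -> (forall M, ~ Gr M `<=` J0) ->
  exists P, [/\ hprime P, J0 `<=` P & ~ mm `<=` P].
Proof.
move=> hJ0 hM; apply: contrapT => hno.
have : exists M, Gr M `<=` J0.
  apply: (hideal_prime_ind (Phi := fun J => exists M, Gr M `<=` J) hJ0).
  - move=> P hP JP; exists 1%N => u hu; apply: contrapT => nu; apply: hno.
    by exists P; split=> // h; apply: nu; apply: h; apply: gr_mm hu.
  - by move=> J [hJ _] J1; exists 0%N => u _; rewrite -[u]mulr1; apply: idealMl.
  - move=> J d e a b hJ _ _ _ Jab [m hm] [n hn]; exists (m + n)%N; exact: gr_sub_addi hm hn.
by case=> M /hM.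
Qed.

(** Otherwise multiplication by [y] on [A] is onto in large degrees and the Hilbert function is
    bounded. *)
Lemma gr_not_principal y M : Gr 1 y -> ~ Gr M `<=` addi [set 0] y.
Proof.
move=> hy hM; apply: hilbert_unbounded.
have [C hC] := bounded_upto M hideal_zero.1.
exists C => d; have [dM|Md] := leqP d M; first exact: hC.
rewrite -(subnKC (ltnW Md)); elim: (d - M)%N => [|n IH]; first by rewrite addn0; apply: hC.
have [iy _] := addi_hideal hideal_zero hy.
rewrite addnS; apply: spanned_addi hy _ IH; first exact: hideal_zero.
by apply: gr_sub_leq hM => //; rewrite -addnS leq_addr.
Qed.

(** If every [f i] is zero, a prime over them could be zero; a prime over a nonzero linear form is
    taken instead. *)
Lemma hprime_over_nonzero (I : finType) (f : I -> A) (e : I -> nat) :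
  (forall i, Gr (e i) (f i)) -> (forall M, ~ Gr M `<=` span_ideal f) ->
  exists P, [/\ hprime P, exists2 a, P a & a != 0, forall i, P (f i) & ~ mm `<=` P].
Proof.
move=> hf hM.
have [f0|/existsNP[i fi]] := pselect (forall i, f i = 0); last first.
  have [P [hP fP nP]] := exists_hprime_over (span_ideal_hideal hf) hM.
  exists P; split=> //; last by move=> j; apply: fP; apply: mem_span_ideal.
  by exists (f i); [apply: fP; apply: mem_span_ideal|apply/eqP].
have [y hy y0] := gr1_nonzero.
have [P [hP yP nP]] := exists_hprime_over (addi_hideal hideal_zero hy) (fun M => @gr_not_principal y M hy).
have Py : P y by apply: yP; apply: mem_addi; exact: hideal_zero.1.
exists P; split=> //; first by exists y.
by move=> i; rewrite f0; apply: ideal0; case: hP => -[].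
Qed.

Lemma addi_mul J a b x y : is_ideal J -> J (a * b) -> addi J a x -> addi J b y -> J (x * y).
Proof.
move=> hJ Jab [j [r [hj ->]]] [j' [r' [hj' ->]]].
rewrite mulrDl; apply: idealD => //; first exact: idealMr.
rewrite mulrDr; apply: idealD => //; first exact: idealMl.
by rewrite mulrACA; apply: idealMl.
Qed.

(* The local ring [A_P] has dimension one, so a power of [f] lies in [w A_P]. *)
Lemma height_one_power P w d f : hprime P -> ~ mm `<=` P -> P w -> w != 0 -> Gr d w ->
  P f -> exists b n, ~ P b /\ addi [set 0] w (b * f ^+ n).
Proof.
move=> hP nP Pw w0 hw Pf; have [[iP _] P1 pP] := hP.
apply: (hideal_prime_ind (Phi := fun J => exists b n, ~ P b /\ J (b * f ^+ n)) (addi_hideal hideal_zero hw)).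
- move=> Q hQ wQ; have Qw : Q w by apply: wQ; apply: mem_addi; exact: hideal_zero.1.
  have [QP|nQP] := pselect (Q `<=` P).
    exists 1, 1%N; rewrite mul1r expr1; split=> //; apply: contrapT => nQf.
    apply: nP; apply: no_hchain hQ hP _ QP _; first by exists w.
    by move=> h; apply: nQf; apply: h.
  have hiQ : hideal Q by case: hQ.
  have hiP : hideal P by case: hP.
  have [e [b [_ Qb nb]]] := gr_notin hiQ hiP nQP.
  by exists b, 0%N; rewrite expr0 mulr1.
- by move=> J _ J1; exists 1, 0%N; rewrite mulr1.
- move=> J e e' a b [hJ _] _ _ _ Jab [c [n [nc hn]]] [c' [n' [nc' hn']]].
  exists (c * c'), (n + n')%N; split; first by move=> /pP[].
  by rewrite exprD mulrACA; apply: addi_mul hn hn'.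
Qed.

Lemma height_one_power_all P w d (I : finType) (f : I -> A) : hprime P -> ~ mm `<=` P ->
  P w -> w != 0 -> Gr d w -> (forall i, P (f i)) ->
  exists b n, [/\ ~ P b, (0 < n)%N & forall i, addi [set 0] w (b * f i ^+ n)].
Proof.
move=> hP nP Pw w0 hw Pf; have [[iP _] P1 pP] := hP.
have /choice[bn hbn] i : exists bn : A * nat, ~ P bn.1 /\ addi [set 0] w (bn.1 * f i ^+ bn.2).
  by have [b [n ?]] := height_one_power hP nP Pw w0 hw (Pf i); exists (b, n).
have iw := (addi_hideal hideal_zero hw).1.
exists (\prod_i (bn i).1), (\sum_i (bn i).2).+1; split=> //.
  by elim/big_ind: _ => // [x y nx ny /pP[]|i _] //; have [] := hbn i.
move=> i; rewrite (bigD1 i) //= [X in (_ ^+ X.+1)](bigD1 i) //= -addnS exprD.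
by rewrite mulrACA; apply: idealMr => //; have [] := hbn i.
Qed.

Lemma first_nonzero n (l : 'I_n -> k) i0 : l i0 != 0 ->
  exists i, l i != 0 /\ forall j : 'I_n, (j < i)%N -> l j = 0.
Proof.
move=> h; case: (@arg_minnP _ i0 (fun i => l i != 0) (fun i => i : nat) h) => i li mn.
exists i; split=> // j ji; apply/eqP; apply: contraTT ji => /mn; rewrite -leqNgt; exact.
Qed.

(** The family is [y ^ (t - d i) w ^ i]. Multiplication by [b ^ m] carries the powers [f i ^ q] into
    [(w ^ m)]. A relation has the form [w ^ i1 * x0] with [x0] outside [P] and [i1 < m]; cancelling
    [w ^ i1] puts [b ^ m * x0] in [(w)], hence in [P]. *)
Lemma nonprimary_free P w y b n d (I : finType) (f : I -> A) : hprime P -> P w -> w != 0 ->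
  Gr d w -> Gr 1 y -> ~ P y -> ~ P b -> (0 < n)%N ->
  (forall i, addi [set 0] w (b * f i ^+ n)) ->
  forall q t m, (m * n <= q)%N -> (m * d <= t)%N ->
  exists c : 'I_m -> V, (forall i, Gr t (c i)) /\
    free_mod (span_ideal (fun i => f i ^+ q) : set V) c.
Proof.
move=> [[iP _] P1 pP] Pw w0 hw hy nPy nPb n0 hbf q t m mq mt.
have nPX x j : ~ P x -> ~ P (x ^+ j).
  by move=> nx; elim: j => [|j IH]; rewrite ?expr0 // exprS => /pP[].
exists (fun i => y ^+ (t - d * i) * w ^+ i); split.
  move=> i; have le : (d * i <= t)%N.
    by apply: leq_trans mt; rewrite mulnC leq_mul2r (ltnW (ltn_ord i)) orbT.
  rewrite -{1}(subnK le); apply: grM; last exact: grX.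
  by have := grX (t - d * i) hy; rewrite mul1n.
move=> l hl i; apply/eqP; apply: contraT => li; exfalso.
have [i1 [li1 lt0]] := first_nonzero li.
have [x0 [nx0 ex0]] : exists x, ~ P x /\
    \sum_i l i *: (y ^+ (t - d * i) * w ^+ i : V) = w ^+ i1 * x.
  exists (iota (l i1) * y ^+ (t - d * i1) +
    \sum_(j | j != i1) iota (l j) * y ^+ (t - d * j) * w ^+ (j - i1)); split.
    move=> h; apply: (nPX y (t - d * i1)%N nPy).
    rewrite -[y ^+ _]mul1r -(rmorph1 iota) -(mulVf li1) rmorphM -mulrA; apply: idealMl => //.
    rewrite -[_ * _](addrK (\sum_(j | j != i1) iota (l j) * y ^+ (t - d * j) * w ^+ (j - i1))).
    apply: idealB => //; apply: ideal_sum => // j ne.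
    have [lt|ge] := ltnP j i1; first by rewrite lt0 // rmorph0 !mul0r; apply: ideal0.
    have : (i1 < j)%N by rewrite ltn_neqAle ge andbT; apply: contraNneq ne => e;
      apply/eqP/ord_inj.
    by rewrite -subn_gt0; case: (j - i1)%N => // s _; rewrite exprS; apply: idealMl => //;
      apply: idealMr.
  rewrite (bigD1 i1) //= mulrDr; congr (_ + _).
    by rewrite [RHS]mulrC -mulrA.
  rewrite mulr_sumr; apply: eq_bigr => j ne.
  have [lt|ge] := ltnP j i1; first by rewrite lt0 // scale0r rmorph0 !mul0r mulr0.
  by rewrite [RHS]mulrCA -exprD subnKC // -mulrA.
have iw : is_ideal (addi [set 0] (w ^+ m)) := (addi_hideal hideal_zero (grX m hw)).1.
have bJ u : span_ideal (fun i => f i ^+ q) u -> addi [set 0] (w ^+ m) (b ^+ m * u).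
  case=> r ->; rewrite mulr_sumr; apply: ideal_sum => // j _.
  have [_ [s [-> e]]] := hbf j.
  rewrite -(subnKC mq) exprD [(m * n)%N]mulnC exprM mulrCA mulrA [_ * (_ * _)]mulrA.
  apply: idealMr => //; rewrite -mulrA -exprMn e add0r exprMn.
  by apply: idealMl => //; apply: idealMl => //; apply: mem_addi; exact: hideal_zero.1.
have := hl; rewrite ex0 => /bJ[_ [s [-> e]]].
have wE : w ^+ m = w ^+ i1 * w ^+ (m - i1) by rewrite -exprD subnKC // ltnW.
move: e; rewrite add0r wE mulrCA [s * _]mulrCA => /(mulfI (expf_neq0 _ w0)) e.
have : P (b ^+ m * x0).
  rewrite e; apply: idealMl => //; have := ltn_ord i1; rewrite -subn_gt0.
  by case: (m - i1)%N => // j _; rewrite exprS; apply: idealMr.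
by move=> /pP[] //; apply: nPX.
Qed.

(** A convex sequence that is eventually zero drops by at least one at each step while it is
    positive. *)
Lemma convex_nat_seq (s : nat -> nat) (J : nat) :
  (forall j, s j.+1 + s j.+1 <= s j + s j.+2)%N ->
  (exists M, forall j, (M <= j)%N -> s j = 0%N) -> (0 < s J)%N -> (J < s 0)%N.
Proof.
move=> cv [M hM].
have dec j : (0 < s j)%N -> (s j.+1 < s j)%N.
  move=> sj; rewrite ltnNge; apply/negP => le.
  have inc n : (s j <= s (j + n))%N /\ (s (j + n) <= s (j + n).+1)%N.
    elim: n => [|n [h1 h2]]; first by rewrite addn0.
    by have := cv (j + n)%N; rewrite addnS; move: h1 h2; lia.
  by have [+ _] := inc M; rewrite (hM (j + M)%N (leq_addl _ _)); move: sj; lia.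
move=> sJ; suff : (s J + J <= s 0)%N by move: sJ; lia.
elim: J sJ => [|J IH] sJ; first by rewrite addn0.
have sJ' : (0 < s J)%N by have := cv J; have := dec J.+1 sJ; lia.
by have := IH sJ'; have := dec J sJ'; lia.
Qed.

(** * Powers of the maximal ideal, and finite colength *)

Definition grge n : set A := [set a | forall d, (d < n)%N -> comp d a = 0].

Lemma grge_ideal n : is_ideal (grge n).
Proof.
split=> [d _|a x y hx hy d dn]; first exact: comp0.
rewrite compD comp_mul (hy d dn) addr0 big1 // => i _.
by rewrite (hx (d - i)%N) ?mulr0 // (leq_ltn_trans (leq_subr _ _)).
Qed.

Lemma grgeM m n a b : grge m a -> grge n b -> grge (m + n) (a * b).
Proof.
move=> ha hb d lt; rewrite comp_mul big1 // => i _.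
have [h|h] := ltnP i m; first by rewrite ha // mul0r.
by rewrite hb ?mulr0 //; move: h lt (ltn_ord i); lia.
Qed.

Lemma grge_gr n d u : Gr d u -> (n <= d)%N -> grge n u.
Proof. by move=> hu nd j jn; rewrite (comp_id _ hu) ltn_eqF // (leq_trans jn). Qed.

Lemma grge_sub n J : is_ideal J -> Gr n `<=` J -> grge n `<=` J.
Proof.
move=> hJ h a ha; apply: hideal_comp => // d.
have [/ha ->|nd] := ltnP d n; first exact: ideal0.
by apply: (gr_sub_leq hJ nd h); apply: comp_gr.
Qed.

Lemma mm_grge a : mm a -> grge 1 a.
Proof. by move=> /mmE h [|d]. Qed.

Lemma ideal_pow_ideal (R : comNzRingType) (J : set R) n : is_ideal (ideal_pow J n).
Proof. by case: n => [|n] /=; [split|apply: ideal_genP]. Qed.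

Lemma gr_ideal_pow n : Gr n `<=` ideal_pow mm n.
Proof.
elim: n => [//|n IH]; rewrite -add1n.
apply: gr_addP; first exact: (@ideal_pow_ideal A mm n.+1).
move=> u v hu hv; apply: sub_ideal_gen; exists u, v; split=> //; last exact: IH.
exact: gr_mm hu.
Qed.

Lemma ideal_pow_sub n J : is_ideal J -> (ideal_pow mm n `<=` J) <-> (Gr n `<=` J).
Proof.
move=> hJ; split=> h; first by apply: subset_trans h; apply: gr_ideal_pow.
apply: subset_trans (grge_sub hJ h).
elim: n {h} => [|n IH]; first by move=> a _ d.
apply: ideal_gen_sub; first exact: grge_ideal.
move=> _ [x [y [hx hy ->]]]; rewrite -add1n; apply: grgeM; last exact: IH.
exact: mm_grge.
Qed.

Lemma gr_sub_colength (T : realType) I : hideal I ->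
  (quo_length T (@idfun A) setT I < +oo)%E -> exists N, Gr N `<=` I.
Proof.
move=> [hI cI] len; apply: contrapT => hno.
have hn N : ~ Gr N `<=` I by move=> h; apply: hno; exists N.
have ge n : ((n%:R)%:E <= quo_length T (@idfun A) setT I)%E.
  apply: ereal_sup_ubound; exists n => //.
  (* The ideals [I + A_(>= n - i)] increase strictly as long as no full degree lies in [I], giving
     chains of any length [n]. *)
  exists (fun i => [set x | exists j r, [/\ I j, grge (n - i) r & x = j + r]]).
  have hs m m' : (m' <= m)%N -> grge m `<=` grge m'.
    by move=> le a ha d lt; apply: ha; apply: leq_trans lt le.
  split=> i hi.
    split=> //; last by move=> x hx; exists x, 0; rewrite addr0; split=> //; apply: ideal0;
      apply: grge_ideal.
    split=> [|a _ _ [j [r [hj hr ->]]] [j' [r' [hj' hr' ->]]]].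
      exists 0, 0; rewrite addr0; split=> //; first exact: ideal0.
      by apply: ideal0; apply: grge_ideal.
    exists (a * j + j'), (a * r + r'); split; first exact: hI.2.
      exact: (grge_ideal _).2.
    by rewrite mulrDr addrACA.
  split.
    move=> _ [j [r [hj hr ->]]]; exists j, r; split=> //; apply: hs hr.
    by rewrite leq_sub2l.
  move=> h; apply: (hn (n - i.+1)%N) => u hu.
  have [|j [r [hj hr e']]] := h u.
    exists 0, u; rewrite add0r; split=> //; first exact: ideal0.
    exact: grge_gr hu _.
  have := comp_id (n - i.+1) hu; rewrite eqxx => <-.
  rewrite e' compD (hr (n - i.+1)%N) ?addr0; last by move: hi; lia.
  exact: cI.
move: len; case E : (quo_length _ _ _ _) => [x| |] // _.
- have := ge (Num.bound `|x|); rewrite E lee_fin leNgt => /negP; apply.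
  exact: le_lt_trans (ler_norm _) (archi_boundP (normr_ge0 _)).
- by have := ge 0%N; rewrite E.
Qed.

Lemma hideal_span I : hideal I -> exists (X : finType) (f : X -> A) (e : X -> nat),
  (forall i, Gr (e i) (f i)) /\ I = span_ideal f.
Proof.
move=> hI; have [X [f [e [hf If hp]]]] := hideal_gens hI.
exists X, f, e; split=> //; apply/seteqP; split=> u.
  move=> Iu; apply: hideal_comp => [|d]; first exact: span_idealP.
  by apply: (@hpiece_span _ f e d); apply: hp; [apply: comp_gr|apply: hI.2].
by case=> r ->; apply: ideal_sum => [|i _]; [exact: hI.1|apply: idealMl => //; exact: hI.1].
Qed.


(** * Rank over the subring of p-th powers *)

Variables (p : nat) (kp : p \in [pchar k]) (kperf : perfect kp).

Lemma p_prime : prime p. Proof. exact: pcharf_prime kp. Qed.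

Lemma p_gt1 : (1 < p)%N. Proof. exact: prime_gt1 p_prime. Qed.

Lemma p_pow_gt0 n : (0 < p ^ n)%N.
Proof. by rewrite expn_gt0 (ltnW p_gt1). Qed.

Lemma perfect_root (c : k) : exists b : k, b ^+ p = c.
Proof. by have [b <-] := kperf c; exists b; rewrite pFrobenius_autE. Qed.

Lemma pchar_sum (R : comNzRingType) : p \in [pchar R] ->
  forall n (I : Type) (r : seq I) (P : pred I) (F : I -> R),
  (\sum_(i <- r | P i) F i) ^+ (p ^ n) = \sum_(i <- r | P i) F i ^+ (p ^ n).
Proof.
move=> hp n I r P F; apply: (big_morph (fun x => x ^+ (p ^ n))).
  move=> x y; apply: exprDn_pchar; by rewrite pnatX pnatE ?p_prime ?hp.
by rewrite expr0n expn_eq0 -leqn0 leqNgt (ltnW p_gt1).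
Qed.

Lemma pcharA : p \in [pchar A]. Proof. exact: (rmorph_pchar iota kp). Qed.

Lemma exprp_sum (I : Type) (r : seq I) (P : pred I) (F : I -> A) :
  (\sum_(i <- r | P i) F i) ^+ p = \sum_(i <- r | P i) F i ^+ p.
Proof. by have := pchar_sum pcharA 1 r P F; rewrite expn1. Qed.

Lemma exprpN (a : A) : (- a) ^+ p = - (a ^+ p).
Proof.
apply/eqP; rewrite -subr_eq0 opprK; apply/eqP.
have := exprp_sum (index_enum bool) xpredT (fun b : bool => if b then - a else a).
by rewrite !big_bool /= addNr => <-; rewrite expr0n gtn_eqF // (ltnW p_gt1).
Qed.

(** Independence over the [p]-th powers, tested on coefficients of one degree; the [g i] share a
    degree divisible by [p]. *)
Definition indep_p (r e : nat) (g : 'I_r -> A) :=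
  (forall i, Gr (p * e) (g i)) /\
  forall t (a : 'I_r -> A), (forall i, Gr t (a i)) ->
    \sum_i a i ^+ p * g i = 0 -> forall i, a i = 0.

(** Passing from [b j] to [b j ^ p * g i] multiplies their number by [r]; scalars have [p]-th roots,
    so freeness is inherited. The degree is [e (p + ... + p ^ n)], and [t + 2 e <= 2 e p ^ n] is its
    inductive bound. *)
Lemma indep_p_free r e (g : 'I_r -> A) n : indep_p e g ->
  exists t (b : {ffun 'I_n -> 'I_r} -> V),
    [/\ (t + 2 * e <= p ^ n * (2 * e))%N, forall i, Gr t (b i) & free_mod [set 0] b].
Proof.
move=> [hg ig]; elim: n => [|n [t [b [ht hb fb]]]].
  exists 0%N, (fun=> 1); rewrite expn0 mul1n add0n; split=> //; first by move=> _; apply: gr1.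
  move=> l /= h i; move/eqP: h; rewrite (big_pred1 i); last first.
    by move=> j; rewrite /= [j](_ : _ = i) ?eqxx //; apply/ffunP => -[].
  by rewrite rs_scaleE mulr1 fmorph_eq0 => /eqP.
pose b' (x : 'I_r * {ffun 'I_n -> 'I_r}) : V := (b x.2 : A) ^+ p * g x.1.
have fb' : free_mod [set 0] b'.
  move=> l; have /choice[m hm] x := perfect_root (l x).
  rewrite /= (eq_bigr (fun x => (iota (m (x.1, x.2)) * (b x.2 : A)) ^+ p * g x.1)); last first.
    by move=> [x y] _; rewrite rs_scaleE exprMn -rmorphXn hm mulrA.
  rewrite -(pair_bigA _ (fun i j => (iota (m (i, j)) * (b j : A)) ^+ p * g i)) /=.
  under eq_bigr do rewrite -mulr_suml -exprp_sum.
  move=> h; have a0 := ig t (fun i => \sum_j iota (m (i, j)) * (b j : A)) _ h.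
  case=> i j; rewrite -hm.
  rewrite (fb (fun j => m (i, j))) ?expr0n ?gtn_eqF ?(ltnW p_gt1) //.
  rewrite /= -[RHS](a0 _ i) // => i'; apply: gr_sum => j' _; exact: grZ.
have ce : #|{ffun 'I_n.+1 -> 'I_r}| = #|{: 'I_r * {ffun 'I_n -> 'I_r}}|.
  by rewrite card_prod !card_ffun !card_ord expnS.
exists (p * t + p * e)%N, (b' \o (fun f => enum_val (cast_ord ce (enum_rank f)))); split.
- have := leq_mul2l p (t + 2 * e) (p ^ n * (2 * e)); rewrite ht orbT.
  have := p_gt1; rewrite expnS; nia.
- by move=> f; rewrite /= /b'; apply: grM => //; rewrite mulnC; apply: grX.
- apply: free_mod_reindex fb'; apply: bij_comp; first exact: enum_val_bij.
  apply: bij_comp; last exact: enum_rank_bij.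
  exact: (Bijective (cast_ordK ce) (cast_ordKV ce)).
Qed.

(* [A] has rank at most [p] over its subring of [p]-th powers in the degrees *)
(* divisible by [p]: otherwise its Hilbert function would not grow linearly. *)
Lemma indep_p_le r e (g : 'I_r -> A) : indep_p e g -> (r <= p)%N.
Proof.
move=> hg; rewrite leqNgt; apply/negP => pr.
have [K hK] := hilbert_linear.
pose M := (K * (2 * e + 1))%N.
(* [r ^ n] independent forms in a degree of order [p ^ n], against linear growth. *)
have bnd n : (p.+1 ^ n <= M * p ^ n)%N.
  have [t [b [ht hb fb]]] := indep_p_free n hg.
  have : (#|{ffun 'I_n -> 'I_r}| <= K * t.+1)%N.
    exact: (free_le_spanned (ideal_linsub iota hideal_zero.1) hb fb (hK t)).
  rewrite card_ffun !card_ord => h.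
  apply: leq_trans (leq_trans h _).
    by case: (posnP n) => [->|n0]; rewrite ?expn0 // leq_exp2r.
  rewrite /M -mulnA leq_mul2l; apply/orP; right.
  have : (0 < p ^ n)%N by rewrite expn_gt0 (ltnW p_gt1).
  by move: ht; nia.
(* Bernoulli's inequality for [(1 + 1 / p) ^ n]. *)
have bern n : ((p + n) * p ^ n <= p * p.+1 ^ n)%N.
  elim: n => [|n IH]; first by rewrite !expn0 addn0.
  have p1 := p_gt1; rewrite !expnS.
  have : ((p + n) * p ^ n * p.+1 <= p * p.+1 ^ n * p.+1)%N by rewrite leq_mul2r IH orbT.
  have : (0 < p ^ n)%N by rewrite expn_gt0 (ltnW p1).
  by move: (p ^ n)%N (p.+1 ^ n)%N => u v; nia.
have := bern (p * M).+1; have := bnd (p * M).+1.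
have : (0 < p ^ (p * M).+1)%N by rewrite expn_gt0 (ltnW p_gt1).
by move: (p ^ _)%N (p.+1 ^ _)%N => u v; nia.
Qed.

Lemma indep_p_max : exists r e (g : 'I_r -> A), indep_p e g /\
  forall r' e' (g' : 'I_r' -> A), indep_p e' g' -> (r' <= r)%N.
Proof.
pose P r := `[< exists e (g : 'I_r -> A), indep_p e g >].
have exP : exists r, P r.
  by exists 0%N; apply/asboolP; exists 0%N, (fun=> 0); split=> [[]|? ? ? ? []].
have ubP r : P r -> (r <= p)%N by move=> /asboolP[e [g]]; apply: indep_p_le.
case: (ex_maxnP exP ubP) => r /asboolP[e [g hg]] mx.
by exists r, e, g; split=> // r' e' g' h; apply: mx; apply/asboolP; exists e', g'.
Qed.

(** Powers of a linear form bring [b] and the [g i] to a common degree; by maximality there is a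
    relation, and its coefficient at [b] is nonzero since the [g i] are independent. *)
Lemma indep_p_dep r e (g : 'I_r -> A) : indep_p e g ->
  (forall r' e' (g' : 'I_r' -> A), indep_p e' g' -> (r' <= r)%N) ->
  forall e' b, Gr (p * e') b -> exists t c (h : 'I_r -> A),
    [/\ Gr (t + e) c, c != 0, forall i, Gr (t + e') (h i) &
        c ^+ p * b = \sum_i h i ^+ p * g i].
Proof.
move=> [hg ig] mx e' b hb; have [y hy y0] := gr1_nonzero.
have hyn n : Gr n (y ^+ n) by have := grX n hy; rewrite mul1n.
pose G (i : 'I_r.+1) := if unlift ord0 i is Some j then y ^+ (p * e') * g j
  else y ^+ (p * e) * b.
have hG' i : Gr (p * (e + e')) (G i).
  rewrite mulnDr /G; case: (unlift ord0 i) => [j|]; last exact: grM.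
  by rewrite addnC; apply: grM.
have : ~ indep_p (e + e') G by move=> /mx; rewrite ltnn.
move=> /not_andP[//|/existsNP[t /existsNP[a /not_implyP[ha]]]].
move=> /not_implyP[/[!big_ord_recl] eG /existsNP[i0 ai0]].
pose a' j := a (lift ord0 j).
have {}eG : (a ord0 * y ^+ e) ^+ p * b + \sum_j (a' j * y ^+ e') ^+ p * g j = 0.
  rewrite -[RHS]eG /G unlift_none !exprMn -!exprM mulrA [(e * p)%N]mulnC; congr (_ + _).
  by apply: eq_bigr => j _; rewrite liftK exprMn -exprM mulrA [(e' * p)%N]mulnC.
have a00 : a ord0 != 0.
  apply/eqP => a00; apply: ai0; case: (unliftP ord0 i0) => [j ->|-> //].
  move: eG; rewrite a00 mul0r expr0n gtn_eqF ?(ltnW p_gt1) // mul0r add0r => eG.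
  have := ig (t + e')%N (fun j => a' j * y ^+ e') _ eG j.
  move=> /(_ _)/eqP; rewrite mulf_eq0 expf_eq0 (negPf y0) andbF orbF => h.
  by apply/eqP/h => j'; exact: grM (ha _) (hyn _).
exists t, (a ord0 * y ^+ e), (fun j => - (a' j * y ^+ e')); split.
- exact: grM.
- by rewrite mulf_neq0 // expf_neq0.
- by move=> i; apply: grN; exact: grM (ha _) (hyn _).
apply/eqP; rewrite -subr_eq0 -sumrN.
by under eq_bigr do rewrite exprpN mulNr opprK; apply/eqP.
Qed.

Lemma grm_sum d e (I : Type) (r : seq I) (Q : pred I) (F : I -> A) :
  (forall i, Q i -> grm d e (F i)) -> grm d e (\sum_(i <- r | Q i) F i).
Proof. by move=> h; elim/big_ind: _ => //; [apply: grm0|apply: grmD]. Qed.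

Lemma grm_mul1 d e x w : Gr 1 x -> grm d e w -> grm d.+1 e (x * w).
Proof.
rewrite /grm; case: leqP => [ed|lt] hx /=.
  by move=> hw; rewrite leqW // subSn // -[(d - e).+1]add1n; apply: grM.
move=> ->; rewrite mulr0; case: ifP => // _; exact: gr0.
Qed.

Lemma expp0 : 0 ^+ p = 0 :> A.
Proof. by rewrite expr0n gtn_eqF // (ltnW p_gt1). Qed.

(** Spanning sets of the degrees [p s] with [s] below the number of linear generators suffice: from
    there on pigeonhole splits off some [x_i ^ p]. *)
Lemma pth_span : exists (J : finType) (b : J -> A) (E : J -> nat),
  (forall j, Gr (p * E j) (b j)) /\ forall d u, Gr (p * d) u ->
  exists v : J -> A, (forall j, grm d (E j) (v j)) /\ u = \sum_j v j ^+ p * b j.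
Proof.
have [I [x [I0 hx pg]]] := pigeonhole_gr.
have [C hC] := bounded_upto (p * #|I|) hideal_zero.1.
have /choice[w hw] (s : 'I_#|I|) : exists w : 'I_C -> V,
    spans_mod (Gr (p * s) : set V) [set 0] w.
  by have := hC (p * s)%N; rewrite leq_mul2l (ltnW (ltn_ord s)) orbT => /(_ isT).
(* Spanning vectors given by [spanned] need not be homogeneous, hence the projection. *)
pose b (j : 'I_#|I| * 'I_C) : A := comp (p * j.1) (w j.1 j.2).
pose E (j : 'I_#|I| * 'I_C) : nat := j.1.
exists ('I_#|I| * 'I_C)%type, b, E; split=> [j|]; first exact: comp_gr.
have small (s : 'I_#|I|) u : Gr (p * s) u ->
    exists v : 'I_#|I| * 'I_C -> A,
      (forall j, grm s (E j) (v j)) /\ u = \sum_j v j ^+ p * b j.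
  move=> hu; have [l /= /eqP] := hw s u hu; rewrite subr_eq0 => /eqP ul.
  have /choice[m hm] i := perfect_root (l i).
  pose v (t : 'I_#|I|) i := if t == s then iota (m i) else 0.
  exists (fun j => v j.1 j.2); split.
    move=> j; rewrite /v /grm /E; case: eqP => [->|_]; last exact: grm0.
    by rewrite leqnn subnn; apply: gr_iota.
  have := comp_id (p * s) hu; rewrite eqxx => <-; rewrite {1}ul comp_sum.
  rewrite -(pair_bigA _ (fun t i => v t i ^+ p * comp (p * t) (w t i))) /=.
  rewrite (bigD1 s) //= [X in _ + X]big1 ?addr0; last first.
    move=> t /negPf ns; apply: big1 => i _.
    by rewrite /v ns expp0 mul0r.
  by apply: eq_bigr => i _; rewrite /v eqxx -rmorphXn hm rs_scaleE comp_iota.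
elim=> [|d IH] u hu; first exact: (small (Ordinal I0)).
have [lt|ge] := ltnP d.+1 #|I|; first exact: (small (Ordinal lt)).
have [||v [hv ->]] := pg p _ u _ _ hu; first exact: ltnW p_gt1.
  by rewrite mulnC leq_mul2l ge orbT.
have /choice[v' hv'] i : exists v' : 'I_#|I| * 'I_C -> A,
    (forall j, grm d (E j) (v' j)) /\ v i = \sum_j v' j ^+ p * b j.
  by apply: IH; have := hv i; rewrite mulnS addKn.
exists (fun j => \sum_i x i * v' i j); split.
  by move=> j; apply: grm_sum => i _; apply: grm_mul1 => //; have [] := hv' i.
under [RHS]eq_bigr do rewrite exprp_sum mulr_suml.
rewrite exchange_big; apply: eq_bigr => i _ /=.
rewrite (hv' i).2 mulr_suml; apply: eq_bigr => j _.
by rewrite exprMn mulrC mulrA.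
Qed.

(** Write a form as the sum of the [v j ^ p * b j]. Modulo [c j], each [v j] varies in a space of
    bounded dimension, which accounts for [C]. The remainder is a combination of the [r <= p] forms
    [g i] with [p]-th powers of forms of degree [d] as coefficients; reducing these modulo [F] costs
    [n] vectors for each [g i]. *)
Lemma frobenius_compare : exists C e, forall (I : finType) (F : I -> A) d n,
  spanned (Gr d : set V) (span_ideal F) n ->
  spanned (Gr (p * (d + e)) : set V) (span_ideal (fun i => F i ^+ p)) (p * n + C).
Proof.
have [r [e [g [hg mx]]]] := indep_p_max.
have rp := indep_p_le hg.
have [J [b [E [hb hsp]]]] := pth_span.
have /choice[tch htch] j : exists tch : nat * A * ('I_r -> A),
    [/\ Gr (tch.1.1 + e) tch.1.2, tch.1.2 != 0, forall i, Gr (tch.1.1 + E j) (tch.2 i) &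
        tch.1.2 ^+ p * b j = \sum_i tch.2 i ^+ p * g i].
  by have [t [c [h ?]]] := indep_p_dep hg mx (hb j); exists ((t, c), h).
pose t j := (tch j).1.1; pose c j := (tch j).1.2; pose h j := (tch j).2.
have /choice[C0 hC0] j : exists C, forall d, spanned (Gr d : set V) (mulgr d (t j + e) (c j)) C.
  by apply: bounded_mulgr; have [] := htch j.
pose C := \sum_j C0 j.
have hC j d : spanned (Gr d : set V) (mulgr d (t j + e) (c j)) C.
  apply: (@spanned_leq _ V _ _ (C0 j)) => //.
    by exists 0; [apply: grm0|rewrite mul0r].
  by rewrite /C (bigD1 j) //= leq_addr.
exists (#|J| * C)%N, e => I F d n [beta hbeta].
have /choice[w hw] j : exists w : 'I_C -> V, forall v, grm (d + e) (E j) v ->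
    exists (l : 'I_C -> k) (rho : A), v = \sum_s l s *: (w s : V) + rho * c j /\
      forall i, Gr d (rho * h j i).
  have [w hw] := hC j (d + e - E j)%N; exists w => v.
  rewrite /grm; case: leqP => [ed|lt] /= hv; last first.
    exists (fun=> 0), 0; split=> [|i]; last by rewrite mul0r; apply: gr0.
    by rewrite mul0r addr0 hv big1 // => s _; rewrite scale0r.
  have [l [rho hrho e']] := hw v hv; exists l, rho; split.
    by rewrite -e' addrC subrK.
  move=> i; have [_ _ /(_ i) hh _] := htch j; move: hrho; rewrite /grm.
  case: leqP => [le|_ ->]; last by rewrite mul0r => *; apply: gr0.
  move=> hrho; rewrite (_ : d = d + e - E j - (t j + e) + (t j + E j))%N; last by lia.
  exact: grM.
pose B (x : J * 'I_C + 'I_r * 'I_n) : V := match x with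
  | inl x => (w x.1 x.2 : A) ^+ p * b x.1
  | inr x => (beta x.2 : A) ^+ p * g x.1 end.
have : spanned (Gr (p * (d + e)) : set V) (span_ideal (fun i => F i ^+ p))
    #|{: J * 'I_C + 'I_r * 'I_n}|.
  apply: (@spans_spanned _ V _ _ _ B) => u hu.
  have [v [hv ->]] := hsp _ u hu.
  have /choice[lr hlr] j : exists lr : ('I_C -> k) * A,
      v j = \sum_s lr.1 s *: (w j s : V) + lr.2 * c j /\ forall i, Gr d (lr.2 * h j i).
    by have [l [rho ?]] := hw j (v j) (hv j); exists (l, rho).
  pose y i := \sum_j (lr j).2 * h j i.
  have hy i : Gr d (y i) by apply: gr_sum => j _; have [] := hlr j.
  have /choice[mu hmu] i := hbeta (y i) (hy i).
  exists (fun x => match x with inl x => (lr x.1).1 x.2 ^+ p | inr x => mu x.1 x.2 ^+ p end).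
  rewrite big_sumType /= opprD addrA.
  have iF := span_idealP (fun i => F i ^+ p).
  have -> : \sum_j v j ^+ p * b j = (\sum_(x : J * 'I_C) (lr x.1).1 x.2 ^+ p *:
      ((w x.1 x.2 : A) ^+ p * b x.1 : V)) + \sum_i y i ^+ p * g i :> A.
    rewrite -(pair_bigA _ (fun j s => (lr j).1 s ^+ p *: ((w j s : A) ^+ p * b j : V))) /=.
    have -> : \sum_i y i ^+ p * g i = \sum_j (lr j).2 ^+ p * (c j ^+ p * b j).
      under eq_bigr do rewrite exprp_sum mulr_suml.
      rewrite exchange_big; apply: eq_bigr => j _ /=.
      have [_ _ _ ->] := htch j; rewrite mulr_sumr; apply: eq_bigr => i _.
      by rewrite exprMn mulrA.
    rewrite -big_split; apply: eq_bigr => j _ /=.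
    have [{1}-> _] := hlr j.
    have := exprp_sum (index_enum bool) xpredT
      (fun z => if z then \sum_s (lr j).1 s *: (w j s : V) else (lr j).2 * c j).
    rewrite !big_bool /= => ->; rewrite mulrDl; congr (_ + _); last by rewrite exprMn mulrA.
    rewrite exprp_sum mulr_suml; apply: eq_bigr => s _.
    by rewrite !rs_scaleE exprMn rmorphXn mulrA.
  have drop (J' : set A) (a1 a2 a3 : A) : J' (a2 - a3) -> J' (a1 + a2 - a1 - a3).
    by rewrite [a1 + a2]addrC addrK.
  apply: drop.
  rewrite -(pair_bigA _ (fun i m => mu i m ^+ p *: ((beta m : A) ^+ p * g i : V))) /=.
  rewrite -sumrB; apply: ideal_sum => // i _.
  rewrite (_ : _ - _ = ((y i - \sum_m mu i m *: (beta m : V)) ^+ p : A) * g i :> A).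
    apply: idealMr => //; have [s ->] := hmu i.
    rewrite exprp_sum; apply: ideal_sum => // x _; rewrite exprMn; apply: idealMl => //.
    exact: (@mem_span_ideal _ (fun i => F i ^+ p)).
  have := exprp_sum (index_enum bool) xpredT
      (fun z => if z then y i else - (\sum_m mu i m *: (beta m : V) : A)).
  rewrite !big_bool /= => ->; rewrite mulrDl exprpN mulNr; congr (_ - _).
  rewrite exprp_sum mulr_suml; apply: eq_bigr => s _.
  by rewrite !rs_scaleE exprMn rmorphXn mulrA.
apply: spanned_leq; first exact: (ideal0 (span_idealP _)).
rewrite card_sum !card_prod !card_ord addnC leq_add2r.
by rewrite leq_mul2r rp orbT.
Qed.

(** * Frobenius powers *)

Definition frob_ideal (X : finType) (f : X -> A) n : set A := span_ideal (fun i => f i ^+ (p ^ n)).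

Lemma frob_gr (X : finType) (f : X -> A) (e : X -> nat) :
  (forall i, Gr (e i) (f i)) -> forall n i, Gr (p ^ n * e i) (f i ^+ (p ^ n)).
Proof. by move=> hf n i; rewrite mulnC; apply: grX. Qed.

Lemma frob_idealP (X : finType) (f : X -> A) n : is_ideal (frob_ideal f n). Proof. exact: span_idealP. Qed.

Lemma frob_idealX (X : finType) (f : X -> A) m n u :
  frob_ideal f m u -> frob_ideal f (m + n) (u ^+ (p ^ n)).
Proof.
move=> [r ->]; exists (fun i => r i ^+ (p ^ n)).
rewrite (pchar_sum pcharA); apply: eq_bigr => i _.
by rewrite exprMn -exprM expnD.
Qed.

Lemma frob_threshold : exists nu, forall (X : finType) (f : X -> A) m n d,
  Gr d `<=` frob_ideal f m -> Gr ((d + nu) * p ^ n) `<=` frob_ideal f (m + n).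
Proof.
have [nu hnu] := frobenius_gens; exists nu => X f m n d h.
by apply: hnu (p_pow_gt0 n) (frob_idealP _ _) _ => u /h; apply: frob_idealX.
Qed.

Lemma len_exists (X : finType) (f : X -> A) n d :
  exists l, dim_mod (Gr d : set V) (frob_ideal f n) l.
Proof.
have [m hm] := gr_fd d; have hJ := ideal_linsub iota (frob_idealP f n).
have [|l _ hl] := @dim_mod_exists _ V (Gr d) (frob_ideal f n) m hJ; last by exists l.
by apply: spanned_sub hm => // _ ->; apply: ideal0; apply: frob_idealP.
Qed.

Lemma len_frobenius (X : finType) (f : X -> A) (e : X -> nat) :
  (forall i, Gr (e i) (f i)) ->
  exists C e0, forall n d l l', (e0 <= d)%N ->
  dim_mod (Gr d : set V) (frob_ideal f n) l ->
  dim_mod (Gr (p * d) : set V) (frob_ideal f n.+1) l' -> (l' <= p * l + C)%N.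
Proof.
move=> hf; have [C1 [e0 h1]] := frobenius_compare; have [y hy y0] := gr1_nonzero.
have hye : Gr e0 (y ^+ e0) by have := grX e0 hy; rewrite mul1n.
have [C2 h2] := spanned_shift X hye (expf_neq0 _ y0).
exists (p * C2 + C1)%N, e0 => n d l l' ed /dim_mod_spanned hl hl'.
have hJ := ideal_linsub iota (frob_idealP f n.+1).
apply: (dim_mod_le hJ hl').
(* The comparison raises the degree by [e0], so it is applied in degree [d - e0], where the length
   is at most [l + C2]. *)
have := h2 _ _ (frob_gr hf n) (d - e0)%N l; rewrite subnK // => /(_ hl) /h1.
rewrite subnK // mulnDr addnA; apply: spanned_sub => // u [r ->].
by exists r; apply: eq_bigr => i _; rewrite -exprM -expnSr.
Qed.

Lemma dim_mod_cmp (M N N' : set V) l l' : linsub M -> linsub N -> linsub N' ->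
  M `&` N `<=` N' -> dim_mod M N l -> dim_mod M N' l' -> (l' <= l)%N.
Proof.
move=> hM hN hN' sub /dim_mod_spanned /(spanned_cap hM hN) h h'.
by apply: (dim_mod_le hN' h'); apply: spanned_sub h.
Qed.

(** * Lower bounds for the lengths *)

Section LowerBound.
Variables (X : finType) (f : X -> A) (e : X -> nat).
Hypothesis hf : forall i, Gr (e i) (f i).

(** Generators of large degree are set to zero, not removed, so the index type stays the same. *)
Definition low_gens (T : nat) (i : X) : A := if (e i <= T)%N then f i else 0.

Lemma low_gens_gr T i : Gr (e i) (low_gens T i).
Proof. by rewrite /low_gens; case: ifP => // _; apply: gr0. Qed.

Lemma low_gens_ideal T n : frob_ideal (low_gens T) n `<=` frob_ideal f n.
Proof.
move=> u [r ->]; exists (fun i => if (e i <= T)%N then r i else 0).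
apply: eq_bigr => i _; rewrite /low_gens; case: ifP => // _.
by rewrite expr0n expn_eq0 gtn_eqF ?(ltnW p_gt1) // mulr0 mul0r.
Qed.

Lemma low_gens_piece T n d : (forall i, (T < e i)%N -> (d < p ^ n * e i)%N) ->
  (Gr d : set A) `&` frob_ideal f n `<=` frob_ideal (low_gens T) n.
Proof.
move=> hd u [hu Ju].
have [r hr ->] := @span_ideal_hpiece _ _ (fun i => (p ^ n * e i)%N) _ _ (frob_gr hf n) hu Ju.
exists r; apply: eq_bigr => i _; rewrite /low_gens; case: leqP => // /hd lt.
by have := hr i; rewrite /grm leqNgt lt /= => ->; rewrite !mul0r.
Qed.

(** On the scale [1 / p ^ s]: no generator degree lies in [(a', b]], lengths are bounded below at
    [a], and [b] is still below the threshold. *)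
Variables (s a' a b : nat).
Hypotheses (a'a : (a' < a)%N) (ab : (a < b)%N).
Hypothesis egap : forall i, (e i * p ^ s <= a')%N \/ (b < e i * p ^ s)%N.
Hypothesis notop : exists n0, forall n, (n0 <= n)%N ->
  ~ Gr (b * p ^ n) `<=` frob_ideal f (s + n).

Let T := (a' %/ p ^ s)%N.

Lemma low_degree i : (e i <= T)%N = (e i * p ^ s <= a')%N.
Proof. by rewrite leq_divRL // p_pow_gt0. Qed.

Lemma low_piece n d : (d <= b * p ^ n)%N ->
  (Gr d : set A) `&` frob_ideal f (s + n) `<=` frob_ideal (low_gens T) (s + n).
Proof.
move=> hd; apply: low_gens_piece => i; rewrite ltnNge low_degree => nle.
have [le|lt] := egap i; first by rewrite le in nle.
rewrite expnD; apply: leq_ltn_trans hd _.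
by rewrite mulnAC ltn_pmul2r ?p_pow_gt0 // mulnC.
Qed.

Lemma len_lower_nonprimary : (forall M, ~ Gr M `<=` span_ideal (low_gens T)) ->
  exists K n0, (0 < K)%N /\ forall n l, (n0 <= n)%N ->
    dim_mod (Gr (a * p ^ n) : set V) (frob_ideal f (s + n)) l -> (p ^ n <= K * l)%N.
Proof.
move=> hM; have [P [hP [w0 Pw0 w0n] Pf nP]] := hprime_over_nonzero (low_gens_gr T) hM.
have [[iP cP] P1 pP] := hP.
have [d wd] := comp_nz w0n; set w := comp d w0 in wd.
have Pw : P w by apply: cP.
have hw : Gr d w := comp_gr d w0.
have [y hy nPy] := gr1_notin iP nP.
have [c [n [nPc n0 hc]]] := height_one_power_all hP nP Pw wd hw Pf.
exists (2 * (n * d.+1))%N, (n * d.+1)%N; split; first by rewrite !muln_gt0 n0.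
(* This [m] meets both size conditions for the independent monomials; the factor 2 in [K] absorbs
   the rounding. *)
move=> N l hN hl; pose m := (p ^ N %/ (n * d.+1))%N.
have pN : (N < p ^ N)%N by apply: ltn_expl p_gt1.
have nd : (0 < n * d.+1)%N by rewrite muln_gt0 n0.
have mle : (m * (n * d.+1) <= p ^ N)%N by apply: leq_divM.
have m1 : (1 <= m)%N by rewrite /m leq_divRL // mul1n; apply: leq_trans hN (ltnW pN).
have mgt : (p ^ N < m.+1 * (n * d.+1))%N by rewrite /m ltn_ceil.
have [||c' [hc' fc']] := @nonprimary_free P w y c n d X (low_gens T) hP Pw wd hw hy nPy nPc n0 hc
  (p ^ (s + N)) (a * p ^ N) m.
- apply: leq_trans (leq_trans _ mle) _; first by rewrite leq_mul2l leq_pmulr ?orbT.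
  by rewrite expnD leq_pmull ?p_pow_gt0.
- apply: leq_trans (leq_trans _ mle) _; last by rewrite leq_pmull // (leq_ltn_trans _ a'a).
  by rewrite leq_mul2l (leq_trans (leqnSn d)) ?leq_pmull ?orbT.
have : (m <= l)%N.
  have h := dim_mod_spanned hl.
  have hJ := ideal_linsub iota (frob_idealP (low_gens T) (s + N)).
  have h' : spanned (Gr (a * p ^ N) : set V) (frob_ideal (low_gens T) (s + N)) l.
    apply: spanned_sub (spanned_cap (gr_linsub _) (ideal_linsub iota (frob_idealP f _)) h) => //.
    by apply: low_piece; rewrite leq_mul2r (ltnW ab) orbT.
  by have := free_le_spanned hJ hc' fc' h'; rewrite card_ord.
move=> ml; apply: leq_trans (ltnW mgt) _.
rewrite [leqRHS]mulnAC leq_mul2r; apply/orP; right; move: m1 ml; lia.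
Qed.

Lemma len_lower_primary M0 : Gr M0 `<=` span_ideal (low_gens T) ->
  exists K n0, (0 < K)%N /\ forall n l, (n0 <= n)%N ->
    dim_mod (Gr (a * p ^ n) : set V) (frob_ideal f (s + n)) l -> (p ^ n <= K * l)%N.
Proof.
move=> hM0; have [N [y [z [N0 [hyz [hspl hkos]]]]]] := parameters_koszul.
have [Npos NN0 hy hz] := hyz.
have [n1 hn1] := notop.
have [nu hnu] := frob_threshold.
exists N, (maxn n1 N0); split=> // n l; rewrite geq_max => /andP[hn1n hN0] hl.
have pn : (n < p ^ n)%N by apply: ltn_expl p_gt1.
pose J := frob_ideal (low_gens T) (s + n).
have hJ : linsub (J : set V) := ideal_linsub iota (frob_idealP _ _).
have /choice[L hL] d := len_exists (low_gens T) (s + n) d.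
pose D := (a * p ^ n)%N.
have LD : (L D <= l)%N.
  apply: dim_mod_cmp hl (hL D) => //; first exact: gr_linsub.
    exact: (ideal_linsub iota (frob_idealP f _)).
  by apply: low_piece; rewrite leq_mul2r (ltnW ab) orbT.
pose sq j := L (D + j * N)%N.
(* The number of steps of length [N] that fit between degrees [a p ^ n] and [b p ^ n]. *)
pose m := ((b - a) * p ^ n %/ N)%N.
have mle : (m * N <= (b - a) * p ^ n)%N by apply: leq_divM.
have mgt : ((b - a) * p ^ n < m.+1 * N)%N by rewrite /m ltn_ceil.
have : (m < sq 0)%N.
  apply: convex_nat_seq.
  - move=> j; apply: (dim_mod_convex hyz hspl hkos (frob_gr (low_gens_gr T) (s + n)) _ _ _ _ (hL (D + j.+1 * N)%N)).
    + have : (p ^ n <= a * p ^ n)%N by rewrite leq_pmull // (leq_ltn_trans _ a'a).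
      by rewrite /D; move: pn hN0; lia.
    (* Since [a' < a], the remaining generators lie at least [p ^ n > N0] below degree [D], so the
       convexity lemma applies from [D] on. *)
    + move=> i; rewrite /low_gens low_degree; case: leqP => [le|_]; last first.
        by left; rewrite expr0n expn_eq0 gtn_eqF ?(ltnW p_gt1).
      right; rewrite /D expnD mulnAC [(p ^ s * _)%N]mulnC.
      have h1 : (e i * p ^ s * p ^ n <= a' * p ^ n)%N by rewrite leq_mul2r le orbT.
      have h2 : (a'.+1 * p ^ n <= a * p ^ n)%N by rewrite leq_mul2r a'a orbT.
      by rewrite mulSn in h2; move: h1 h2 pn hN0; lia.
    + rewrite (_ : D + j.+1 * N - N = D + j * N)%N; last by rewrite mulSn; lia.
      exact: dim_mod_spanned (hL _).
    + rewrite (_ : D + j.+1 * N + N = D + j.+2 * N)%N; last by rewrite !mulSn; lia.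
      exact: dim_mod_spanned (hL _).
  - have hnu' := hnu X (low_gens T) 0%N (s + n)%N M0.
    rewrite add0n /frob_ideal expn0 in hnu'.
    exists ((M0 + nu) * p ^ (s + n))%N => j hj.
    apply/eqP; rewrite -leqn0; apply: (dim_mod_le hJ (hL _)).
    apply: spanned_zero; first exact: frob_idealP.
    apply: gr_sub_leq (hnu' hM0); first exact: frob_idealP.
    exact: leq_trans hj (leq_trans (leq_pmulr j Npos) (leq_addl _ _)).
  (* Length zero after [m] steps would place the whole degree [b p ^ n] in the Frobenius power. *)
  - rewrite lt0n; apply/negP => /eqP L0.
    apply: (hn1 n hn1n); apply: (@gr_sub_leq _ (D + m * N)%N).
    + exact: frob_idealP.
    + have h : (a * p ^ n <= b * p ^ n)%N by rewrite leq_mul2r (ltnW ab) orbT.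
      by rewrite /D; move: mle; rewrite mulnBl; move: h; lia.
    + move=> u hu; apply: (@low_gens_ideal T); have := hL (D + m * N)%N; rewrite -/(sq m) L0.
      move=> [c [_ _ sc]]; have [l' hl'] := sc u hu.
      by rewrite big_ord0 subr0 in hl'.
rewrite /sq mul0n addn0 => mL.
have h : (p ^ n <= (b - a) * p ^ n)%N by rewrite leq_pmull // subn_gt0.
apply: leq_trans (leq_trans h (ltnW mgt)) _; rewrite mulnC leq_mul2l.
by rewrite (leq_trans mL LD) orbT.
Qed.

Lemma len_lower : exists K n0, (0 < K)%N /\ forall n l, (n0 <= n)%N ->
  dim_mod (Gr (a * p ^ n) : set V) (frob_ideal f (s + n)) l -> (p ^ n <= K * l)%N.
Proof.
have [[M hM]|hM] := pselect (exists M, Gr M `<=` span_ideal (low_gens T)).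
  exact: len_lower_primary hM.
by apply: len_lower_nonprimary => M h; apply: hM; exists M.
Qed.

End LowerBound.

Lemma frobenius_powerE (X : finType) (f : X -> A) n :
  frobenius_power (span_ideal f) (p ^ n) = frob_ideal f n.
Proof.
apply/seteqP; split.
  apply: ideal_gen_sub; first exact: frob_idealP.
  move=> _ [x hx <-]; rewrite -[n]add0n; apply: frob_idealX.
  by case: hx => r ->; exists r; apply: eq_bigr => i _; rewrite expn0 expr1.
move=> u [r ->]; have hF := @ideal_genP A [set x ^+ (p ^ n) | x in span_ideal f].
apply: (ideal_sum _ hF) => i _; apply: (idealMl _ hF); apply: sub_ideal_gen.
by exists (f i) => //; apply: mem_span_ideal.
Qed.

Lemma frob_grge (X : finType) (f : X -> A) n : span_ideal f `<=` mm ->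
  frob_ideal f n `<=` grge (p ^ n).
Proof.
move=> fm u [r ->]; apply: ideal_sum => [|i _]; first exact: grge_ideal.
apply: (idealMl _ (grge_ideal _)).
elim: (p ^ n)%N => [|m IH]; first by move=> d.
rewrite exprS -add1n; apply: grgeM => //; apply: mm_grge; apply: fm.
exact: mem_span_ideal.
Qed.

(** [I^[q]] lives in degrees at least [q], whereas every degree contains a power of a nonzero linear
    form. *)
Lemma threshold_ge (X : finType) (f : X -> A) n r : span_ideal f `<=` mm ->
  Gr r `<=` frob_ideal f n -> (p ^ n <= r)%N.
Proof.
move=> fm h; rewrite leqNgt; apply/negP => lt; have [y hy y0] := gr1_nonzero.
have hyr : Gr r (y ^+ r) by have := grX r hy; rewrite mul1n.
have /(_ r lt) := frob_grge fm (h _ hyr); rewrite (comp_id _ hyr) eqxx => /eqP.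
by rewrite expf_eq0 (negPf y0) andbF.
Qed.

(* The condition on [c] says that [Gr r] lies in the tight closure of [I^[p^m]]. *)
Lemma tight_closure_bounded (X : finType) (f : X -> A) (e : X -> nat) :
  (forall i, Gr (e i) (f i)) ->
  exists nu, forall m r c, c != 0 ->
  (forall n u, Gr r u -> frob_ideal f (m + n) (c * u ^+ (p ^ n))) ->
  exists C n0, forall n d, (n0 <= n)%N -> ((r + nu) * p ^ n <= d)%N ->
    spanned (Gr d : set V) (frob_ideal f (m + n)) C.
Proof.
(* The extra unit in [nu.+1] provides [p ^ n] further degrees, enough to absorb the degree of the
   multiplier once [n] is at least that degree. *)
move=> hf; have [nu hnu] := frobenius_gens; exists nu.+1 => m r c0 c00 hc.
have [ec cn] := comp_nz c00; set c := comp ec c0 in cn.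
have hgc : Gr ec c := comp_gr _ _.
have {}hc n u : Gr r u -> frob_ideal f (m + n) (c * u ^+ (p ^ n)).
  move=> hu; have := (span_ideal_hideal (frob_gr hf (m + n))).2 (ec + r * p ^ n)%N _ (hc n u hu).
  by rewrite (comp_mulr _ _ (grX _ hu)) /compm leq_addl addnK.
have [C hC] := bounded_mulgr hgc cn.
exists C, ec => n d hn hd.
apply: spanned_sub (hC d) => // _ [v hv ->].
have pn : (n < p ^ n)%N by apply: ltn_expl p_gt1.
have hJ : is_ideal [set a | frob_ideal f (m + n) (c * a)].
  have iF := frob_idealP f (m + n); split=> [|a x y /= hx hy].
    by rewrite /= mulr0; apply: ideal0.
  by rewrite mulrDr mulrCA; apply: iF.2.
have := hnu _ _ _ (p_pow_gt0 n) hJ (hc n).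
rewrite addnS mulSn in hd.
have ed : (ec <= d)%N by move: hd pn hn; lia.
move=> /(gr_sub_leq (n := d - ec) hJ) -/(_ _ v); rewrite mulrC; apply.
  by move: hd pn hn; lia.
by move: hv; rewrite /grm ed.
Qed.

(** * The normalization *)

Notation S := (normalization A).
Notation tn := (@to_normalization A).

Lemma tnD a b : tn (a + b) = tn a + tn b.
Proof. by apply: val_inj; rewrite /= rmorphD. Qed.

Lemma tnM a b : tn (a * b) = tn a * tn b.
Proof. by apply: val_inj; rewrite /= rmorphM. Qed.

Lemma tn1 : tn 1 = 1.
Proof. by apply: val_inj; rewrite /= rmorph1. Qed.

Lemma tn0 : tn 0 = 0.
Proof. by apply: val_inj; rewrite /= rmorph0. Qed.

Lemma tnX a n : tn (a ^+ n) = tn a ^+ n.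
Proof. by elim: n => [|n IH]; rewrite ?expr0 ?tn1 // !exprS tnM IH. Qed.

Lemma tn_sum (J : Type) (r : seq J) (P : pred J) (F : J -> A) :
  tn (\sum_(i <- r | P i) F i) = \sum_(i <- r | P i) tn (F i).
Proof. by apply: (big_morph tn tnD tn0). Qed.

Lemma tn_inj : injective tn.
Proof. by move=> a b /(congr1 val) /= /eqP; rewrite tofrac_eq => /eqP. Qed.

Lemma pcharS : p \in [pchar S].
Proof.
rewrite inE p_prime /=; apply/eqP; have : tn (p%:R) = 0.
  by rewrite (pcharf0 pcharA) tn0.
move=> <-; elim: (p) => [|n IH]; first by rewrite tn0.
by rewrite -addn1 !natrD IH tnD tn1.
Qed.

Lemma preim_ideal (K : set S) : is_ideal K -> is_ideal [set a | K (tn a)].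
Proof.
move=> hK; split=> [|a x y /= hx hy]; first by rewrite /= tn0; apply: ideal0.
by rewrite tnD tnM; apply: hK.2.
Qed.

Lemma ideal_pow_extend J n a : ideal_pow J n a -> ideal_pow (extend_ideal J) n (tn a).
Proof.
elim: n a => [//|n IH] a.
have hK := preim_ideal (@ideal_pow_ideal S (extend_ideal J) n.+1).
apply: (ideal_gen_sub hK) => _ [x [y [hx hy ->]]] /=; rewrite tnM.
apply: sub_ideal_gen; exists (tn x), (tn y); split=> //; last exact: IH.
by apply: sub_ideal_gen; exists x.
Qed.

Lemma ideal_pow_extend_sub J n (K : set S) : is_ideal K ->
  (forall a, ideal_pow J n a -> K (tn a)) -> ideal_pow (extend_ideal J) n `<=` K.
Proof.
move=> hK h; suff : ideal_pow (extend_ideal J) n `<=` extend_ideal (ideal_pow J n).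
  move=> sub; apply: subset_trans sub _; apply: (ideal_gen_sub hK) => _ [a ha <-]; exact: h.
have hE m : is_ideal (extend_ideal (ideal_pow J m)) by apply: ideal_genP.
elim: n {h} => [|n IH] /=.
  move=> x _; rewrite -[x]mulr1; apply: (idealMl _ (hE 0%N)); apply: sub_ideal_gen.
  by exists 1 => //; apply: tn1.
apply: (ideal_gen_sub (hE n.+1)) => _ [x [y [hx hy ->]]].
have [m [r [j [hj ->]]]] := ideal_genE hx.
have [m' [r' [j' [hj' ->]]]] := ideal_genE (IH _ hy).
rewrite mulr_suml; apply: (ideal_sum _ (hE n.+1)) => i _.
rewrite mulr_sumr; apply: (ideal_sum _ (hE n.+1)) => i' _.
rewrite mulrACA; apply: (idealMl _ (hE n.+1)); apply: sub_ideal_gen.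
have [a Ja <-] := hj i; have [b Jb <-] := hj' i'; exists (a * b); last exact: tnM.
by apply: sub_ideal_gen; exists a, b.
Qed.

Lemma frobenius_power_extend I q a :
  frobenius_power I q a -> frobenius_power (extend_ideal I) q (tn a).
Proof.
have hK := preim_ideal (ideal_genP [set x ^+ q | x in extend_ideal I]).
apply: (ideal_gen_sub hK) => _ [x hx <-] /=; rewrite tnX.
by apply: sub_ideal_gen; exists (tn x) => //; apply: sub_ideal_gen; exists x.
Qed.

Lemma frobenius_power_extendE (X : finType) (f : X -> A) n (x : S) :
  frobenius_power (extend_ideal (span_ideal f)) (p ^ n) x ->
  exists r : X -> S, x = \sum_i r i * tn (f i ^+ (p ^ n)).
Proof.
pose K q : set S := [set x | exists r : X -> S, x = \sum_i r i * tn (f i ^+ q)].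
have hK q : is_ideal (K q).
  split=> [|a _ _ [r ->] [r' ->]].
    by exists (fun=> 0); rewrite big1 // => i _; rewrite mul0r.
  exists (fun i => a * r i + r' i); rewrite mulr_sumr -big_split; apply: eq_bigr => i _ /=.
  by rewrite mulrDl mulrA.
move: x; apply: (ideal_gen_sub (hK (p ^ n)%N)) => _ [x hx <-].
have [r ->] : K 1%N x.
  move: x hx; apply: (ideal_gen_sub (hK 1%N)) => _ [_ [r ->] <-].
  exists (fun i => tn (r i)); rewrite tn_sum; apply: eq_bigr => i _.
  by rewrite expr1 tnM.
rewrite (pchar_sum pcharS); exists (fun i => r i ^+ (p ^ n)).
by apply: eq_bigr => i _; rewrite exprMn expr1 -tnX.
Qed.

Local Notation tofrac := (@FracField.tofrac A).

Lemma fraction_numden (z : {fraction A}) : exists x y, y != 0 /\ z * tofrac y = tofrac x.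
Proof.
elim/quotW: z => x; exists (frac x).1, (frac x).2; split; first exact: denom_ratioP.
unlock FracField.tofrac; rewrite -[LHS]FracField.pi_mul; apply/eqmodP => /=.
by rewrite /FracField.mulf /equivf !numden_Ratio ?mulr1 ?mulf_neq0 ?oner_neq0 ?denom_ratioP //=; apply/eqP; ring.
Qed.

(** One denominator serves all powers of [z = x / y]: [y ^ N] clears exponents up to the degree [N]
    of a monic equation, and the equation reduces higher ones to these. *)
Lemma integral_denominator (z : {fraction A}) : integralOver tofrac z ->
  exists c, c != 0 /\ forall n, exists a, tofrac c * z ^+ n = tofrac a.
Proof.
move=> [P mP rP]; have [x [y [y0 zy]]] := fraction_numden z.
pose N := (size P).-1.
have sP : size P = N.+1 by rewrite prednK // size_poly_gt0 monic_neq0.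
exists (y ^+ N); split; first exact: expf_neq0.
have zN : z ^+ N = - \sum_(i < N) tofrac P`_i * z ^+ i.
  have sz : (size (map_poly tofrac P) <= N.+1)%N by rewrite -sP; exact: size_poly.
  move/rootP: rP; rewrite (horner_coef_wide _ sz) big_ord_recr /=.
  rewrite coef_map /= -/N.
  have -> : P`_N = 1 by move/monicP: mP; rewrite lead_coefE.
  rewrite rmorph1 mul1r addrC => /eqP; rewrite addr_eq0 => /eqP ->; congr (- _).
  by apply: eq_bigr => i _; rewrite coef_map.
elim/ltn_ind => n IH; have [le|lt] := leqP n N.
  exists (y ^+ (N - n) * x ^+ n).
  rewrite -{1}(subnK le) exprD !rmorphM !rmorphXn /= -mulrA; congr (_ * _).
  by rewrite -exprMn mulrC zy.
have /choice[a ha] : forall i : 'I_N, exists a, tofrac (y ^+ N) * z ^+ (n - N + i) = tofrac a.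
  by move=> i; apply: IH; move: (ltn_ord i) lt; lia.
exists (- \sum_(i < N) P`_i * a i).
rewrite -{1}(subnK (ltnW lt)) exprD zN mulrN mulrN rmorphN rmorph_sum /=; congr (- _).
rewrite !mulr_sumr; apply: eq_bigr => i _.
by rewrite rmorphM /= -ha exprD; ring.
Qed.

Lemma norm_valX (x : S) n : norm_val (x ^+ n) = norm_val x ^+ n.
Proof. by elim: n => [|n IH]; rewrite ?expr0 // !exprS -IH. Qed.

Lemma normalization_denominator (J : finType) (s : J -> S) :
  exists c, c != 0 /\ forall j n, exists a, tn c * s j ^+ n = tn a.
Proof.
have /choice[c hc] j : exists c, c != 0 /\ forall n, exists a, tn c * s j ^+ n = tn a.
  have /integral_predP/integral_denominator[c [c0 hc]] := norm_valP (s j).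
  exists c; split=> // n; have [a ha] := hc n; exists a; apply: val_inj => /=.
  by rewrite -ha norm_valX.
exists (\prod_j c j); split; first by apply/prodf_neq0 => j _; have [] := hc j.
move=> j n; have [a ha] := (hc j).2 n.
exists ((\prod_(i | i != j) c i) * a); rewrite (bigD1 j) //= !tnM -ha.
by rewrite [tn (c j) * _]mulrC mulrA.
Qed.

(** Expand a basis of degree [r] with coefficients in [S] and raise to the power [p ^ n]: a common
    denominator of all powers of these coefficients brings the expansion back to [A], independently
    of [n]. *)
Lemma extended_tight_closure (X : finType) (f : X -> A) m r :
  (forall u, Gr r u -> frobenius_power (extend_ideal (span_ideal f)) (p ^ m) (tn u)) ->
  exists c, c != 0 /\
    forall n u, Gr r u -> frob_ideal f (m + n) (c * u ^+ (p ^ n)).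
Proof.
move=> hr.
have l0 : linsub ([set 0] : set V) := ideal_linsub iota hideal_zero.1.
have [m0 hm0] := gr_fd r; have [N _ [b [Mb _ sb]]] := dim_mod_exists l0 hm0.
have /choice[s hs] : forall i : 'I_N, exists s : X -> S,
    tn (b i) = \sum_j s j * tn (f j ^+ (p ^ m)).
  by move=> i; apply: frobenius_power_extendE; apply: hr; apply: Mb.
have [c [c0 hc]] := normalization_denominator (fun x : 'I_N * X => s x.1 x.2).
exists c; split=> // n u hu.
have iF := frob_idealP f (m + n).
have hb i : frob_ideal f (m + n) (c * (b i : A) ^+ (p ^ n)).
  have /choice[a ha] j := hc (i, j) (p ^ n)%N.
  exists a; apply: tn_inj; rewrite tnM tnX hs (pchar_sum pcharS) mulr_sumr tn_sum.
  apply: eq_bigr => j _; rewrite tnM -ha /= exprMn mulrA; congr (_ * _).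
  by rewrite -tnX -exprM expnD.
have [l /= /eqP] := sb u hu; rewrite subr_eq0 => /eqP ->.
rewrite (pchar_sum pcharA n (index_enum 'I_N) xpredT (fun i => iota (l i) * (b i : A))).
rewrite mulr_sumr; apply: (ideal_sum _ iF) => i _.
by rewrite exprMn mulrCA; apply: (idealMl _ iF).
Qed.

(** * Limits *)

Lemma ereal_inf_nat (T : realType) (P : set nat) m : P m -> (forall r, P r -> (m <= r)%N) ->
  ereal_inf [set ((r%:R : T)%:E) | r in P] = ((m%:R : T)%:E).
Proof.
move=> Pm mn; apply/eqP; rewrite eq_le; apply/andP; split.
  by apply: ereal_inf_lbound; exists m.
by apply: le_ereal_inf_tmp => _ [r Pr <-]; rewrite lee_fin ler_nat; apply: mn.
Qed.

Section Sequences.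
Variable T : realType.
Implicit Types (C L : T).

Lemma ppow_gt0 n : 0 < (p ^ n)%:R :> T.
Proof. by rewrite ltr0n p_pow_gt0. Qed.

Lemma div_ppow_cvg C : (fun n => C / (p ^ n)%:R) @ \oo --> (0 : T).
Proof.
have -> : (fun n => C / (p ^ n)%:R) = geometric C (p%:R^-1).
  by apply/funext => n; rewrite /= natrX exprVn.
apply: cvg_geometric; rewrite ger0_norm ?invr_ge0 // invf_lt1 ?ltr1n ?p_gt1 //.
by rewrite ltr0n (ltnW p_gt1).
Qed.

(** Adding [2 C / p ^ n] makes the sequence nonincreasing, because [2 / p <= 1]. *)
Lemma almost_decreasing_cvg (u : nat -> T) C : 0 <= C -> (forall n, 0 <= u n) ->
  (forall n, u n.+1 <= u n + C / (p ^ n)%:R) ->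
  exists L, [/\ u @ \oo --> L, 0 <= L & forall n, L <= u n + 2 * C / (p ^ n)%:R].
Proof.
move=> C0 u0 hu; pose v n := u n + 2 * C / (p ^ n)%:R.
have vS n : v n.+1 <= v n.
  rewrite /v; apply: le_trans (lerD (hu n) (lexx _)) _.
  rewrite -addrA lerD2l expnS natrM invfM.
  have h : 2 * (p%:R^-1) <= 1 :> T.
    by rewrite ler_pdivrMr ?ltr0n ?(ltnW p_gt1) // mul1r ler_nat p_gt1.
  have h' : 0 <= C / (p ^ n)%:R by rewrite mulr_ge0 // invr_ge0.
  have -> : 2 * C / (p ^ n)%:R = C / (p ^ n)%:R + C / (p ^ n)%:R by ring.
  rewrite lerD2l (_ : 2 * C * _ = (2 * p%:R^-1) * (C / (p ^ n)%:R)); last by ring.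
  by rewrite ler_piMl.
have v0 n : 0 <= v n by rewrite addr_ge0 // mulr_ge0 ?invr_ge0 // mulr_ge0.
have vd : nonincreasing_seq v by apply/nonincreasing_seqP.
have vl : has_lbound (range v) by exists 0 => _ [n _ <-].
have vc := nonincreasing_is_cvgn vd vl.
have vcv : v @ \oo --> limn v by [].
exists (limn v); split.
- have -> : u = (fun n => v n - 2 * C / (p ^ n)%:R) by apply/funext => n; rewrite /v addrK.
  rewrite -[X in _ --> X]subr0; apply: cvgB => //; exact: div_ppow_cvg.
- by apply: limr_ge => //; near=> n.
- by move=> n; apply: nonincreasing_cvgn_ge.
Unshelve. all: by end_near. Qed.

End Sequences.

Lemma dim_mod_cap (M N : set V) l : linsub M -> linsub N ->
  dim_mod M N l -> dim_mod M (M `&` N) l.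
Proof.
move=> hM hN [b [Mb fb sb]]; exists b; split=> //.
  by move=> c [_ /fb].
move=> u Mu; have [c hc] := sb u Mu; exists c; split=> //.
by apply: linsubB => //; apply: linsub_sum => // i _; apply: linsubZ.
Qed.

(** * Passage to the limit for thresholds and densities *)

Section Asymptotics.
Variables (T : realType) (X : finType) (f : X -> A) (e : X -> nat).
Hypothesis hf : forall i, Gr (e i) (f i).
Hypothesis fm : span_ideal f `<=` mm.
Hypothesis fprim : exists N, Gr N `<=` span_ideal f.

Lemma threshold_fun : exists E : nat -> nat, forall n,
  Gr (E n) `<=` frob_ideal f n /\ forall r, Gr r `<=` frob_ideal f n -> (E n <= r)%N.
Proof.
have [nu hnu] := frob_threshold; have [N hN] := fprim.
suff /choice[E hE] : forall n, exists E, Gr E `<=` frob_ideal f n /\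
  forall r, Gr r `<=` frob_ideal f n -> (E <= r)%N by exists E.
move=> n; have ex : exists r, `[< Gr r `<=` frob_ideal f n >].
  exists ((N + nu) * p ^ n)%N; apply/asboolP; have := hnu X f 0%N n N.
  by rewrite add0n {1}/frob_ideal expn0; apply.
case: (ex_minnP ex) => r /asboolP hr mn; exists r; split=> // r' hr'.
by apply: mn; apply/asboolP.
Qed.

Lemma F_thresholdE (E : nat -> nat) : (forall n,
    Gr (E n) `<=` frob_ideal f n /\ forall r, Gr r `<=` frob_ideal f n -> (E n <= r)%N) ->
  F_threshold T p (span_ideal f) mm =
    limn (fun n => (((E n).-1%:R / (p ^ n)%:R : T)%:E)).
Proof.
move=> hE; rewrite /F_threshold; congr (lim (_ @ \oo)); apply/funext => n.
have [h1 h2] := hE n.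
have E0 : (0 < E n)%N by apply: leq_trans (threshold_ge fm h1); apply: p_pow_gt0.
(* The threshold is defined with the power [r + 1], hence the predecessor; [E n] is positive. *)
rewrite (@ereal_inf_nat T _ (E n).-1).
- by rewrite -EFinM mulrC.
- rewrite /mkset prednK // frobenius_powerE.
  by apply/ideal_pow_sub => //; apply: frob_idealP.
- move=> r; rewrite /mkset frobenius_powerE => /(ideal_pow_sub _ (frob_idealP _ _)) /h2.
  by move: E0; lia.
Qed.

Lemma threshold_limit (E : nat -> nat) : (forall n,
    Gr (E n) `<=` frob_ideal f n /\ forall r, Gr r `<=` frob_ideal f n -> (E n <= r)%N) ->
  exists c K : T, [/\ (fun n => (E n)%:R / (p ^ n)%:R) @ \oo --> c, 0 < c &
    forall n, c <= (E n)%:R / (p ^ n)%:R + K / (p ^ n)%:R].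
Proof.
move=> hE; have [nu hnu] := frob_threshold.
have [||n|c [hc _ hK]] := @almost_decreasing_cvg T (fun n => (E n)%:R / (p ^ n)%:R) nu%:R.
- by [].
- by move=> n; rewrite mulr_ge0 // invr_ge0.
- have := (hE n.+1).2 ((E n + nu) * p ^ 1)%N; rewrite expn1 => h.
  have {}h : (E n.+1 <= (E n + nu) * p)%N.
    by apply: h; have := hnu X f n 1%N (E n) (hE n).1; rewrite expn1 addn1.
  rewrite -mulrDl -natrD expnS natrM invfM mulrA ler_wpM2r ?invr_ge0 //.
  by rewrite ler_pdivrMr ?ltr0n ?(ltnW p_gt1) // -natrM ler_nat.
exists c, (2 * nu%:R); split=> //.
apply: (@lt_le_trans _ _ 1) => //.
have -> : c = limn (fun n => (E n)%:R / (p ^ n)%:R : T) by symmetry; apply: cvg_lim.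
apply: limr_ge; first by apply/cvg_ex; exists c.
near=> n; rewrite ler_pdivlMr ?ppow_gt0 // mul1r ler_nat.
exact: threshold_ge fm (hE n).1.
Unshelve. all: by end_near. Qed.

Lemma quo_length_len n d l : dim_mod (Gr d : set V) (frob_ideal f n) l ->
  quo_length T iota (Gr d) (Gr d `&` frobenius_power (span_ideal f) (p ^ n)) = ((l%:R : T)%:E).
Proof.
move=> hl; rewrite frobenius_powerE.
have hM : linsub (Gr d : set V) := gr_linsub d.
have hJ : linsub (frob_ideal f n : set V) := ideal_linsub iota (frob_idealP f n).
by apply: quo_length_dim => //; [apply: linsubI|apply: dim_mod_cap].
Qed.

(** The length in degree [x q] stays bounded as [q] grows, so its quotient by [q] tends to zero. The
    hypothesis is stated over the normalization, which covers [A] as well. *)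
Lemma HK_density_zero : exists nu, forall m r (x : T),
  (forall u, Gr r u -> frobenius_power (extend_ideal (span_ideal f)) (p ^ m) (tn u)) ->
  (r + nu)%:R / (p ^ m)%:R <= x ->
  HK_density iota Gr p (span_ideal f) x = 0%E.
Proof.
have [nu hnu] := tight_closure_bounded hf; exists nu => m r x hr hx.
have [c [c0 hc]] := extended_tight_closure hr.
have [C [n0 hC]] := hnu m r c c0 hc.
rewrite /HK_density.
have /choice[L hL] N := len_exists f N (Num.truncn (x * (p ^ N)%:R)).
have -> : (fun n => (let d := Num.truncn (x * (p ^ n)%:R) in
    ((p ^ n)%:R^-1)%:E * quo_length T iota (Gr d)
      (Gr d `&` frobenius_power (span_ideal f) (p ^ n)))%E) =
    (fun n => (((L n)%:R / (p ^ n)%:R : T)%:E)).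
  by apply/funext => n; rewrite /= (quo_length_len (hL n)) -EFinM mulrC.
apply: cvg_lim => //; apply: cvg_EFin; first by near=> n.
apply: (@squeeze_cvgr _ _ _ _ (fun=> 0) (fun n => C%:R / (p ^ n)%:R)).
- near=> n; rewrite /= mulr_ge0 ?invr_ge0 //= ler_wpM2r ?invr_ge0 // ler_nat.
  have nm : (m + n0 <= n)%N by near: n; exists (m + n0)%N.
  have hJ : linsub (frob_ideal f n : set V) := ideal_linsub iota (frob_idealP f n).
  apply: (dim_mod_le hJ (hL n)).
  have := hC (n - m)%N (Num.truncn (x * (p ^ n)%:R)).
  rewrite subnKC; last by move: nm; lia.
  apply; first by move: nm; lia.
  rewrite truncn_ge_nat; last first.
    rewrite mulr_ge0 //; apply: le_trans hx; by rewrite mulr_ge0 // invr_ge0.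
  have pm := ppow_gt0 T m.
  have en : (p ^ n)%:R = (p ^ m)%:R * (p ^ (n - m))%:R :> T.
    by rewrite -natrM -expnD subnKC //; move: nm; lia.
  by rewrite en natrM mulrA ler_wpM2r // -ler_pdivrMr.
- exact: cvg_cst.
- exact: div_ppow_cvg.
Unshelve. all: by end_near. Qed.



Lemma ppow_dominates (M d : T) : 0 < d -> exists n0, forall n, (n0 <= n)%N -> M < d * (p ^ n)%:R.
Proof.
move=> d0; exists (Num.bound `|M / d|) => n hn.
rewrite mulrC -ltr_pdivrMr //; apply: le_lt_trans (ler_norm _) _.
apply: lt_trans (archi_boundP (normr_ge0 _)) _; rewrite ltr_nat.
by apply: leq_ltn_trans hn _; apply: ltn_expl p_gt1.
Qed.

Lemma p_rational_window (x0 c : T) : 0 < c -> x0 < c ->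
  exists s a : nat, [/\ x0 < a.+1%:R / (p ^ s)%:R, a.+2%:R / (p ^ s)%:R < c &
    forall i, (e i * p ^ s <= a)%N \/ (a.+2 < e i * p ^ s)%N].
Proof.
move=> c0 x0c.
(* Beyond [x1], the largest of 0, [x0] and the generator degrees below [c], no generator degree
   occurs before [c]. *)
pose x1 := \big[Order.max/Order.max 0 x0]_(i | (e i)%:R < c) (e i)%:R : T.
have x1c : x1 < c by apply/bigmax_ltP; rewrite gt_max c0.
have m1 : Order.max 0 x0 <= x1 by apply: bigmax_ge_id.
have x10 : 0 <= x1 by apply: le_trans m1; rewrite le_max lexx.
have x01 : x0 <= x1 by apply: le_trans m1; rewrite le_max lexx orbT.
have ex1 i : (e i)%:R < c -> (e i)%:R <= x1 by move=> h;
  apply: (le_bigmax_cond _ (fun i => (e i)%:R : T) h).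
(* Room for three consecutive integers between [x1 p ^ s] and [c p ^ s]: the values of [a'], [a] and
   [b] in the lower bound. *)
have [s hs] : exists s, 3 < (c - x1) * (p ^ s)%:R.
  have [|s hs] := @ppow_dominates 3 (c - x1); first by rewrite subr_gt0.
  by exists s; apply: hs.
have ps := ppow_gt0 T s.
pose y := x1 * (p ^ s)%:R; have y0 : 0 <= y by apply: mulr_ge0 => //; apply: ltW.
have /andP[ty yt] := truncn_itv y0.
have yc : y + 3 < c * (p ^ s)%:R by move: hs; rewrite mulrBl -/y; lra.
have S1 n : n.+1%:R = n%:R + 1 :> T by rewrite -addn1 natrD.
exists s, (Num.truncn y).+1; split.
- rewrite ltr_pdivlMr //; apply: le_lt_trans (_ : _ <= y) _; first by rewrite ler_pM2r.
  by apply: lt_le_trans yt _; rewrite ler_nat.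
- by rewrite ltr_pdivrMr // !S1; lra.
- move=> i; have [lt|ge] := ltP ((e i)%:R : T) c; [left|right].
    rewrite -(ler_nat T) natrM; apply: le_trans (ltW yt).
    by rewrite ler_pM2r // ex1.
  rewrite -(ltr_nat T) natrM !S1; apply: lt_le_trans (_ : c * (p ^ s)%:R <= _); first by lra.
  by rewrite ler_pM2r.
Qed.

(** The Frobenius comparison makes the normalized lengths almost decreasing, so they converge; the
    lower bound keeps the limit positive. *)
Lemma HK_density_len_neq0 (s a K n0 : nat) : (0 < K)%N ->
  (forall n l, (n0 <= n)%N ->
    dim_mod (Gr (a.+1 * p ^ n) : set V) (frob_ideal f (s + n)) l -> (p ^ n <= K * l)%N) ->
  HK_density iota Gr p (span_ideal f) (a.+1%:R / (p ^ s)%:R : T) <> 0%E.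
Proof.
move=> K0 hK; set x := _ / _.
have [C [e0 hC]] := len_frobenius hf.
have /choice[L hL] N := len_exists f N (Num.truncn (x * (p ^ N)%:R)).
rewrite /HK_density.
have -> : (fun n => (let d := Num.truncn (x * (p ^ n)%:R) in
    ((p ^ n)%:R^-1)%:E * quo_length T iota (Gr d)
      (Gr d `&` frobenius_power (span_ideal f) (p ^ n)))%E) =
    (fun n => (((L n)%:R / (p ^ n)%:R : T)%:E)).
  by apply/funext => n; rewrite /= (quo_length_len (hL n)) -EFinM mulrC.
pose n2 := maxn n0 e0.
have tr m : Num.truncn (x * (p ^ (s + m))%:R) = (a.+1 * p ^ m)%N.
  rewrite expnD natrM mulrA divfK ?gt_eqF ?ppow_gt0 // -natrM; exact: natrK.
(* Divided by [p ^ (n + n2)] instead of [p ^ (s + n + n2)]; the constant factor [p ^ s] is restored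
   after the limit is taken. *)
pose u n := (L (s + (n + n2))%N)%:R / (p ^ (n + n2))%:R : T.
have u_ge n : K%:R^-1 <= u n.
  rewrite /u ler_pdivlMr ?ppow_gt0 // mulrC ler_pdivrMr ?ltr0n // -natrM ler_nat.
  rewrite mulnC; apply: hK; last by rewrite -tr.
  by apply: leq_trans (leq_maxl n0 e0) (leq_addl _ _).
have [||n|l [hl _ _]] := @almost_decreasing_cvg T u C%:R.
- by [].
- by move=> n; rewrite mulr_ge0 // invr_ge0.
- have h : (L (s + (n.+1 + n2)) <= p * L (s + (n + n2)) + C)%N.
    apply: (hC (s + (n + n2))%N (a.+1 * p ^ (n + n2))%N).
    + have : (n + n2 < p ^ (n + n2))%N by apply: ltn_expl p_gt1.
      have : (e0 <= n2)%N by apply: leq_maxr.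
      rewrite mulSn; lia.
    + by rewrite -tr.
    + have -> : (p * (a.+1 * p ^ (n + n2)) = a.+1 * p ^ (n.+1 + n2))%N.
        by rewrite addSn expnS mulnCA.
      by have := hL (s + (n.+1 + n2))%N; rewrite tr addSn addnS.
  have pn := ppow_gt0 T (n + n2); have p0 : 0 < p%:R :> T by rewrite ltr0n (ltnW p_gt1).
  apply: (@le_trans _ _ (u n + C%:R / (p ^ (n + n2))%:R)); last first.
    rewrite lerD2l ler_wpM2l // lef_pV2 ?posrE ?ppow_gt0 // ler_nat.
    by rewrite leq_exp2l ?p_gt1 // leq_addr.
  apply: (@le_trans _ _ (u n + C%:R / (p ^ (n + n2).+1)%:R)); last first.
    rewrite lerD2l ler_wpM2l // lef_pV2 ?posrE ?ppow_gt0 // ler_nat.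
    by rewrite leq_exp2l ?p_gt1.
  rewrite /u.
  have -> : (p ^ (n.+1 + n2))%:R = p%:R * (p ^ (n + n2))%:R :> T by rewrite addSn expnS natrM.
  rewrite ler_pdivrMr ?mulr_gt0 //.
  have -> : (L (s + (n + n2)))%:R / (p ^ (n + n2))%:R + C%:R / (p%:R * (p ^ (n + n2))%:R) =
     (p%:R * (L (s + (n + n2)))%:R + C%:R) / (p%:R * (p ^ (n + n2))%:R) :> T.
    by field; rewrite !gt_eqF.
  by rewrite divfK ?gt_eqF ?mulr_gt0 // -natrM -natrD ler_nat.
have lpos : 0 < l.
  have K1 : 0 < K%:R^-1 :> T by rewrite invr_gt0 ltr0n.
  apply: lt_le_trans K1 _; have -> : l = limn u by symmetry; apply: cvg_lim.
  by apply: limr_ge; [apply/cvg_ex; exists l|near=> n].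
have -> : limn (fun n => ((L n)%:R / (p ^ n)%:R : T)%:E) = (l / (p ^ s)%:R)%:E.
  apply: cvg_lim => //; rewrite -(cvg_shiftn (n2 + s)).
  apply: cvg_EFin; first by near=> n.
  have -> : fine \o (fun n => ((L (n + (n2 + s))%N)%:R / (p ^ (n + (n2 + s)))%:R : T)%:E) =
     (fun n => u n * (p ^ s)%:R^-1).
    apply/funext => n; rewrite /= /u.
    have -> : (n + (n2 + s) = s + (n + n2))%N by lia.
    by rewrite expnD natrM invfM mulrAC mulrA.
  by apply: cvgMr_tmp.
by case=> /eqP; rewrite mulf_eq0 invr_eq0 !gt_eqF // ppow_gt0.
Unshelve. all: by end_near. Qed.

Lemma HK_density_nonzero (E : nat -> nat) (c K x0 : T) : (forall n,
    Gr (E n) `<=` frob_ideal f n /\ forall r, Gr r `<=` frob_ideal f n -> (E n <= r)%N) ->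
  (forall n, c <= (E n)%:R / (p ^ n)%:R + K / (p ^ n)%:R) -> 0 < c -> x0 < c ->
  exists x, [/\ x0 < x, 0 <= x & HK_density iota Gr p (span_ideal f) x <> 0%E].
Proof.
move=> hE hc c0 x0c; have [s [a [xa bc gap]]] := p_rational_window c0 x0c.
exists (a.+1%:R / (p ^ s)%:R); split=> //.
have ps := ppow_gt0 T s.
(* Otherwise [c p ^ s - (a + 2)], a positive number, would be at most [K / p ^ n] for arbitrarily
   large [n]. *)
have notop : exists n0, forall n, (n0 <= n)%N ->
    ~ Gr (a.+2 * p ^ n) `<=` frob_ideal f (s + n).
  have [|n0 hn0] := @ppow_dominates K (c * (p ^ s)%:R - a.+2%:R).
    by rewrite subr_gt0 -ltr_pdivrMr.
  exists n0 => n hn /(hE _).2 hle; have := hn0 n hn; rewrite ltNge => /negP; apply.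
  have := hc (s + n)%N; rewrite -mulrDl ler_pdivlMr ?ppow_gt0 // expnD natrM => h.
  rewrite mulrBl lerBlDl -mulrA; apply: le_trans h _.
  by rewrite lerD2r -natrM ler_nat.
have [K1 [n0 [K10 hK1]]] := len_lower hf (ltnSn a) (ltnSn a.+1) gap notop.
exact: (HK_density_len_neq0 K10 hK1).
Qed.

Lemma HK_alphaE (E : nat -> nat) (c K : T) : (forall n,
    Gr (E n) `<=` frob_ideal f n /\ forall r, Gr r `<=` frob_ideal f n -> (E n <= r)%N) ->
  (fun n => (E n)%:R / (p ^ n)%:R) @ \oo --> c ->
  (forall n, c <= (E n)%:R / (p ^ n)%:R + K / (p ^ n)%:R) -> 0 < c ->
  HK_alpha T iota Gr p (span_ideal f) = c%:E.
Proof.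
move=> hE hcv hc c0; apply/eqP; rewrite eq_le; apply/andP; split.
  apply: ge_ereal_sup => _ [x [x0 hx] <-]; rewrite lee_fin.
  have [nu hnu] := HK_density_zero.
  have ub m : x <= (E m)%:R / (p ^ m)%:R + nu%:R / (p ^ m)%:R.
    rewrite -mulrDl -natrD leNgt; apply/negP => lt; apply: hx.
    apply: (hnu m (E m)); last exact: ltW.
    by move=> u /(hE m).1; rewrite -frobenius_powerE; apply: frobenius_power_extend.
  have hl : (fun m => (E m)%:R / (p ^ m)%:R + nu%:R / (p ^ m)%:R) @ \oo --> c.
    by rewrite -[c]addr0; apply: cvgD hcv (div_ppow_cvg _).
  have -> : c = limn (fun m => (E m)%:R / (p ^ m)%:R + nu%:R / (p ^ m)%:R : T).
    by symmetry; apply: cvg_lim.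
  by apply: limr_ge; [apply/cvg_ex; exists c|near=> m].
rewrite leNgt; apply/negP => lt.
(* A single point of nonzero density rules out the value minus infinity. *)
have ge0 : (0 <= HK_alpha T iota Gr p (span_ideal f) :> \bar T)%E.
  have [x [_ x0 hx]] := HK_density_nonzero hE hc c0 c0.
  apply: (@le_trans _ _ x%:E); first by rewrite lee_fin.
  by apply: ereal_sup_ubound; exists x.
case eqa : (HK_alpha T iota Gr p (span_ideal f)) => [x0| |]; rewrite eqa // in lt ge0.
rewrite lte_fin in lt; have [x [x0x xge hx]] := HK_density_nonzero hE hc c0 lt.
have : (x%:E <= HK_alpha T iota Gr p (span_ideal f))%E by apply: ereal_sup_ubound; exists x.
by rewrite eqa lee_fin leNgt x0x.
Unshelve. all: by end_near. Qed.

Lemma F_threshold_extendE (E : nat -> nat) (c K : T) : (forall n,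
    Gr (E n) `<=` frob_ideal f n /\ forall r, Gr r `<=` frob_ideal f n -> (E n <= r)%N) ->
  (fun n => (E n)%:R / (p ^ n)%:R) @ \oo --> c ->
  (forall n, c <= (E n)%:R / (p ^ n)%:R + K / (p ^ n)%:R) -> 0 < c ->
  F_threshold T p (extend_ideal (span_ideal f)) (extend_ideal mm) = c%:E.
Proof.
move=> hE hcv hc c0; have [nu hnu] := HK_density_zero.
pose Q n r := ideal_pow (extend_ideal mm) r.+1 `<=`
  frobenius_power (extend_ideal (span_ideal f)) (p ^ n).
have E0 n : (0 < E n)%N.
  by apply: leq_trans (threshold_ge fm (hE n).1); apply: p_pow_gt0.
have QE n : Q n (E n).-1.
  apply: ideal_pow_extend_sub; first exact: ideal_genP.
  move=> a; rewrite prednK // => ha; apply: frobenius_power_extend.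
  rewrite frobenius_powerE; move: a ha; apply/ideal_pow_sub; first exact: frob_idealP.
  exact: (hE n).1.
have [D hD] : exists D : nat -> nat, forall n, Q n (D n) /\ forall r, Q n r -> (D n <= r)%N.
  suff /choice[D hD] : forall n, exists D, Q n D /\ forall r, Q n r -> (D <= r)%N by exists D.
  move=> n; have ex : exists r, `[< Q n r >] by exists (E n).-1; apply/asboolP.
  case: (ex_minnP ex) => r /asboolP hr mn; exists r; split=> // r' hr'.
  by apply: mn; apply/asboolP.
(* [D n] refers to the power [D n + 1], so the density vanishes from [(D n + 1 + nu) / p ^ n] on,
   which therefore cannot be below [c]. *)
have lb n : c <= (D n)%:R / (p ^ n)%:R + (1 + nu)%:R / (p ^ n)%:R.
  rewrite -mulrDl -natrD addnA addn1 leNgt; apply/negP => lt.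
  have [x [x0 _ hx]] := HK_density_nonzero hE hc c0 lt; apply: hx.
  apply: (hnu n (D n).+1); last exact: ltW.
  move=> u hu; apply: (hD n).1; apply: ideal_pow_extend; exact: gr_ideal_pow hu.
have ub n : (D n)%:R / (p ^ n)%:R <= (E n)%:R / (p ^ n)%:R :> T.
  rewrite ler_wpM2r ?invr_ge0 // ler_nat; apply: leq_trans ((hD n).2 _ (QE n)) _.
  exact: leq_pred.
rewrite /F_threshold.
have -> : (fun n => (((p ^ n)%:R^-1)%:E * ereal_inf [set (r%:R)%:E | r in
    [set r : nat | ideal_pow (extend_ideal mm) r.+1 `<=`
      frobenius_power (extend_ideal (span_ideal f)) (p ^ n)]])%E) =
  (fun n => ((D n)%:R / (p ^ n)%:R : T)%:E).
  apply/funext => n; rewrite (@ereal_inf_nat T _ (D n)); last exact: (hD n).2.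
    by rewrite -EFinM mulrC.
  exact: (hD n).1.
apply: cvg_lim => //; apply: cvg_EFin; first by near=> n.
apply: (@squeeze_cvgr _ _ _ _ (fun n => c - (1 + nu)%:R / (p ^ n)%:R)
  (fun n => (E n)%:R / (p ^ n)%:R)) => //.
- by near=> n; rewrite /= ub lerBlDr lb.
- by rewrite -[X in _ --> X]subr0; apply: cvgB; [exact: cvg_cst|exact: div_ppow_cvg].
Unshelve. all: by end_near. Qed.

Lemma F_threshold_main :
  F_threshold T p (span_ideal f) mm = HK_alpha T iota Gr p (span_ideal f) /\
  F_threshold T p (span_ideal f) mm =
    F_threshold T p (extend_ideal (span_ideal f)) (extend_ideal mm).
Proof.
have [E hE] := threshold_fun; have [c [K [hcv c0 hc]]] := threshold_limit hE.
have -> : F_threshold T p (span_ideal f) mm = c%:E.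
  rewrite (F_thresholdE hE); apply: cvg_lim => //; apply: cvg_EFin; first by near=> n.
  have -> : fine \o (fun n => ((E n).-1%:R / (p ^ n)%:R : T)%:E) =
      (fun n => (E n)%:R / (p ^ n)%:R - 1 / (p ^ n)%:R).
    apply/funext => n /=; rewrite -mulrBl; congr (_ / _).
    have E0 : (0 < E n)%N by apply: leq_trans (threshold_ge fm (hE n).1); apply: p_pow_gt0.
    by rewrite -{2}(prednK E0) -addn1 natrD addrK.
  by rewrite -[X in _ --> X]subr0; apply: cvgB hcv (div_ppow_cvg _).
by rewrite (HK_alphaE hE hcv hc c0) (F_threshold_extendE hE hcv hc c0).
Unshelve. all: by end_near. Qed.

End Asymptotics.

End Graded.

Theorem theoremC (T : realType) (k : fieldType) (p : nat)
    (kp : p \in [pchar k]%R) (kperf : perfect kp)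
    (A : idomainType) (iota : {rmorphism k -> A}) (Gr : nat -> set A)
    (I : set A) (AI : standard_graded_pair T iota Gr I) (dimA : krull_dim A 2) :
  let m := graded_maximal Gr in
  F_threshold T p I m = HK_alpha T iota Gr p I /\
  F_threshold T p I m = F_threshold T p (extend_ideal I) (extend_ideal m).
Proof.
case: AI => nA hG hI Im len.
have hI' : hideal Gr I by apply/(hidealE hG).
have [X [f [e [hf eI]]]] := hideal_span hG nA hI'.
have fprim := gr_sub_colength hG hI' len.
rewrite eI in Im fprim *.
exact: (F_threshold_main hG nA dimA kperf T hf Im fprim).
Qed.
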